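(* The left-hand column of each homogeneous variational bicomplex is locally exact, modulo pullbacks. That is, let $k>-m$ be an integer and let $s_0=\max(0,-k)$. The column \[ 0\to\overline\Omega^{0,s_0}_{k+s_0}\xrightarrow{d_{\mathrm T}}\overline\Omega^{0,s_0+1}_{k+s_0+1}\xrightarrow{d_{\mathrm T}}\cdots\xrightarrow{d_{\mathrm T}}\overline\Omega^{0,m}_{k+m}\xrightarrow{p_0}\overline\Xi^0_{k+m}\to0,\qquad \overline\Xi^0_{k+m}=\overline\Omega^{0,m}_{k+m}/d_{\mathrm T}\overline\Omega^{0,m-1}_{k+m-1}, \] is locally exact modulo pullbacks: exactness at the last two nonzero terms holds by definition of the quotient, and for $s_0\le s\le m-1$, if $U\subset\mathcal F^{k+s}$ is open and $\Phi\in\Omega^{0,s}_{k+s}(U)$ is such that $d_{\mathrm T}\Phi$ is locally a constant element of $\bigwedge^{s+1}\mathbf R^{m*}$, then: (1) if $s=s_0$, $\Phi$ is locally a constant element of $\bigwedge^{s_0}\mathbf R^{m*}$; (2) if $s>s_0$, there is $l>k+s$ such that every $b\in\mathcal F^l$ lying over $U$ has an open neighbourhood $W$ in $\mathcal F^l$, lying over $U$, together with an open set $W'\subset\mathcal F^{l-1}$ containing $\tau^{l,l-1}(W)$, a function $\Psi\in\Omega^{0,s-1}_{l-1}(W')$ and a constant $c\in\bigwedge^s\mathbf R^{m*}$, with $(\tau^{l,k+s})^*\Phi=d_{\mathrm T}\Psi+c$ on $W$.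
   Context: $E$ is a smooth manifold with local coordinates $(u^\alpha)$, $m\ge1$. For $k\ge0$, $\mathcal F^k=\mathcal F^k_{(m)}E$ is the manifold of $k$-jets $j^k_0\gamma$ at $0\in\mathbf R^m$ of immersions $\gamma$ from a neighbourhood of $0$ in $\mathbf R^m$ to $E$, with local coordinates $u^\alpha_I(j^k_0\gamma)=\partial^{|I|}(u^\alpha\circ\gamma)/\partial t^I(0)$ for multi-indices $I\in\mathbf N^m$, $0\le|I|\le k$; $\tau^{l,k}:\mathcal F^l\to\mathcal F^k$ ($l\ge k$) is the projection. $1_i$ is the multi-index with $1$ in position $i$ and $0$ elsewhere. For $U\subset\mathcal F^k$ open, $\Omega^{r,s}_k(U)=\Omega^r(U)\otimes\bigwedge^s\mathbf R^{m*}$ is the space of $r$-forms on $U$ with values in $\bigwedge^s\mathbf R^{m*}$; $dt^1,\dots,dt^m$ is the standard basis of $\mathbf R^{m*}$. The total derivative $d_i:\Omega^r(U)\to\Omega^r((\tau^{k+1,k})^{-1}(U))$ is the degree-zero derivation along the pullback map, commuting with $d$, given on functions by $d_if=\sum_{|I|=0}^ku^\alpha_{I+1_i}\,\partial f/\partial u^\alpha_I$. The total exterior derivative is $d_{\mathrm T}:\Omega^{r,s}_k(U)\to\Omega^{r,s+1}_{k+1}((\tau^{k+1,k})^{-1}(U))$, $d_{\mathrm T}(\theta\otimes w)=d_i\theta\otimes(dt^i\wedge w)$ (summed over $i$). $\overline\Omega^{0,s}=\Omega^{0,s}/\bigwedge^s\mathbf R^{m*}$ is the quotient by the constant vector-valued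 functions, on which $d_{\mathrm T}$ is well defined. The homogeneous variational bicomplex of index $k>-m$ has as columns (indexed by the form degree $r\ge0$) the complexes of the $\Omega^{r,s}_{k+s}$ (of the $\overline\Omega^{0,s}_{k+s}$ if $r=0$) under $d_{\mathrm T}$, for those $s\in\{0,\dots,m\}$ with $k+s\ge0$, followed by the quotient by the image of the last $d_{\mathrm T}$; its horizontal maps are induced by $d$. The left-hand column is the one with $r=0$. ''Locally'' means that the symbols are read as sheaves of germs; ''modulo pullbacks'' means that a germ in the kernel lies in the image after pulling back to a frame bundle of sufficiently high order. *)

(* Defs.v *)
From HB Require Import structures.
From mathcomp Require Import all_boot all_order all_algebra.
From mathcomp Require Import all_classical all_reals all_analysis.

Set Implicit Arguments.
Unset Strict Implicit.
Unset Printing Implicit Defensive.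

Import Order.TTheory GRing.Theory Num.Theory numFieldNormedType.Exports.

Local Open Scope quotient_scope.
Local Open Scope classical_set_scope.
Local Open Scope ring_scope.

Section Smooth.
Context {R : realType} {V W : normedModType R}.

(* [f] is of class C^j on the set [U], which is meant to be open. *)
Fixpoint of_class (j : nat) (U : set V) (f : V -> W) : Prop :=
  if j is j'.+1 then
    (forall a, U a -> differentiable f a) /\
    (forall v, of_class j' U (fun a => 'D_v f a))
  else forall a, U a -> {for a, continuous f}.

Definition smooth (U : set V) (f : V -> W) : Prop :=
  forall j, of_class j U f.

End Smooth.

Section Manifold.
Context {R : realType} {n : nat} {E : topologicalType}.

(* A homeomorphism from an open subset of E to an open subset of R^n; [cmap]
   and [cinv] are total functions whose values outside of [cdom] and of
   [cmap @` cdom] are irrelevant. *)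
Record chart := Chart {
  cdom : set E ;
  cmap :> E -> 'rV[R]_n ;
  cinv : 'rV[R]_n -> E ;
  cdom_open : open cdom ;
  cimg_open : open (cmap @` cdom) ;
  cmapK : forall p, cdom p -> cinv (cmap p) = p ;
  cmap_cts : forall p, cdom p -> {for p, continuous cmap} ;
  cinv_cts : forall p, cdom p -> {for cmap p, continuous cinv}
}.

End Manifold.

Arguments chart R n E : clear implicits.

Record smooth_manifold (R : realType) (n : nat) (E : topologicalType) :=
  SmoothManifold {
  atlas : set (chart R n E) ;
  atlas_cover : forall p, exists2 x, atlas x & cdom x p ;
  atlas_compat : forall x y, atlas x -> atlas y ->
    smooth (x @` (cdom x `&` cdom y)) (y \o cinv x) ;
  manifold_hausdorff : hausdorff_space E ;
  manifold_second_countable : @second_countable E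
}.

Definition chart_at (R : realType) (n : nat) (E : topologicalType)
  (M : smooth_manifold R n E) (p : E) : chart R n E :=
  sval (cid2 (atlas_cover M p)).

Definition mindex (m : nat) := {ffun 'I_m -> nat}.

Definition mlen (m : nat) (I : mindex m) : nat := (\sum_(i < m) I i)%N.

(* I + 1_i *)
Definition mincr (m : nat) (I : mindex m) (i : 'I_m) : mindex m :=
  [ffun j => (I j + (j == i))%N].

Definition bmindex (m k : nat) : finType :=
  {I : {ffun 'I_m -> 'I_k.+1} | (\sum_(i < m) I i <= k)%N}.

Definition mindex_of (m k : nat) (I : bmindex m k) : mindex m :=
  [ffun i => val (val I i)].

(* The partial derivative of multi-index I; the order in which the variables are
   taken is immaterial on smooth functions. *)
Definition mpartial (R : realType) (m : nat) (I : mindex m)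
    (f : 'rV[R]_m -> R^o) : 'rV[R]_m -> R^o :=
  foldr (fun i g => iter (I i) (fun h => 'D_(delta_mx 0 i) h) g) f (enum 'I_m).

Section Frames.
Context {R : realType} {n : nat} {E : topologicalType}.
Variables (M : smooth_manifold R n E) (m : nat).

(* Maps which are an immersion on some neighbourhood of 0. *)
Definition is_immersion (g : 'rV[R]_m -> E) : Prop :=
  exists V : set 'rV[R]_m, [/\ open V, V 0,
    forall t, V t -> {for t, continuous g} &
    forall x, atlas M x ->
      smooth (V `&` g @^-1` cdom x) (x \o g) /\
      (forall t, V t -> cdom x (g t) -> injective ('d (x \o g) t))].

Definition immersion := {g : 'rV[R]_m -> E | `[< is_immersion g >]}.

(* The derivative of multi-index I at 0 of the coordinate u^al o g. *)
Definition dcoord (x : chart R n E) (g : immersion) (al : 'I_n)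
    (I : mindex m) : R :=
  mpartial I (fun t => x (val g t) 0 al) 0.

Definition same_jet (k : nat) (g h : immersion) : bool :=
  `[< val g 0 = val h 0 /\
      forall x, atlas M x -> cdom x (val g 0) ->
      forall al (I : mindex m), (mlen I <= k)%N ->
        dcoord x g al I = dcoord x h al I >].

Lemma same_jet_refl k : reflexive (same_jet k).
Proof. by move=> g; apply/asboolP. Qed.

Lemma same_jet_sym k : symmetric (same_jet k).
Proof.
move=> g h; apply/asboolP/asboolP => -[e gh]; split=> // x Mx xp al I Ik.
  by rewrite gh// e.
by rewrite gh// e.
Qed.

Lemma same_jet_trans k : transitive (same_jet k).
Proof.
move=> h g f /asboolP[e gh] /asboolP[e' hf]; apply/asboolP; split.
  by rewrite e.
by move=> x Mx xp al I Ik; rewrite gh// hf// -e.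
Qed.

Canonical same_jet_equiv (k : nat) :=
  EquivRel (same_jet k) (@same_jet_refl k) (@same_jet_sym k)
    (@same_jet_trans k).

(* The frame bundle F^k of k-jets at 0. *)
Definition frame (k : nat) := {eq_quot (same_jet_equiv k)}.
HB.instance Definition _ k := Choice.on (frame k).

Definition jet (k : nat) (g : immersion) : frame k := \pi_(frame k) g.

(* The projection F^l -> F^k; only meaningful for l >= k. *)
Definition tau (l k : nat) (j : frame l) : frame k := jet k (repr j).

Definition base (k : nat) (j : frame k) : E := val (repr j) 0.

Definition fdom (k : nat) (x : chart R n E) : set (frame k) :=
  [set j | cdom x (base j)].

(* The coordinate u^al_I, for |I| <= k. *)
Definition ucoord (k : nat) (x : chart R n E) (j : frame k) (al : 'I_n)
  (I : mindex m) : R := dcoord x (repr j) al I.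

Definition fcoord (k : nat) (x : chart R n E) (j : frame k) :
    'M[R]_(n, #|bmindex m k|) :=
  \matrix_(al, e) ucoord x j al (mindex_of (enum_val e)).

(* The manifold topology of F^k: the coordinate systems [fcoord x], which have
   open images, are homeomorphisms. *)
HB.instance Definition _ (k : nat) :=
  @isSubBaseTopological.Build (frame k) (set (frame k))
    [set B | exists x A, [/\ atlas M x, open A &
                           B = fdom x `&` fcoord x @^-1` A]] id.

(* The expression of a function on F^k in the coordinates [fcoord x]; it is 0
   off the image of [fcoord x]. *)
Definition frep (k : nat) (x : chart R n E) (f : frame k -> R) :
    'M[R]_(n, #|bmindex m k|) -> R^o :=
  fun z =>
    if pselect (exists j : frame k, fdom x j /\ fcoord x j = z) is left h
    then f (projT1 (cid h)) else 0.

Definition smooth_fun (k : nat) (U : set (frame k)) (f : frame k -> R) : Prop :=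
  forall x, atlas M x -> smooth (fcoord x @` (U `&` fdom x)) (frep x f).

(* The total derivative on functions, computed at each point in one chart of
   the atlas; by the chain rule any other chart gives the same value wherever
   [f] is smooth near the projected point. *)
Definition total_derivative (k : nat) (i : 'I_m) (f : frame k -> R) :
    frame k.+1 -> R :=
  fun j =>
    let x := chart_at M (base j) in
    \sum_(al < n) \sum_(I : bmindex m k)
      ucoord x j al (mincr (mindex_of I) i) *
      'D_(delta_mx al (enum_rank I)) (frep x f) (fcoord x (tau k j)).

(* The s-element subsets A of {1..m}; A = {a_1 < ... < a_s} stands for the basis
   vector dt^A = dt^(a_1) /\ ... /\ dt^(a_s) of the s-th exterior power. *)
Definition sset (s : nat) : finType := {A : {set 'I_m} | #|A| == s}.

(* Elements of the s-th exterior power of R^m*, by their coordinates. *)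
Definition ext (s : nat) := {ffun sset s -> R}.

(* dt^i /\ w: moving dt^i past the dt^j with j < i gives the sign in
   dt^i /\ dt^A = +- dt^(A + i), while dt^i /\ dt^A = 0 if i is in A. *)
Definition dt_wedge (s : nat) (i : 'I_m) (w : ext s) : ext s.+1 :=
  [ffun B : sset s.+1 =>
    \sum_(A : sset s | (i \notin val A) && (val B == i |: val A)%SET)
      (-1) ^+ #|[set j in val A | (j < i)%N]%SET| * w A].

Definition smooth_form (k s : nat) (U : set (frame k)) (Phi : frame k -> ext s)
    : Prop :=
  forall A, smooth_fun U (fun j => Phi j A).

Definition dT (k s : nat) (Phi : frame k -> ext s) : frame k.+1 -> ext s.+1 :=
  fun j => \sum_(i < m)
    dt_wedge i [ffun A => total_derivative i (fun j' => Phi j' A) j].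

Definition locally_constant (k s : nat) (U : set (frame k))
    (Phi : frame k -> ext s) : Prop :=
  forall b, U b -> exists c, \forall a \near b, Phi a = c.

Definition smooth_germ (k s : nat) (b : frame k) (Phi : frame k -> ext s)
    : Prop :=
  exists U, [/\ open U, U b & smooth_form U Phi].

(* The germ of [Phi] at [b], modulo constants, is d_T of a germ. *)
Definition dT_exact_germ (k s : nat) (b : frame k.+1)
    (Phi : frame k.+1 -> ext s.+1) : Prop :=
  exists (W : set (frame k)) (Psi : frame k -> ext s) (c : ext s.+1),
    [/\ open W, W (tau k b), smooth_form W Psi &
        \forall a \near b, Phi a = dT Psi a + c].

(* The coset of the germ of [Phi] at [b] modulo d_T of germs and constants. *)
Definition p0 (k s : nat) (b : frame k.+1) (Phi : frame k.+1 -> ext s.+1) :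
    set (frame k.+1 -> ext s.+1) :=
  [set Phi' | smooth_germ b Phi' /\
              dT_exact_germ b (fun a => Phi' a - Phi a)].

(* The stalk at [b] of the quotient by the image of the last d_T. *)
Definition Xi (k s : nat) (b : frame k.+1) :
    set (set (frame k.+1 -> ext s.+1)) :=
  p0 b @` [set Phi | smooth_germ b Phi].

End Frames.

Arguments sset m s : clear implicits.
Arguments ext R m s : clear implicits.

(* The order k + s of the frame bundle in row s, for k + s >= 0. *)
Definition row_order (k : int) (s : nat) : nat := absz (k + s%:Z).

(* s_0 = max(0, - k), the first row with k + s >= 0. *)
Definition first_row (k : int) : nat := absz (Num.max 0 (- k)).

(* Main.v *)
Require Import Defs.
From HB Require Import structures.
From mathcomp Require Import all_boot all_order all_algebra.
From mathcomp Require Import all_classical all_reals all_analysis.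
From mathcomp Require Import ring lra zify.

Set Implicit Arguments.
Unset Strict Implicit.
Unset Printing Implicit Defensive.

Import Order.TTheory GRing.Theory Num.Theory numFieldNormedType.Exports.

Local Open Scope quotient_scope.
Local Open Scope classical_set_scope.
Local Open Scope ring_scope.

(** Read in a chart, a form of degree s on the frames of order k has coefficients which
    are functions of a jet u, and its total exterior derivative is sum_i dt^i /\ D_i,
    where D_i is the derivative along the field of components u_(J + 1_i). The
    coefficients are allowed to depend in addition on a time t in R^m, and D_i is
    completed by d/dt^i. Jets are truncated at a large order N; the D_i still commute.

    Let Phi be a form whose total derivative is constant, of degree s < m.
    Differentiating by the coordinates u_J gives a family th_J of forms which satisfies
    sum_i dt^i /\ (D_i th_J + th_(J - 1_i)) = 0, because of the commutation rule
    [d/du_J, D_i] = d/du_(J - 1_i) (lemma jD_vert). The highest order part of this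
    equation is the Koszul complex of the polynomial ring in m variables, which is
    exact in degrees s < m; descending on the order, th = sum_i dt^i /\ (D_i eta_J +
    eta_(J - 1_i)) for some family eta (lemma koszul). Fix a jet w0 and let b(t) be the
    jet at t of the polynomial map with jet w0 at 0. Integrating d/dl of
    Phi(t, b + l (u - b)) for l in [0, 1] shows that Phi(t, u) - Phi(t, b(t)) is the
    total derivative of the integral of sum_J eta_J (u - b)_J (lemma
    vertical_homotopy). If s = 0, or if Phi has order 0, this primitive is 0 and, at
    t = 0, Phi(0, u) = Phi(0, w0): this is the exactness of the first row.

    The remaining term Phi(t, b(t)) is, when Phi is closed, a closed form on a ball of
    R^m, to which the usual Poincare lemma applies (lemma radial_homotopy). The primitive
    so obtained depends on the time, while the coefficients of a form on frames do not.
    The time variables are eliminated one by one (lemma closed_exact): along the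
    way the constant value of the total derivative of Phi turns out to be 0. Each step
    takes two primitives, whence the final order exact_order m k.

    Passing from frames to this model uses that a jet is determined by its coordinates in
    one chart (lemma fcoord_inj), that all values of the coordinates close to those of a
    given jet are realized by immersions (lemma perturbation), that the transition maps
    between frame coordinates are smooth (lemma transition), and that the total
    derivative may be computed in any chart, being the derivative along the jets of the
    translates of an immersion (lemma total_derivativeE). *)

(** * Calculus of smooth maps *)

Section ClassCj.
Context {R : realType}.
Implicit Types V W : normedModType R.

(** The little-o of the definition of the differential, in terms of epsilons. *)
Lemma differentiable_eps V W (f : V -> W) (L : {linear V -> W}) (a : V) :
  continuous L ->
  (forall e : R, 0 < e ->
     \forall b \near a, `|f b - f a - L (b - a)| <= e * `|b - a|) ->
  differentiable f a /\ 'd f a = L :> (V -> W).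
Proof.
move=> Lc H.
have E : f \o shift a = cst (f a) + L +o_ 0 id.
  apply/eqaddoP => _/posnumP[e].
  have := H e%:num [gt0 of e%:num].
  rewrite (near_shift 0 a) /=; apply: filterS => h /=.
  rewrite /= subr0 addrK => h1.
  by rewrite -![(_ - _ : _ -> _) _]/(_ - _) -![(_ + _ : _ -> _) _]/(_ + _) /= opprD addrA.
have dE := diff_unique Lc E.
by split => //; apply/diff_locallyP; rewrite dE.
Qed.

Lemma diff_eps V W (f : V -> W) (a : V) : differentiable f a ->
  forall e : R, 0 < e ->
     \forall b \near a, `|f b - f a - 'd f a (b - a)| <= e * `|b - a|.
Proof.
move=> /diff_locally /eqaddoP fa e e0.
rewrite (near_shift 0 a) /=; have := fa e e0; apply: filterS => h /=.
rewrite -![(_ - _ : _ -> _) _]/(_ - _) -![(_ + _ : _ -> _) _]/(_ + _) /=.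
by rewrite subr0 addrK opprD addrA.
Qed.

Lemma near_differentiable V W (f g : V -> W) (a : V) :
  (\near a, f a = g a) -> differentiable f a -> differentiable g a.
Proof.
move=> fg df; have dc := diff_continuous df.
have [|//] := @differentiable_eps _ _ g ('d f a) a dc.
move=> e e0; have ega := nbhs_singleton fg.
have := diff_eps df e0; apply: filterS2 fg => b -> /=.
by rewrite ega.
Qed.

(** A finite-dimensional normed space is used through such a system of linear
    coordinates. Coordinates reduce maps between matrix spaces and their products
    to scalar functions, and let a vector field be differentiated componentwise. *)
Record coords V := Coords {
  cidx : finType ;
  cvec : cidx -> V ;
  cfun : cidx -> {linear V -> R^o} ;
  cfun_cts : forall c, continuous (cfun c) ;
  cdec : forall v, v = \sum_c cfun c v *: cvec c }.

Lemma smooth_open_near V (U : set V) a : open U -> U a -> \forall b \near a, U b.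
Proof. by move=> oU Ua; apply: open_nbhs_nbhs. Qed.

Lemma of_class_ext V W j (U : set V) (f g : V -> W) : open U ->
  (forall a, U a -> f a = g a) -> of_class j U f -> of_class j U g.
Proof.
move=> oU; elim: j f g => [|j IH] f g fg /=.
  move=> cf a Ua; rewrite /prop_for /continuous_at -(fg a Ua).
  apply: cvg_trans (cf a Ua); apply: near_eq_cvg; near=> b; apply/esym.
  by rewrite fg//; near: b; exact: smooth_open_near.
move=> [df Df]; split.
  move=> a Ua; apply: near_differentiable (df a Ua).
  by near=> b; apply: fg; near: b; exact: smooth_open_near.
move=> v; apply: IH (Df v) => a Ua; apply: near_eq_derive.
by near=> b; apply: fg; near: b; exact: smooth_open_near.
Unshelve. all: by end_near. Qed.

(** By induction on the class, as a differentiable function is continuous. *)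
Lemma of_classS V W j (U : set V) (f : V -> W) :
  of_class j.+1 U f -> of_class j U f.
Proof.
elim: j f => [|j IH] f [df Df].
  by move=> a /df; exact: differentiable_continuous.
by split=> // v; apply: IH.
Qed.

Lemma of_class_sub V W j (U U' : set V) (f : V -> W) : U' `<=` U ->
  of_class j U f -> of_class j U' f.
Proof.
move=> UU; elim: j f => [|j IH] f /=; first by move=> H a /UU; exact: H.
by move=> [df Df]; split => [a /UU|v]; [exact: df|exact: IH].
Qed.

Lemma of_class_cst V W j (U : set V) (w : W) : of_class j U (fun=> w).
Proof.
elim: j w => [|j IH] w /=; first by move=> a _; exact: cst_continuous.
split; first by move=> a _; exact: differentiable_cst.
move=> v; have -> : (fun a : V => 'D_v (fun=> w) a) = (fun=> 0).
  by apply/funext => a; exact: derive_cst.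
exact: IH.
Qed.

Lemma of_class_lin V W W' j (U : set V) (f : V -> W) (L : {linear W -> W'}) :
  open U -> continuous L -> of_class j U f -> of_class j U (L \o f).
Proof.
move=> oU Lc; elim: j f => [|j IH] f /=.
  by move=> cf a Ua; apply: continuous_comp; [exact: cf|exact: Lc].
have dL w : differentiable L w by exact: linear_differentiable.
move=> [df Df]; split.
  by move=> a Ua; apply: differentiable_comp; [exact: df|exact: dL].
move=> v; apply: of_class_ext (IH _ (Df v)) => // a Ua /=.
have dfa := df a Ua; have dLa := dL (f a).
have dLf : differentiable (L \o f) a := differentiable_comp dfa dLa.
rewrite (deriveE _ dfa) (deriveE _ dLf) (diff_comp dfa dLa) [RHS]/=.
by rewrite (diff_lin _ Lc).
Qed.

Lemma of_classL V W j (U : set V) (L : {linear V -> W}) :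
  continuous L -> of_class j U L.
Proof.
move=> Lc.
have dL w : differentiable L w by exact: linear_differentiable.
case: j => [|j] /=; first by move=> a _; exact: Lc.
split; first by move=> a _; exact: dL.
move=> v; have -> : (fun a : V => 'D_v L a) = (fun=> L v).
  by apply/funext => a; rewrite deriveE// diff_lin.
exact: of_class_cst.
Qed.

Lemma of_classD V W j (U : set V) (f g : V -> W) :
  open U -> of_class j U f -> of_class j U g -> of_class j U (fun a => f a + g a).
Proof.
move=> oU; elim: j f g => [|j IH] f g /=.
  by move=> cf cg a Ua; apply: continuousD; [exact: cf|exact: cg].
move=> [df Df] [dg Dg]; split.
  by move=> a Ua; apply: differentiableD; [exact: df|exact: dg].
move=> v; apply: of_class_ext (IH _ _ (Df v) (Dg v)) => // a Ua /=.
by rewrite [RHS]deriveD//; apply: diff_derivable; [exact: df|exact: dg].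
Qed.

Lemma of_classM V j (U : set V) (f g : V -> R^o) :
  open U -> of_class j U f -> of_class j U g -> of_class j U (fun a => f a * g a : R^o).
Proof.
move=> oU; elim: j f g => [|j IH] f g /=.
  by move=> cf cg a Ua; apply: continuousM; [exact: cf|exact: cg].
move=> Cf Cg; have [df Df] := Cf; have [dg Dg] := Cg; split.
  by move=> a Ua; apply: differentiableM; [exact: df|exact: dg].
move=> v; apply: of_class_ext (of_classD oU (IH _ _ (of_classS Cf) (Dg v))
  (IH _ _ (of_classS Cg) (Df v))) => // a Ua /=.
by rewrite [RHS]deriveM//; apply: diff_derivable; [exact: df|exact: dg].
Qed.

End ClassCj.

Section SmoothMaps.
Context {R : realType}.
Implicit Types V W : normedModType R.

Lemma of_class_sum V W (I : Type) (r : seq I) (P : pred I) j (U : set V)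
    (f : I -> V -> W) : open U -> (forall i, P i -> of_class j U (f i)) ->
  of_class j U (fun a => \sum_(i <- r | P i) f i a).
Proof.
move=> oU Cf; elim: r => [|i r IH].
  under eq_fun do rewrite big_nil; exact: of_class_cst.
under eq_fun do rewrite big_cons.
by case: (boolP (P i)) => // Pi; apply: of_classD => //; exact: Cf.
Qed.

Lemma of_classZl V W j (U : set V) (f : V -> R^o) (w : W) :
  open U -> of_class j U f -> of_class j U (fun a => f a *: w).
Proof.
move=> oU; pose g (r : R^o) := r *: w.
have gl : linear g by move=> k x y; rewrite /g scalerDl scalerA.
pose L : {linear R^o -> W} := HB.pack g (GRing.isLinear.Build _ _ _ _ g gl).
have Lc : continuous L by move=> r; apply: scalel_continuous.
exact: (of_class_lin oU Lc).
Qed.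

Lemma of_classZr V W j (U : set V) (k : R) (f : V -> W) :
  open U -> of_class j U f -> of_class j U (fun a => k *: f a).
Proof.
move=> oU; apply: (of_class_lin (L := *:%R k) oU); exact: scaler_continuous.
Qed.

Lemma of_classN V W j (U : set V) (f : V -> W) :
  open U -> of_class j U f -> of_class j U (fun a => - f a).
Proof.
move=> oU Cf; have := of_classZr (-1) oU Cf.
by apply: of_class_ext => // a _; rewrite scaleN1r.
Qed.

Lemma derive_dec V W (C : coords V) (f : V -> W) a v : differentiable f a ->
  'D_v f a = \sum_(c : cidx C) cfun c v *: 'D_(cvec c) f a.
Proof.
move=> df; rewrite deriveE// {1}[v](cdec C) linear_sum.
by apply: eq_bigr => c _; rewrite linearZ deriveE.
Qed.

Lemma derive_comp V V' W (f : V -> W) (phi : V' -> V) a v :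
  differentiable phi a -> differentiable f (phi a) ->
  'D_v (f \o phi) a = 'D_('D_v phi a) f (phi a).
Proof.
move=> dphi df.
have dfp : differentiable (f \o phi) a := differentiable_comp dphi df.
by rewrite !deriveE// (diff_comp dphi df).
Qed.

Lemma smooth_cst V W (U : set V) (w : W) : smooth U (fun=> w).
Proof. by move=> j; exact: of_class_cst. Qed.

Lemma smoothD V W (U : set V) (f g : V -> W) : open U ->
  smooth U f -> smooth U g -> smooth U (fun a => f a + g a).
Proof. by move=> oU sf sg j; apply: of_classD. Qed.

Lemma smoothN V W (U : set V) (f : V -> W) : open U ->
  smooth U f -> smooth U (fun a => - f a).
Proof. by move=> oU sf j; apply: of_classN. Qed.

Lemma smoothB V W (U : set V) (f g : V -> W) : open U ->
  smooth U f -> smooth U g -> smooth U (fun a => f a - g a).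
Proof. by move=> oU sf sg; apply: smoothD => //; apply: smoothN. Qed.

Lemma smoothM V (U : set V) (f g : V -> R^o) : open U ->
  smooth U f -> smooth U g -> smooth U (fun a => f a * g a : R^o).
Proof. by move=> oU sf sg j; apply: of_classM. Qed.

Lemma smooth_sum V W (I : Type) (r : seq I) (P : pred I) (U : set V)
    (f : I -> V -> W) : open U -> (forall i, P i -> smooth U (f i)) ->
  smooth U (fun a => \sum_(i <- r | P i) f i a).
Proof. by move=> oU Cf j; apply: of_class_sum => // i Pi; exact: Cf. Qed.

Lemma smoothX V (U : set V) (f : V -> R^o) p : open U -> smooth U f ->
  smooth U (fun a => f a ^+ p : R^o).
Proof.
move=> oU sf; elim: p => [|p IH].
  by under eq_fun do rewrite expr0; exact: smooth_cst.
by under eq_fun do rewrite exprS; exact: smoothM.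
Qed.

Lemma smooth_sub V W (U U' : set V) (f : V -> W) : U' `<=` U ->
  smooth U f -> smooth U' f.
Proof. by move=> UU sf j; apply: of_class_sub (sf j). Qed.

Lemma smooth_ext V W (U : set V) (f g : V -> W) : open U ->
  (forall a, U a -> f a = g a) -> smooth U f -> smooth U g.
Proof. by move=> oU fg sf j; apply: of_class_ext (sf j). Qed.

Lemma smoothL V W (U : set V) (L : {linear V -> W}) :
  continuous L -> smooth U L.
Proof. by move=> Lc j; exact: of_classL. Qed.

Lemma smooth_lin V W W' (U : set V) (f : V -> W) (L : {linear W -> W'}) :
  open U -> continuous L -> smooth U f -> smooth U (L \o f).
Proof. by move=> oU Lc sf j; exact: of_class_lin. Qed.

Lemma smooth_derive V W (U : set V) (f : V -> W) v :
  smooth U f -> smooth U (fun a => 'D_v f a).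
Proof. by move=> sf j; have [_] := sf j.+1; apply. Qed.

Lemma smooth_diff V W (U : set V) (f : V -> W) a :
  smooth U f -> U a -> differentiable f a.
Proof. by move=> sf; have [+ _] := sf 1; apply. Qed.

Lemma smooth_cts V W (U : set V) (f : V -> W) a :
  smooth U f -> U a -> {for a, continuous f}.
Proof. by move=> sf; exact: (sf 0%N). Qed.

Lemma smooth_glue V W (U : set V) (f : V -> W) :
  (forall a, U a -> exists2 U' : set V, open U' /\ U' a & smooth U' f) ->
  smooth U f.
Proof.
move=> H j; elim: j f H => [|j IH] f H /=.
  by move=> a /H [U' [_ U'a]] sf; exact: smooth_cts U'a.
split; first by move=> a /H [U' [_ U'a] sf]; exact: smooth_diff U'a.
move=> v; apply: IH => a /H [U' oU' sf]; exists U' => //.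
exact: smooth_derive.
Qed.

Lemma smooth_coords V W (C : coords W) (U : set V) (f : V -> W) : open U ->
  (forall c : cidx C, smooth U (cfun c \o f)) -> smooth U f.
Proof.
move=> oU sf; apply: smooth_ext (_ : smooth U (fun a =>
  \sum_(c : cidx C) cfun c (f a) *: cvec c)) => //.
  by move=> a _; rewrite -cdec.
apply: smooth_sum => // c _ j.
exact: (of_classZl (f := cfun c \o f) _ oU (sf c j)).
Qed.

(** The derivative of f o phi along v is the sum over the coordinates c of
    (d_c f o phi) * d_v (phi_c): the induction hypothesis applies to d_c f o phi. *)
Lemma of_class_comp V V' j (C : coords V) (O : set V) (U : set V')
    (f : V -> R^o) (phi : V' -> V) :
  open U -> smooth U phi -> (forall a, U a -> O (phi a)) -> smooth O f ->
  of_class j U (f \o phi).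
Proof.
move=> oU sphi OU; elim: j f => [|j IH] f sf /=.
  move=> a Ua; apply: continuous_comp; first exact: smooth_cts Ua.
  by apply: smooth_cts sf _; exact: OU.
have dphi a : U a -> differentiable phi a by exact: smooth_diff.
have df a : U a -> differentiable f (phi a).
  by move=> /OU; exact: smooth_diff.
split; first by move=> a Ua; apply: differentiable_comp; auto.
move=> v; apply: (@of_class_ext _ _ _ _ _ (fun a => \sum_(c : cidx C)
  cfun c ('D_v phi a) * 'D_(cvec c) f (phi a))) => //.
  move=> a Ua; rewrite (derive_comp v (dphi a Ua) (df a Ua)).
  by rewrite [RHS](derive_dec C _ (df a Ua)).
apply: of_class_sum => // c _; apply: of_classM => //.
  have := smooth_lin (L := cfun c) oU (@cfun_cts _ _ C c) (smooth_derive v sphi).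
  by apply.
by apply: (IH (fun b => 'D_(cvec c) f b)); exact: smooth_derive.
Qed.

Lemma smooth_comp V V' (C : coords V) (O : set V) (U : set V')
    (f : V -> R^o) (phi : V' -> V) :
  open U -> smooth U phi -> (forall a, U a -> O (phi a)) -> smooth O f ->
  smooth U (fun a => f (phi a)).
Proof. by move=> oU sphi OU sf j; exact: (of_class_comp j C oU sphi OU sf). Qed.

Lemma smooth_map_comp V V' W (C : coords V) (C' : coords W) (O : set V)
    (U : set V') (f : V -> W) (phi : V' -> V) : open O ->
  open U -> smooth U phi -> (forall a, U a -> O (phi a)) -> smooth O f ->
  smooth U (fun a => f (phi a)).
Proof.
move=> oO oU sphi OU sf; apply: (smooth_coords (C := C')) => // c.
apply: (smooth_comp C oU sphi OU (f := cfun c \o f)).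
exact: (smooth_lin oO (@cfun_cts _ _ C' c) sf).
Qed.

(** In coordinates the derivative along X is the sum of the products X_c * d_c f. *)
Lemma smooth_vfield V (C : coords V) (O : set V) (f : V -> R^o) (X : V -> V) :
  open O -> smooth O X -> smooth O f -> smooth O (fun a => 'D_(X a) f a : R^o).
Proof.
move=> oO sX sf; apply: smooth_ext (_ : smooth O (fun a => \sum_(c : cidx C)
  cfun c (X a) * 'D_(cvec c) f a : R^o)) => //.
  by move=> a Oa; rewrite (derive_dec C) //; exact: smooth_diff Oa.
apply: smooth_sum => // c _; apply: smoothM => //.
  exact: (smooth_lin oO (@cfun_cts _ _ C c) sX).
exact: smooth_derive.
Qed.

Lemma derivableZ_dir V W (f : V -> W) a (k : R) v : differentiable f a ->
  'D_(k *: v) f a = k *: 'D_v f a.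
Proof. by move=> df; rewrite !deriveE// linearZ. Qed.

End SmoothMaps.

Section MeanValue.
Context {R : realType}.
Implicit Types V W : normedModType R.
Lemma is_derive_line V (f : V -> R^o) (a v : V) (s : R) :
  derivable f (a + s *: v) v ->
  is_derive s 1 (fun h : R => f (a + h *: v)) ('D_v f (a + s *: v)).
Proof.
have E : (fun h : R => h^-1 *: (f (h *: v + (a + s *: v)) - f (a + s *: v))) =
    (fun h : R => h^-1 *: (f (a + (h *: 1 + s) *: v) - f (a + s *: v))).
  apply/funext => h; congr (_ *: (f _ - _)).
  by rewrite [_%:A]mulr1 scalerDl addrCA.
by move=> df; split; rewrite /derivable /derive /= -E.
Qed.

Lemma MVT_line V (f : V -> R^o) (a v : V) :
  (forall s : R, 0 <= s <= 1 -> derivable f (a + s *: v) v) ->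
  exists2 s : R, 0 <= s <= 1 & f (a + v) - f a = 'D_v f (a + s *: v).
Proof.
move=> df; pose g : R -> R := fun h => f (a + h *: v).
have dg (x : R) : x \in `[0, 1]%R -> is_derive (x : R) (1 : R) (g : R -> R) ('D_v f (a + x *: v)).
  by rewrite in_itv/= => x01; apply: is_derive_line; exact: df.
have gc : {within `[(0:R), 1], continuous g}.
  by apply: derivable_within_continuous => x /dg [].
have dg' (x : R) : x \in `](0:R), 1[%R -> is_derive (x : R) (1 : R) (g : R -> R) ('D_v f (a + x *: v)).
  by rewrite in_itv/= => /andP[x0 x1]; apply: dg; rewrite in_itv/= !ltW.
have [s] := MVT_segment ler01 dg' gc.
rewrite in_itv/= => s01; rewrite /g scale1r scale0r addr0 subr0 mulr1 => E.
by exists s.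
Qed.

Lemma derive_shift_pt V W (f : V -> W) (a c v : V) :
  'D_v (fun b => f (b + c)) a = 'D_v f (a + c).
Proof. by rewrite /derive; under eq_fun do rewrite /= -addrA. Qed.

Lemma diff_shift_pt V W (f : V -> W) (a c : V) : differentiable f (a + c) ->
  differentiable (fun b => f (b + c)) a.
Proof.
move=> df; apply: (@differentiable_comp _ _ _ _ (fun b => b + c) f) => //.
Qed.

(** Two applications of the mean value theorem: along v to the increment of f by w,
    then along w to the derivative of f along v. *)
Lemma second_difference V (U : set V) (f : V -> R^o) (a v w : V) :
  smooth U f ->
  (forall s t : R, 0 <= s <= 1 -> 0 <= t <= 1 -> U (a + s *: v + t *: w)) ->
  exists s t : R, [/\ 0 <= s <= 1, 0 <= t <= 1 &
    f (a + v + w) - f (a + v) - (f (a + w) - f a) =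
    'D_w (fun b => 'D_v f b) (a + s *: v + t *: w)].
Proof.
move=> sf Ua.
have z01 : 0 <= (0 : R) <= 1 by rewrite lexx ler01.
have o01 : 0 <= (1 : R) <= 1 by rewrite lexx ler01.
have d0 (s : R) : 0 <= s <= 1 -> differentiable f (a + s *: v).
  by move=> /Ua /(_ z01); rewrite scale0r addr0; exact: smooth_diff.
have d1 (s : R) : 0 <= s <= 1 -> differentiable f (a + s *: v + w).
  by move=> /Ua /(_ o01); rewrite scale1r; exact: smooth_diff.
pose g b := f (b + w) - f b.
have dg (s : R) : 0 <= s <= 1 -> differentiable g (a + s *: v).
  move=> s01; apply: differentiableB; last exact: d0.
  by apply: diff_shift_pt; exact: d1.
have [s s01 Es] := MVT_line (fun s s01 => diff_derivable (v := v) (dg s s01)).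
have [t t01 Et] : exists2 t : R, 0 <= t <= 1 &
   'D_v f (a + s *: v + w) - 'D_v f (a + s *: v) =
    'D_w (fun b => 'D_v f b) (a + s *: v + t *: w).
  have dDv (t : R) : 0 <= t <= 1 ->
      differentiable (fun b => 'D_v f b) (a + s *: v + t *: w).
    move=> t01; apply: (smooth_diff (U := U)); first exact: smooth_derive.
    exact: Ua.
  exact: (MVT_line (fun s s01 => diff_derivable (v := w) (dDv s s01))).
exists s, t; split => //; rewrite -Et -[LHS]/(g (a + v) - g a) Es /g.
rewrite deriveB ?derive_shift_pt//; apply: diff_derivable.
  by apply: diff_shift_pt; exact: d1.
exact: d0.
Qed.

(** Schwarz: on a small parallelogram the second difference, which is symmetric in v
    and w, is the value of either second derivative at a nearby point. *)
Lemma derive_swap V (U : set V) (f : V -> R^o) (a v w : V) : open U -> U a ->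
  smooth U f ->
  'D_v (fun b => 'D_w f b) a = 'D_w (fun b => 'D_v f b) a.
Proof.
move=> oU Ua sf; apply/eqP; rewrite -subr_eq0 -normr_le0; apply/ler_addgt0Pr => e e0.
rewrite add0r.
have cA : {for a, continuous (fun b => 'D_v (fun b => 'D_w f b) b)}.
  by apply: (smooth_cts (U := U)) => //; do 2!apply: smooth_derive.
have cB : {for a, continuous (fun b => 'D_w (fun b => 'D_v f b) b)}.
  by apply: (smooth_cts (U := U)) => //; do 2!apply: smooth_derive.
have e20 : 0 < e / 2 by rewrite divr_gt0.
move/cvgrPdist_lt : cA => /(_ _ e20) cA.
move/cvgrPdist_lt : cB => /(_ _ e20) cB.
have [d /= d0 dP] := iffLR (nbhs_ballP _ _)
  (filterI (filterI cA cB) (smooth_open_near oU Ua)).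
have vw0 : 0 < `|v| + `|w| + 1.
  by rewrite ltr_wpDl// addr_ge0.
have [k k0 kk] : exists2 k : R, 0 < k & k * (`|v| + `|w| + 1) < d.
  exists (d / 2 / (`|v| + `|w| + 1)); first by rewrite !divr_gt0.
  by rewrite divfK ?gt_eqF// ltr_pdivrMr// ltr_pMr// ltr1n.
have kd (s t : R) : 0 <= s <= 1 -> 0 <= t <= 1 ->
   ball a d (a + s *: (k *: v) + t *: (k *: w)).
  move=> /andP[s0 s1] /andP[t0 t1]; rewrite -ball_normE /= -addrA opprD addrA subrr.
  rewrite sub0r normrN (le_lt_trans (ler_normD _ _))// !scalerA !normrZ.
  rewrite (ger0_norm s0) (ger0_norm t0) (ger0_norm (ltW k0)).
  apply: le_lt_trans kk; rewrite !mulrDr mulr1.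
  rewrite -[leLHS]addr0; apply: lerD; last exact: ltW.
  by apply: lerD; rewrite ler_wpM2r// ger_pMl.
have UP b : ball a d b -> U b by move=> /dP [].
have [s [t [s01 t01 E1]]] := second_difference sf (fun s t s1 t1 => UP _ (kd s t s1 t1)).
have kd' (t' s' : R) : 0 <= t' <= 1 -> 0 <= s' <= 1 -> U (a + t' *: (k *: w) + s' *: (k *: v)).
  by move=> ? ?; rewrite addrAC; apply: UP; exact: kd.
have [t' [s' [t01' s01' E2]]] := second_difference sf kd'.
have [[_ b1] Ub1] := dP _ (kd s t s01 t01).
have [[b2 _] Ub2] := dP _ (kd s' t' s01' t01').
have dd u b : U b -> differentiable (fun b => 'D_u f b) b.
  by apply: smooth_diff; exact: smooth_derive.
have sc u u' b : U b -> 'D_(k *: u) (fun b => 'D_(k *: u') f b) b =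
    k ^+ 2 * 'D_u (fun b => 'D_u' f b) b.
  move=> Ub; rewrite derivableZ_dir; last by apply: dd.
  have -> : 'D_u (fun b => 'D_(k *: u') f b) b = 'D_u (fun b => k *: 'D_u' f b) b.
    apply: near_eq_derive; near=> c; rewrite derivableZ_dir//.
    apply: smooth_diff sf _; near: c; exact: smooth_open_near.
  by rewrite deriveZ ?scalerA -?expr2//; apply: diff_derivable; apply: dd.
rewrite (sc w v _ Ub1) in E1.
rewrite (addrAC a (t' *: (k *: w))) (sc v w _ Ub2) in E2.
(* the two evaluations of the same second difference *)
have EE : 'D_v (fun b => 'D_w f b) (a + s' *: (k *: v) + t' *: (k *: w)) =
  'D_w (fun b => 'D_v f b) (a + s *: (k *: v) + t *: (k *: w)).
  have k2 : k ^+ 2 != 0 by rewrite expf_neq0// gt_eqF.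
  apply: (mulfI k2); apply: (etrans (esym E2)); apply: etrans E1.
  rewrite (addrAC a (k *: w)) !opprB addrACA [RHS]addrACA.
  by congr (_ + _); rewrite addrC.
rewrite EE in b2.
have fin (x y p : R) : `|x - p| < e / 2 -> `|y - p| < e / 2 -> `|x - y| <= e.
  move=> xp yp; apply: le_trans (ler_distD p _ _) _; rewrite [leRHS]splitr.
  by apply: lerD; [exact: ltW|rewrite distrC ltW].
exact: fin b2 b1.
Unshelve. all: by end_near. Qed.

(** A function with continuous partial derivatives is differentiable: its increment
    is, by the mean value theorem, a derivative at an intermediate point. *)
Lemma C1_differentiable V (C : coords V) (U : set V) (f : V -> R^o)
    (Df : cidx C -> V -> R^o) (a : V) : open U -> U a ->
  (forall b v, U b -> is_derive b v f (\sum_(c : cidx C) cfun c v * Df c b)) ->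
  (forall c : cidx C, {for a, continuous (Df c)}) -> differentiable f a.
Proof.
move=> oU Ua df cf.
pose g v : R^o := \sum_(c : cidx C) Df c a * cfun c v.
have gl : linear g.
  move=> k x y; rewrite /g scaler_sumr -big_split; apply: eq_bigr => c _ /=.
  by rewrite linearP mulrDr /GRing.scale /= mulrCA.
pose L : {linear V -> R^o} := HB.pack g (GRing.isLinear.Build _ _ _ _ g gl).
have Lc : continuous L.
  move=> x; apply: (smooth_cts (U := setT)) => //.
  apply: smooth_sum => [|c _]; first exact: openT.
  apply: smoothM; [exact: openT|exact: smooth_cst|].
  exact: smoothL (@cfun_cts _ _ C c).
have [//|//] := @differentiable_eps R V R^o f L a Lc _.
have bd (c : cidx C) : exists2 K : R, 0 < K & forall v, `|cfun c v| <= K * `|v|.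
  have [K K0 KP] := @linear_lipschitz _ _ _ (@cfun _ _ C c) (@cfun_cts _ _ C c).
  by exists K.
pose K c := sval (cid2 (bd c)).
have K0 c : 0 < K c by rewrite /K; case: cid2.
have KP (c : cidx C) v : `|cfun c v| <= K c * `|v| by rewrite /K; case: cid2.
pose S := 1 + \sum_(c : cidx C) K c.
have S0 : 0 < S by rewrite ltr_pwDl// sumr_ge0// => c _; exact: ltW.
move=> e e0; have eS : 0 < e / S by rewrite divr_gt0.
have [d /= d0 dP] : nbhs_ball a (fun b => (forall c, `|Df c a - Df c b| < e / S) /\ U b).
  apply/nbhs_ballP; apply: filterI; last exact: smooth_open_near.
  apply: filter_forall => c0.
  by have /cvgrPdist_lt := cf c0; apply.
apply/nbhs_ballP; exists d => //= b ab.
have seg (s : R) : 0 <= s <= 1 -> ball a d (a + s *: (b - a)).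
  move=> /andP[s0 s1]; move: ab; rewrite -!ball_normE /= opprD addrA subrr sub0r.
  move=> ab; rewrite normrN normrZ ger0_norm// distrC in ab *.
  by apply: le_lt_trans ab; rewrite ler_piMl.
have [|s s01 E] := @MVT_line V f a (b - a).
  by move=> s /seg /dP [_ /(df _ (b - a))[]].
rewrite [X in f X - _]addrC in E; rewrite subrK in E.
rewrite E.
have [dPs Us] := dP _ (seg s s01).
have [_ ->] := df _ (b - a) Us.
rewrite /L /= /g -sumrB.
apply: le_trans (_ : \sum_(c : cidx C) (K c * `|b - a|) * (e / S) <= _).
  apply: le_trans (ler_norm_sum _ _ _) _; apply: ler_sum => c _.
  rewrite [Df c a * _]mulrC -mulrBr normrM ler_pM//.
  by rewrite distrC ltW.
rewrite -mulr_suml -mulr_suml -mulrA [leRHS]mulrC mulrCA ler_wpM2l//.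
rewrite mulrCA ler_piMr ?(ltW e0)// ler_pdivrMr// mul1r /S lerDr//.
Qed.

Lemma smooth_cfun V (C : coords V) (U : set V) (c : cidx C) : smooth U (@cfun _ _ C c).
Proof. exact: smoothL (@cfun_cts _ _ C c). Qed.

End MeanValue.

Section CoordSpaces.
Context {R : realType}.

Section Mx.
Variables p q : nat.
Definition entry (c : 'I_p * 'I_q) (A : 'M[R]_(p, q)) : R^o := A c.1 c.2.
Lemma entry_linear c : linear (entry c).
Proof. by move=> k A B; rewrite /entry !mxE. Qed.
HB.instance Definition _ c :=
  GRing.isLinear.Build R 'M[R]_(p, q) R^o _ (entry c) (entry_linear c).

Definition coordsM : coords 'M[R]_(p, q).
Proof.
apply: (@Coords R _ ('I_p * 'I_q)%type (fun c => delta_mx c.1 c.2) entry).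
  move=> [i j] A; apply: differentiable_continuous.
  exact: (differentiable_coord A i j).
by move=> A; rewrite [LHS]matrix_sum_delta pair_bigA; exact: eq_bigr.
Defined.
End Mx.

Section Prod.
Variables (V W : normedModType R) (C : coords V) (C' : coords W).
Definition pcfun (c : cidx C + cidx C') (x : V * W) : R^o :=
  match c with inl c => cfun c x.1 | inr c => cfun c x.2 end.
Lemma pcfun_linear c : linear (pcfun c).
Proof. by case: c => c k x y; rewrite /pcfun/= linearP. Qed.
HB.instance Definition _ c :=
  GRing.isLinear.Build R (V * W)%type R^o _ (pcfun c) (pcfun_linear c).
Definition coordsP : coords (V * W)%type.
Proof.
apply: (@Coords R (V * W)%type (cidx C + cidx C')%type
   (fun c => match c with inl c => (cvec c, 0) | inr c => (0, cvec c) end)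
   pcfun).
  move=> [] c x; rewrite /pcfun /=; apply: continuous_comp.
  - exact: cvg_fst.
  - exact: cfun_cts.
  - exact: cvg_snd.
  - exact: cfun_cts.
move=> [v w]; rewrite big_sumType /=.
have fst_sum (I : finType) (F : I -> V * W) : (\sum_i F i).1 = \sum_i (F i).1.
  by elim/big_rec2 : _ => // i x y _ <-.
have snd_sum (I : finType) (F : I -> V * W) : (\sum_i F i).2 = \sum_i (F i).2.
  by elim/big_rec2 : _ => // i x y _ <-.
apply/pair_equal_spec; split.
  rewrite [LHS](cdec C) [RHS]/= fst_sum fst_sum /= [X in _ + X]big1 ?addr0//.
  by move=> c _; rewrite scaler0.
rewrite [LHS](cdec C') [RHS]/= snd_sum snd_sum /= [X in X + _]big1 ?add0r//.
by move=> c _; rewrite scaler0.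
Defined.
End Prod.

End CoordSpaces.

(** * Integrals over the unit interval *)

Section UnitIntegral.
Context {R : realType}.
Local Notation mu := (@lebesgue_measure R).

Definition int01 (f : R -> R) : R := \int[mu]_(x in `[(0 : R), 1]%classic) f x.

Definition cts01 (f : R -> R) := {within `[(0 : R), 1], continuous f}.

Lemma cts01_integrable (f : R -> R) :
  cts01 f -> mu.-integrable `[(0 : R), 1]%classic (EFin \o f).
Proof.
move=> cf; apply: continuous_compact_integrable => //; exact: segment_compact.
Qed.

Lemma cts01_pt (f : R -> R) :
  (forall l : R, 0 <= l <= 1 -> {for l, continuous f}) -> cts01 f.
Proof.
move=> cf; apply: continuous_in_subspaceT => x.
by rewrite inE /= in_itv /=; exact: cf.
Qed.

Lemma eq_int01 (f g : R -> R) :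
  (forall l : R, 0 <= l <= 1 -> f l = g l) -> int01 f = int01 g.
Proof.
move=> fg; apply: eq_Rintegral => x; rewrite inE /= in_itv /=; exact: fg.
Qed.

Lemma int01D (f g : R -> R) : cts01 f -> cts01 g ->
  int01 (fun x => f x + g x) = int01 f + int01 g.
Proof. by move=> cf cg; apply: RintegralD => //; exact: cts01_integrable. Qed.

Lemma int01Z (f : R -> R) (k : R) : cts01 f ->
  int01 (fun x => k * f x) = k * int01 f.
Proof. by move=> cf; apply: RintegralZl => //; exact: cts01_integrable. Qed.

Lemma int01_cst (k : R) : int01 (fun=> k) = k.
Proof.
rewrite /int01 Rintegral_cst//= lebesgue_measure_itv/= lte_fin ltr01.
by rewrite -EFinD/= subr0 mulr1.
Qed.

Lemma cts01_cst (k : R) : cts01 (fun=> k).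
Proof. by apply: cts01_pt => l _; exact: cst_continuous. Qed.

Lemma cts01D (f g : R -> R) : cts01 f -> cts01 g -> cts01 (fun l => f l + g l).
Proof. by move=> cf cg x; apply: continuousD; [exact: cf|exact: cg]. Qed.

Lemma cts01Z (k : R) (f : R -> R) : cts01 f -> cts01 (fun l => k * f l).
Proof.
by move=> cf x; apply: continuousM; [exact: cst_continuous|exact: cf].
Qed.

Lemma int01_sum (I : Type) (r : seq I) (P : pred I) (f : I -> R -> R) :
  (forall i, P i -> cts01 (f i)) ->
  cts01 (fun x => \sum_(i <- r | P i) f i x) /\
  int01 (fun x => \sum_(i <- r | P i) f i x) = \sum_(i <- r | P i) int01 (f i).
Proof.
move=> cf; elim: r => [|i r [cr IH]].
  rewrite big_nil; split.
    by under eq_fun do rewrite big_nil; exact: cts01_cst.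
  by under eq_fun do rewrite big_nil; exact: int01_cst.
rewrite big_cons; under eq_fun do rewrite big_cons.
case: (boolP (P i)) => // Pi; split.
  by move=> x; apply: continuousD; [exact: cf|exact: cr].
by rewrite int01D ?IH//; exact: cf.
Qed.

Lemma int01_bound (f : R -> R) (M : R) : cts01 f ->
  (forall l : R, 0 <= l <= 1 -> `|f l| <= M) -> `|int01 f| <= M.
Proof.
move=> cf fM; have If := cts01_integrable cf.
apply: le_trans (le_normr_Rintegral _ If) _ => //.
rewrite -[leRHS]int01_cst; apply: le_Rintegral => //.
- have := integrable_norm If.
  by apply.
- apply: cts01_integrable; exact: cts01_cst.
Qed.

Lemma int01_FTC (f F : R -> R) :
  (forall l : R, 0 <= l <= 1 -> {for l, continuous f}) ->
  (forall l : R, 0 <= l <= 1 -> is_derive l 1 F (f l)) ->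
  int01 f = F 1 - F 0.
Proof.
move=> cf dF.
have cF (l : R) : 0 <= l <= 1 -> {for l, continuous F}.
  move=> /dF [dl _]; apply: differentiable_continuous.
  exact/derivable1_diffP.
have o : 0 <= (1 : R) <= 1 by rewrite lexx ler01.
have z : 0 <= (0 : R) <= 1 by rewrite lexx ler01.
have := @continuous_FTC2 R f F 0 1 ltr01 (cts01_pt cf) _ _.
rewrite /int01 /Rintegral => -> //.
  split.
  - move=> x; rewrite in_itv /= => /andP[x0 x1].
    by have [] := dF x _; rewrite ?(ltW x0) ?(ltW x1).
  - apply: cvg_at_right_filter; exact: cF.
  - apply: cvg_at_left_filter; exact: cF.
move=> x; rewrite in_itv /= => /andP[x0 x1]; rewrite derive1E.
by have [] := dF x _; rewrite ?(ltW x0) ?(ltW x1).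
Qed.

End UnitIntegral.

Section ParamIntegral.
Context {R : realType} {V : normedModType R}.
Variables (C : coords V) (O : set V) (O' : set (R * V)).
Hypothesis (oO : open O) (oO' : open O').
Hypothesis OO' : forall (l : R) z, 0 <= l <= 1 -> O z -> O' (l, z).

Let itg (G : R * V -> R^o) (z : V) : R^o := int01 (fun l => G (l, z)).

Lemma slice_cts (G : R * V -> R^o) (l : R) z : smooth O' G -> 0 <= l <= 1 ->
  O z -> {for l, continuous (fun l => G (l, z))}.
Proof.
move=> sG l01 Oz; apply: (@continuous_comp _ _ _ (fun l : R => (l, z)) G).
  by apply: differentiable_continuous; apply: differentiable_pair.
exact: smooth_cts sG (OO' l01 Oz).
Qed.

Lemma slice_cts01 (G : R * V -> R^o) z : smooth O' G ->
  O z -> cts01 (fun l => G (l, z)).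
Proof. by move=> sG Oz; apply: cts01_pt => l l01; exact: slice_cts. Qed.

(** By compactness of the interval, the continuity in the parameter is uniform in l. *)
Let tube (G : R * V -> R^o) z (e : R) : smooth O' G -> O z -> 0 < e ->
  \forall z' \near z, forall l : R, 0 <= l <= 1 -> `|G (l, z') - G (l, z)| < e.
Proof.
move=> sG Oz e0.
suff : \forall z' \near z,
    `[(0:R), 1]%classic `<=` (fun l => `|G (l, z') - G (l, z)| < e).
  by apply: filterS => z' H l l01; apply: (H l); rewrite /= in_itv.
apply: (iffLR (compact_near_coveringP _) (@segment_compact R 0 1) V (nbhs z)
  (fun z' l => `|G (l, z') - G (l, z)| < e)) => l.
rewrite /= in_itv /= => l01.
have e20 : 0 < e / 2 by rewrite divr_gt0.
have := smooth_cts sG (OO' l01 Oz).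
move=> /cvgrPdist_lt /(_ _ e20) [[A B] /= [nA nB] AB].
exists (A, B) => //= -[l' z'] /= [Al' Bz'].
have h1 := AB (l', z') (conj Al' Bz').
have h2 := AB (l', z) (conj Al' (nbhs_singleton nB)).
rewrite [e]splitr; apply: le_lt_trans (ler_distD (G (l, z)) _ _) _.
by apply: ltrD; [rewrite distrC|].
Qed.

Let itg_cts G z : smooth O' G -> O z -> {for z, continuous (itg G)}.
Proof.
move=> sG Oz; apply/cvgrPdist_le => e e0.
have nT := tube sG Oz e0; have nO := smooth_open_near oO Oz.
near=> z'.
have Tz' : forall l : R, 0 <= l <= 1 -> `|G (l, z') - G (l, z)| < e by near: z'.
have Oz' : O z' by near: z'.
have cz := slice_cts01 sG Oz; have cz' := slice_cts01 sG Oz'.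
have -> : itg G z - itg G z' = int01 (fun l => G (l, z) + (-1) * G (l, z')).
  by rewrite int01D ?int01Z ?mulN1r//; exact: cts01Z.
apply: int01_bound.
  by apply: cts01D => //; exact: cts01Z.
by move=> l l01; rewrite mulN1r distrC ltW//; exact: Tz'.
Unshelve. all: by end_near. Qed.

(** Differentiation under the integral sign. By the mean value theorem the difference
    quotient of the integrand is a value of its derivative at a point which tends to z
    uniformly in l. *)
Let itg_derive G z v : smooth O' G -> O z ->
  is_derive z v (itg G) (itg (fun x => 'D_(0, v) G x) z).
Proof.
move=> sG Oz.
have sDG : smooth O' (fun x => 'D_(0, v) G x) by exact: smooth_derive.
suff : (fun h : R => h^-1 *: (itg G (h *: v + z) - itg G z)) @ 0^' -->
    itg (fun x => 'D_(0, v) G x) z.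
  by move=> H; split; [apply/cvg_ex; eexists; exact: H|exact/cvg_lim].
apply/cvgrPdist_le => e e0.
have [d /= d0 dP] := iffLR (nbhs_ballP _ _)
  (filterI (tube sDG Oz e0) (smooth_open_near oO Oz)).
have nd : \forall h \near (0 : R)^', `|h| * `|v| < d.
  have dv : 0 < d / (`|v| + 1) by rewrite divr_gt0// ltr_wpDl.
  have := @dnbhs0_lt R R _ dv.
  apply: filterS => h; rewrite ltr_pdivlMr; last by rewrite ltr_wpDl.
  by apply: le_lt_trans; rewrite mulrDr mulr1 lerDl.
near=> h.
have h0 : h != 0 by near: h; exact: nbhs_dnbhs_neq.
have hd : `|h| * `|v| < d by near: h.
have inb (s : R) : 0 <= s <= 1 -> ball z d (z + s *: (h *: v)).
  move=> /andP[s0 s1]; rewrite -ball_normE /= opprD addrA subrr sub0r normrN.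
  rewrite !normrZ (ger0_norm s0); apply: le_lt_trans hd.
  by rewrite ler_piMl.
have o01 : 0 <= (1 : R) <= 1 by rewrite lexx ler01.
have Ozh : O (h *: v + z) by have := (dP _ (inb 1 o01)).2; rewrite scale1r addrC.
have cz := slice_cts01 sG Oz; have czh := slice_cts01 sG Ozh.
have cDz := slice_cts01 sDG Oz.
have cB : cts01 (fun l => G (l, h *: v + z) + (-1) * G (l, z)).
  by apply: cts01D => //; exact: cts01Z.
have -> : itg (fun x => 'D_(0, v) G x) z - h^-1 *: (itg G (h *: v + z) - itg G z)
   = int01 (fun l => 'D_(0, v) G (l, z) +
       (- h^-1) * (G (l, h *: v + z) + (-1) * G (l, z))).
  rewrite int01D//; last exact: cts01Z.
  rewrite int01Z// int01D//; last exact: cts01Z.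
  by rewrite int01Z// mulN1r mulNr.
apply: int01_bound; first by apply: cts01D => //; exact: cts01Z.
move=> l l01.
have seg (s : R) : 0 <= s <= 1 ->
    differentiable G ((l, z) + s *: ((0 : R), h *: v)).
  move=> s01; apply: smooth_diff sG _.
  have -> : (l, z) + s *: ((0 : R), h *: v) = (l, z + s *: (h *: v)).
    by rewrite -[LHS]/(l + s *: 0, z + s *: (h *: v)) scaler0 addr0.
  by apply: OO' => //; exact: (dP _ (inb _ s01)).2.
have [s s01 E] := MVT_line (fun s s01 => diff_derivable (v := (0, h *: v)) (seg s s01)).
have E1 : (l, z) + ((0 : R), h *: v) = (l, h *: v + z).
  by rewrite -[LHS]/(l + 0, z + h *: v) addr0 addrC.
have E2 : (l, z) + s *: ((0 : R), h *: v) = (l, z + s *: (h *: v)).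
  by rewrite -[LHS]/(l + s *: 0, z + s *: (h *: v)) scaler0 addr0.
have E3 : ((0 : R), h *: v) = h *: ((0 : R), v).
  by rewrite -[RHS]/(h *: 0, h *: v) scaler0.
have E4 : 'D_(0, h *: v) G ((l, z) + s *: ((0 : R), h *: v)) =
    h *: 'D_(0, v) G (l, z + s *: (h *: v)).
  by have := seg s s01; rewrite E2 E3 => dG; exact: derivableZ_dir.
rewrite E1 E4 in E; rewrite mulN1r E [_ *: _]/(_ * _) mulNr mulrA mulVf// mul1r.
rewrite distrC ltW//; exact: (dP _ (inb _ s01)).1.
Unshelve. all: by end_near. Qed.

(** All derivatives are again integrals of smooth functions, so the class follows by
    induction; total differentiability comes from the continuity of the partials. *)
Lemma smooth_int01 (G : R * V -> R^o) : smooth O' G ->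
  smooth O (fun z => int01 (fun l => G (l, z)) : R^o) /\
  forall z v, O z -> 'D_v (fun z => int01 (fun l => G (l, z)) : R^o) z =
    int01 (fun l => 'D_(0, v) G (l, z)).
Proof.
move=> sG; split; last by move=> z v Oz; have [] := itg_derive v sG Oz.
move=> j; elim: j G sG => [|j IH] G sG /=.
  by move=> z Oz; exact: itg_cts.
split; last first.
  move=> v; apply: of_class_ext (IH _ (smooth_derive (0, v) sG)) => // z Oz.
  by have [] := itg_derive v sG Oz.
move=> z Oz; apply: (@C1_differentiable _ _ C O _
    (fun c => itg (fun x => 'D_(0, cvec c) G x))) => //.
  move=> b v Ob.
  have -> : \sum_(c : cidx C) cfun c v * itg (fun x => 'D_(0, cvec c) G x) b =
      itg (fun x => 'D_(0, v) G x) b; last exact: itg_derive.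
  pose F (c : cidx C) (l : R) : R := cfun c v * 'D_(0, cvec c) G (l, b).
  have cF c : cts01 (F c).
    by apply: cts01Z; apply: (slice_cts01 (G := fun x => 'D_(0, cvec c) G x) _ Ob); exact: smooth_derive.
  have [_ ] := int01_sum (index_enum (cidx C)) (fun c (_ : true) => cF c).
  rewrite /F.
  have -> : itg (fun x => 'D_(0, v) G x) b =
    int01 (fun l => \sum_(c : cidx C) cfun c v * 'D_(0, cvec c) G (l, b)).
    apply: eq_int01 => l l01.
    have dG : differentiable G (l, b) by apply: smooth_diff sG _; exact: OO'.
    rewrite deriveE//.
    have -> : ((0 : R), v) = \sum_(c : cidx C) cfun c v *: ((0 : R), cvec c).
      rewrite [in LHS](cdec C v); elim/big_rec2 : _ => // c x y _ <-.
      by rewrite -[RHS]/(cfun c v *: 0 + 0, cfun c v *: cvec c + y) scaler0 addr0.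
    by rewrite linear_sum; apply: eq_bigr => c _; rewrite linearZ deriveE.
  move=> ->; apply: eq_bigr => c _; rewrite -int01Z//.
  by apply: (slice_cts01 (G := fun x => 'D_(0, cvec c) G x) _ Ob); exact: smooth_derive.
by move=> c; apply: itg_cts => //; exact: smooth_derive.
Qed.

End ParamIntegral.

(** * Exterior algebra *)

Section Exterior.
Context {R : realFieldType} {m : nat}.
Implicit Types (A B : {set 'I_m}).

(** The sign of moving dt^i past the dt^j with j in A and j < i. *)
Definition sgn (i : 'I_m) A : R := (-1) ^+ #|[set j in A | (j < i)%N]|.

Lemma sgnsq i A : sgn i A * sgn i A = 1.
Proof. by rewrite /sgn -exprD -signr_odd oddD addbb. Qed.

Lemma sgnU i j A : j \notin A -> sgn i (j |: A) = (-1) ^+ (j < i)%N * sgn i A.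
Proof.
move=> jA; rewrite /sgn -exprD; congr (_ ^+ _).
case: (ltnP j i) => ji.
  have -> : [set k in j |: A | (k < i)%N] = j |: [set k in A | (k < i)%N].
    apply/setP => k; rewrite !inE; case: eqP => [->|]//=; by rewrite ji.
  by rewrite cardsU1 !inE (negPf jA).
have -> : [set k in j |: A | (k < i)%N] = [set k in A | (k < i)%N]; last by [].
apply/setP => k; rewrite !inE; case: eqP => [->|]//=.
by rewrite ltnNge ji (negPf jA).
Qed.

Lemma sgnD i j B : j \in B -> sgn i (B :\ j) = (-1) ^+ (j < i)%N * sgn i B.
Proof.
move=> jB; rewrite -[in RHS](finset.setD1K jB) sgnU ?finset.setD11// mulrA -exprD.
by rewrite -signr_odd oddD addbb mul1r.
Qed.

Context {M : lmodType R}.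
Local Notation form := {ffun {set 'I_m} -> M}.
Implicit Types w : form.

(** Forms are indexed by all sets of indices, whatever their size, so that exterior
    multiplication by dt^i and contraction by d/dt^i are endomorphisms of one module. *)
Definition wedge (i : 'I_m) w : form :=
  [ffun B : {set 'I_m} => if i \in B then sgn i (B :\ i) *: w (B :\ i) else 0].
Definition contr (i : 'I_m) w : form :=
  [ffun A : {set 'I_m} => if i \in A then 0 else sgn i A *: w (i |: A)].

Lemma wedge_linear i : linear (wedge i).
Proof.
move=> k u v; apply/ffunP => B; rewrite !ffunE; case: ifP => _.
  by rewrite scalerDr !scalerA mulrC.
by rewrite scaler0 addr0.
Qed.
HB.instance Definition _ i :=
  GRing.isLinear.Build R form form _ (wedge i) (wedge_linear i).

Lemma contr_linear i : linear (contr i).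
Proof.
move=> k u v; apply/ffunP => B; rewrite !ffunE; case: ifP => _.
  by rewrite scaler0 addr0.
by rewrite scalerDr !scalerA mulrC.
Qed.
HB.instance Definition _ i :=
  GRing.isLinear.Build R form form _ (contr i) (contr_linear i).

Lemma wedge0 i : wedge i 0 = 0. Proof. exact: linear0. Qed.
Lemma wedgeB i u v : wedge i (u - v) = wedge i u - wedge i v.
Proof. exact: linearB. Qed.

Lemma ltn_sign (i j : 'I_m) : i != j ->
  (-1) ^+ (j < i)%N = - (-1) ^+ (i < j)%N :> R.
Proof.
by rewrite -(inj_eq val_inj) /= neq_ltn => /orP[] ij; rewrite ij ltnNge (ltnW ij) /= ?opprK.
Qed.

Lemma wedgeii i w : wedge i (wedge i w) = 0.
Proof.
by apply/ffunP => B; rewrite !ffunE finset.setD11 scaler0 if_same.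
Qed.

Lemma wedgeC i j w : wedge i (wedge j w) = - wedge j (wedge i w).
Proof.
have [->|ij] := eqVneq i j; first by rewrite wedgeii oppr0.
apply/ffunP => B; rewrite !ffunE !inE ij eq_sym (negPf ij) /=.
case: (boolP (i \in B)) => iB; case: (boolP (j \in B)) => jB;
  rewrite /= ?scaler0 ?oppr0//.
rewrite !scalerA -scaleNr; congr (_ *: w _); last first.
  by apply/setP => k; rewrite !inE andbCA.
rewrite -mulNr !sgnD ?inE ?ij ?(eq_sym j) ?ij ?iB ?jB//.
rewrite !ltnn /= !mul1r (ltn_sign ij) !mulNr !mulrA.
by move: ((-1) ^+ _) (sgn i B) (sgn j B) => a b c; ring.
Qed.

(** This and the next identity are the Clifford relations between wedge and contr. *)
Lemma wedge_contr_neq i j w : i != j -> wedge i (contr j w) = - contr j (wedge i w).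
Proof.
move=> ij; apply/ffunP => B; rewrite !ffunE !inE (negPf ij) /= eq_sym ij /=.
case: (boolP (i \in B)) => iB; case: (boolP (j \in B)) => jB;
  rewrite /= ?scaler0 ?oppr0//.
rewrite !scalerA -scaleNr; congr (_ *: w _); last first.
  by apply/setP => k; rewrite !inE; case: (eqVneq k i) => [->|]; rewrite ?(negPf ij) ?orbF.
rewrite (sgnD i iB) ltnn mul1r (sgnD j iB).
rewrite (@sgnD i i) ?inE ?iB ?orbT// ltnn mul1r (sgnU i jB) (ltn_sign ij).
by move: ((-1) ^+ _) (sgn i B) (sgn j B) => a b c; ring.
Qed.

Lemma wedge_contr_eq i w : wedge i (contr i w) + contr i (wedge i w) = w.
Proof.
apply/ffunP => B; rewrite !ffunE !inE eqxx /=.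
case: (boolP (i \in B)) => iB /=.
  by rewrite addr0 scalerA sgnsq scale1r finset.setD1K.
by rewrite add0r finset.setU1K// scalerA sgnsq scale1r.
Qed.

Definition hom s w := forall A, #|A| != s -> w A = 0.
(** Homogeneous of degree s - 1; there is no such nonzero form if s = 0. This shift
    avoids a truncated subtraction in degree 0. *)
Definition hom1 s w := forall A, (#|A|).+1 != s -> w A = 0.

Lemma hom_contr s i w : hom s w -> hom1 s (contr i w).
Proof.
move=> hw A sA; rewrite ffunE; case: ifP => // /negbT iA.
by rewrite hw ?scaler0// cardsU1 iA.
Qed.

Lemma hom1_wedge s i w : hom1 s w -> hom s (wedge i w).
Proof.
move=> hw A sA; rewrite ffunE; case: ifP => // iA.
by rewrite hw ?scaler0//; move: sA; rewrite (cardsD1 i A) iA.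
Qed.

Lemma hom_wedge s i w : hom s w -> hom s.+1 (wedge i w).
Proof.
move=> hw A sA; rewrite ffunE; case: ifP => // iA.
by rewrite hw ?scaler0//; move: sA; rewrite (cardsD1 i A) iA eqSS.
Qed.

(** The operator sum_i dt^i /\ contr_i counts the factors of dt^A. *)
Lemma euler_contr s w : hom s w -> \sum_i wedge i (contr i w) = s%:R *: w.
Proof.
move=> hw; apply/ffunP => A; rewrite sum_ffunE [RHS]ffunE.
have -> : \sum_i wedge i (contr i w) A = \sum_(i in A) w A.
  rewrite [RHS]big_mkcond; apply: eq_bigr => i _; rewrite !ffunE.
  by case: ifP => // iA; rewrite finset.setD11 scalerA sgnsq scale1r finset.setD1K.
rewrite sumr_const; case: (eqVneq #|A| s) => [->|/hw ->]; first by rewrite scaler_nat.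
by rewrite mul0rn scaler0.
Qed.

(** A symmetric coefficient contracted with an antisymmetric product. *)
Lemma wedge_wedge_sum (T : 'I_m -> 'I_m -> form) :
  (forall i j, T i j = T j i) -> \sum_i \sum_j wedge i (wedge j (T i j)) = 0.
Proof.
move=> TC; set S := (LHS).
have SN : S = - S.
  rewrite {2}/S exchange_big -sumrN; apply: eq_bigr => i _; rewrite -sumrN.
  by apply: eq_bigr => j _; rewrite TC -wedgeC.
have : 2%:R *: S = 0 by rewrite scaler_nat mulr2n {2}SN subrr.
by move/eqP; rewrite scaler_eq0 pnatr_eq0 /= => /eqP.
Qed.

Definition mapf (f : M -> M) w : form := [ffun A : {set 'I_m} => f (w A)].

Section Fmap.
Variable f : {linear M -> M}.
Lemma mapf_linear : linear (mapf f).
Proof. by move=> k u v; apply/ffunP => B; rewrite !ffunE linearP. Qed.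
HB.instance Definition _ :=
  GRing.isLinear.Build R form form _ (mapf f) mapf_linear.

Lemma mapf0 : mapf f 0 = 0. Proof. exact: linear0. Qed.
Lemma mapfD u v : mapf f (u + v) = mapf f u + mapf f v. Proof. exact: linearD. Qed.
Lemma mapfB u v : mapf f (u - v) = mapf f u - mapf f v. Proof. exact: linearB. Qed.

Lemma mapf_wedge i w : mapf f (wedge i w) = wedge i (mapf f w).
Proof. by apply/ffunP => B; rewrite !ffunE; case: ifP; rewrite ?linearZ ?linear0. Qed.
Lemma mapf_contr i w : mapf f (contr i w) = contr i (mapf f w).
Proof. by apply/ffunP => B; rewrite !ffunE; case: ifP; rewrite ?linearZ ?linear0. Qed.
Lemma hom_mapf s w : hom s w -> hom s (mapf f w).
Proof. by move=> hw A /hw; rewrite ffunE => ->; rewrite linear0. Qed.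
Lemma hom1_mapf s w : hom1 s w -> hom1 s (mapf f w).
Proof. by move=> hw A /hw; rewrite ffunE => ->; rewrite linear0. Qed.
End Fmap.

Lemma homD s u v : hom s u -> hom s v -> hom s (u + v).
Proof. by move=> hu hv A sA; rewrite ffunE hu// hv// addr0. Qed.
Lemma homZ s k u : hom s u -> hom s (k *: u).
Proof. by move=> hu A sA; rewrite ffunE hu// scaler0. Qed.
Lemma hom0 s : hom s 0. Proof. by move=> A _; rewrite ffunE. Qed.
Lemma hom_sum s (I : Type) (r : seq I) (P : pred I) (F : I -> form) :
  (forall i, P i -> hom s (F i)) -> hom s (\sum_(i <- r | P i) F i).
Proof.
move=> hF; elim/big_rec : _ => [|i x Pi hx]; first exact: hom0.
by apply: homD => //; exact: hF.
Qed.
Lemma hom1D s u v : hom1 s u -> hom1 s v -> hom1 s (u + v).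
Proof. by move=> hu hv A sA; rewrite ffunE hu// hv// addr0. Qed.
Lemma hom1Z s k u : hom1 s u -> hom1 s (k *: u).
Proof. by move=> hu A sA; rewrite ffunE hu// scaler0. Qed.
Lemma hom10 s : hom1 s 0. Proof. by move=> A _; rewrite ffunE. Qed.
Lemma hom1_sum s (I : Type) (r : seq I) (P : pred I) (F : I -> form) :
  (forall i, P i -> hom1 s (F i)) -> hom1 s (\sum_(i <- r | P i) F i).
Proof.
move=> hF; elim/big_rec : _ => [|i x Pi hx]; first exact: hom10.
by apply: hom1D => //; exact: hF.
Qed.

End Exterior.

(** * The Koszul homotopy *)

Section MultiIndex.
Variable m : nat.
Implicit Types (I J : mindex m) (i j : 'I_m).

Definition mdecr I i : mindex m := [ffun j => (I j - (j == i))%N].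

Lemma mlen_incr I i : mlen (mincr I i) = (mlen I).+1.
Proof.
rewrite /mlen (eq_bigr (fun j => I j + (j == i))%N) => [|j _]; last by rewrite ffunE.
rewrite big_split /= -(addn1 (\sum_i0 _)%N); congr addn.
by rewrite -big_mkcond /= big_pred1_eq.
Qed.

Lemma mdecrK I i : (0 < I i)%N -> mincr (mdecr I i) i = I.
Proof.
move=> Ii; apply/ffunP => j; rewrite !ffunE; case: eqP => [->|_]; last by rewrite subn0 addn0.
by rewrite subnK.
Qed.

Lemma mincrK I i : mdecr (mincr I i) i = I.
Proof. by apply/ffunP => j; rewrite !ffunE addnK. Qed.

Lemma mlen_decr I i : (0 < I i)%N -> (mlen (mdecr I i)).+1 = mlen I.
Proof. by move=> Ii; rewrite -(mlen_incr _ i) mdecrK. Qed.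

Lemma mincrC I i j : mincr (mincr I i) j = mincr (mincr I j) i.
Proof. by apply/ffunP => k; rewrite !ffunE addnAC. Qed.

Lemma mdecrC I i j : mdecr (mdecr I i) j = mdecr (mdecr I j) i.
Proof. by apply/ffunP => k; rewrite !ffunE subnAC. Qed.

Lemma mdecr_neq I i j : i != j -> mdecr I i j = I j.
Proof. by move=> ij; rewrite ffunE eq_sym (negPf ij) subn0. Qed.

Lemma mincr_decr I i j : i != j -> mincr (mdecr I i) j = mdecr (mincr I j) i.
Proof.
move=> ij; apply/ffunP => k; rewrite !ffunE.
case: (eqVneq k i) => [->|]; last by rewrite !subn0.
by rewrite (negPf ij) !addn0.
Qed.

End MultiIndex.

Section Koszul.
Context {R : realFieldType} {m : nat} {M : lmodType R}.
Local Notation form := {ffun {set 'I_m} -> M}.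
Variable D : 'I_m -> {linear M -> M}.
Hypothesis DC : forall i j x, D i (D j x) = D j (D i x).

(** The total exterior derivative attached to the derivations D. *)
Definition dform (w : form) : form := \sum_i wedge i (mapf (D i) w).

Lemma dform_linear : linear dform.
Proof.
move=> k u v; rewrite /dform scaler_sumr -big_split; apply: eq_bigr => i _.
by rewrite !linearP.
Qed.
HB.instance Definition _ := GRing.isLinear.Build R form form _ dform dform_linear.

Lemma dform0 : dform 0 = 0. Proof. exact: linear0. Qed.
Lemma dformD u v : dform (u + v) = dform u + dform v. Proof. exact: linearD. Qed.
Lemma dformB u v : dform (u - v) = dform u - dform v. Proof. exact: linearB. Qed.

Lemma dform_wedge i w : dform (wedge i w) = - wedge i (dform w).
Proof.
rewrite /dform linear_sum -sumrN; apply: eq_bigr => j _.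
by rewrite mapf_wedge wedgeC.
Qed.

Implicit Types (th : mindex m -> form) (J : mindex m).

Definition jshift i th J : form := if (0 < J i)%N then th (mdecr J i) else 0.

Definition jT i th J : form := mapf (D i) (th J) + jshift i th J.

(** Families th_J of forms indexed by the multi-indices are the coefficients of the
    vertical differential sum_J th_J du_J. Since D_i du_J = du_(J + 1_i), the total
    derivatives act on the coefficients by the operators jT i, where
    (jT i th)_J = D_i th_J + th_(J - 1_i). *)
Definition jD th J : form := \sum_i wedge i (jT i th J).

Lemma jshiftC i j th J : jshift i (jshift j th) J = jshift j (jshift i th) J.
Proof.
rewrite /jshift; have [->//|ij] := eqVneq i j.
rewrite (mdecr_neq _ ij) (mdecr_neq J (i := j) (j := i)) 1?eq_sym//.
by case: ifP => // _; case: ifP => // _; rewrite mdecrC.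
Qed.

Lemma jTC i j th J : jT i (jT j th) J = jT j (jT i th) J.
Proof.
have fs k l : mapf (D k) (jshift l th J) = jshift l (fun J => mapf (D k) (th J)) J.
  by rewrite /jshift; case: ifP => //; rewrite linear0.
have sD k l : jshift k (jT l th) J =
    jshift k (fun J => mapf (D l) (th J)) J + jshift k (jshift l th) J.
  by rewrite /jT /jshift; case: ifP => // _; rewrite addr0.
rewrite {1}/jT [in RHS]/jT /= !sD /jT !linearD /= !fs addrACA jshiftC.
congr (_ + _ + _); apply/ffunP => A; rewrite !ffunE; exact: DC.
Qed.

(** The operators jT i commute with each other, as the D i do. *)
Lemma jD_comp th J : jD (jD th) J = 0.
Proof.
have E i : jT i (jD th) J = \sum_j wedge j (jT i (jT j th) J).
  have -> : jT i (jD th) J = mapf (D i) (jD th J) + jshift i (jD th) J by [].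
  have -> : jshift i (jD th) J = \sum_j wedge j (jshift i (jT j th) J).
    rewrite /jshift; case: ifP => // _.
    by rewrite big1// => j _; rewrite linear0.
  rewrite linear_sum -big_split /=; apply: eq_bigr => j _.
  by rewrite mapf_wedge -linearD.
rewrite {1}/jD; under eq_bigr do rewrite E linear_sum.
by apply: wedge_wedge_sum => i j; exact: jTC.
Qed.

Lemma jDB u v J : jD (fun J => u J - v J) J = jD u J - jD v J.
Proof.
rewrite /jD -sumrB; apply: eq_bigr => i _; rewrite -linearB; congr wedge.
rewrite /jT linearB opprD addrACA; congr (_ + _).
by rewrite /jshift; case: ifP; rewrite ?subr0.
Qed.

Lemma jDD u v J : jD (fun J => u J + v J) J = jD u J + jD v J.
Proof.
rewrite /jD -big_split; apply: eq_bigr => i _ /=; rewrite -linearD; congr wedge.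
rewrite /jT linearD addrACA; congr (_ + _).
by rewrite /jshift; case: ifP; rewrite ?addr0.
Qed.

Lemma hom1_jD s u : (forall J, hom1 s (u J)) -> forall J, hom s (jD u J).
Proof.
move=> hu J; apply: hom_sum => i _; apply: hom1_wedge; apply: hom1D.
  exact: hom1_mapf.
by rewrite /jshift; case: ifP => _; [exact: hu|exact: hom10].
Qed.

(** If th_J = 0 for all |J| > k, the terms of order k + 1 in jD th = 0 say that the
    th_J with |J| = k, viewed as the coefficients of a polynomial in m variables xi,
    are closed for the product by sum_i xi_i dt^i. This is the homotopy of the Koszul
    complex of the polynomial ring, given by the derivatives d/dxi_j and the
    contractions. *)
Definition top_homotopy (c : R) (k : nat) th J : form :=
  if (mlen J).+1 == k then
    c *: \sum_j (J j).+1%:R *: contr j (th (mincr J j))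
  else 0.

(** The Euler identity of the Koszul complex: on polynomials of degree k with
    coefficients of degree s, the anticommutator of the product by sum_i xi_i dt^i and
    of sum_j (d/dxi_j) contr_j is the product by k + m - s, which is invertible as
    s < m. *)
Lemma top_homotopyP (s k : nat) th J : (s < m)%N -> mlen J = k ->
  (forall J, hom s (th J)) ->
  (forall j, \sum_i wedge i (jshift i th (mincr J j)) = 0) ->
  \sum_i wedge i (jshift i (top_homotopy (k + m - s)%:R^-1 k th) J) = th J.
Proof.
move=> sm Jk hth cl; set c := _^-1.
have E i : wedge i (jshift i (top_homotopy c k th) J) =
   c *: \sum_(j < m) (if (0 < J i)%N then ((mdecr J i) j).+1%:R *: wedge i (contr j (th (mincr (mdecr J i) j))) else 0).
  rewrite /jshift; case: ifP => Ji; last by rewrite linear0 big1// scaler0.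
  rewrite /top_homotopy (mlen_decr Ji) Jk eqxx linearZ linear_sum; congr (_ *: _).
  by apply: eq_bigr => j _; rewrite linearZ.
rewrite (eq_bigr _ (fun i _ => E i)) -scaler_sumr exchange_big /=.
have F j : \sum_i (if (0 < J i)%N then ((mdecr J i) j).+1%:R *: wedge i (contr j (th (mincr (mdecr J i) j))) else 0)
  = (J j).+1%:R *: th J - wedge j (contr j (th J)).
  have Jj0 : (0 < mincr J j j)%N by rewrite ffunE eqxx addn1.
  have cl' : \sum_(i | i != j) contr j (wedge i (jshift i th (mincr J j))) = - contr j (wedge j (th J)).
    have := congr1 (contr j) (cl j); rewrite (bigD1 j) //= linear0 linearD linear_sum /=.
    by rewrite {1}/jshift Jj0 mincrK addrC => /eqP; rewrite addr_eq0 => /eqP.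
  rewrite (bigD1 j) //=.
  have -> : \sum_(i | i != j) (if (0 < J i)%N then ((mdecr J i) j).+1%:R *: wedge i (contr j (th (mincr (mdecr J i) j))) else 0)
     = (J j).+1%:R *: contr j (wedge j (th J)).
    rewrite -[contr j (wedge j _)]opprK -cl' scalerN scaler_sumr -sumrN.
    apply: eq_bigr => i ij; rewrite /jshift.
    have -> : mincr J j i = J i by rewrite ffunE (negPf ij) addn0.
    case: ifP => Ji; last by rewrite !linear0.
    by rewrite mdecr_neq// mincr_decr// wedge_contr_neq// scalerN.
  have -> : (if (0 < J j)%N then ((mdecr J j) j).+1%:R *: wedge j (contr j (th (mincr (mdecr J j) j))) else 0) = (J j)%:R *: wedge j (contr j (th J)).
    case: ifP => Jj; last by move/negbT: Jj; rewrite -eqn0Ngt => /eqP ->; rewrite scale0r.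
    by rewrite mdecrK// ffunE eqxx subn1 prednK.
  rewrite -[X in _ = _ *: X - _](wedge_contr_eq j (th J)) scalerDr addrAC; congr (_ + _).
  by rewrite -[X in _ = _ - X]scale1r -scalerBl -addn1 natrD addrK.
rewrite (eq_bigr _ (fun j _ => F j)) sumrB (euler_contr (hth J)) -scaler_suml.
have -> : \sum_(i < m) (J i).+1%:R = (k + m)%:R :> R.
  rewrite -natr_sum; congr _%:R; rewrite -Jk /mlen.
  under eq_bigr do rewrite -addn1.
  by rewrite big_split /= sum_nat_const card_ord muln1.
rewrite -scalerBl -natrB; last by rewrite (leq_trans (ltnW sm))// leq_addl.
rewrite scalerA mulVf ?scale1r// pnatr_eq0 -lt0n subn_gt0.
by rewrite (leq_trans sm)// leq_addl.
Qed.

Variable P : nat -> M -> Prop.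
Hypothesis (P0 : forall r, P r 0)
  (PA : forall r x y, P r x -> P r y -> P r (x + y))
  (PZ : forall r k x, P r x -> P r (k *: x))
  (PS : forall r x, P r x -> P r.+1 x)
  (PD : forall r i x, P r x -> P r.+1 (D i x)).

(** [P r x] bounds by r the order of x, which the derivations raise by one. *)
Definition ordf r (w : form) := forall A, P r (w A).

Lemma ordf_sum r (I : Type) (q : seq I) (Q : pred I) (F : I -> form) :
  (forall i, Q i -> ordf r (F i)) -> ordf r (\sum_(i <- q | Q i) F i).
Proof.
move=> hF A; elim/big_rec : _ => [|i x Qi hx]; first by rewrite ffunE.
by rewrite ffunE; apply: PA => //; exact: hF.
Qed.

Lemma ordf_wedge r i w : ordf r w -> ordf r (wedge i w).
Proof. by move=> hw A; rewrite ffunE; case: ifP => _; [exact: PZ|exact: P0]. Qed.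

Lemma ordf_contr r i w : ordf r w -> ordf r (contr i w).
Proof. by move=> hw A; rewrite ffunE; case: ifP => _; [exact: P0|exact: PZ]. Qed.

Lemma ordf_mapf r i w : ordf r w -> ordf r.+1 (mapf (D i) w).
Proof. by move=> hw A; rewrite ffunE; exact: PD. Qed.

Lemma ordf_jD r th : (forall J, ordf r (th J)) -> forall J, ordf r.+1 (jD th J).
Proof.
move=> hth J; apply: ordf_sum => i _; apply: ordf_wedge => A.
rewrite ffunE; apply: PA; first exact: ordf_mapf.
by rewrite /jshift; case: ifP => _; [apply: PS; exact: hth|rewrite ffunE].
Qed.

(** Closed families of degree s < m vanishing in orders >= k are exact: the Koszul
    homotopy on the terms of highest order lowers k by one, at the price of one
    derivation, and hence of one unit in the order of the coefficients. *)
Lemma koszul (s k r : nat) th : (s < m)%N -> (forall J, hom s (th J)) ->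
  (forall J, (k <= mlen J)%N -> th J = 0) -> (forall J, jD th J = 0) ->
  (forall J, ordf r (th J)) ->
  exists eta, [/\ forall J, hom1 s (eta J),
    forall J, (k <= (mlen J).+1)%N -> eta J = 0,
    forall J, th J = jD eta J & forall J, ordf (r + k) (eta J)].
Proof.
move=> sm; elim: k r th => [|k IH] r th hth thk cl oth.
  exists (fun=> 0); split => //.
  - by move=> J; exact: hom10.
  - move=> J; rewrite thk// /jD big1// => i _.
    by rewrite /jT /jshift if_same linear0 addr0 linear0.
  - by move=> J A; rewrite ffunE.
(* subtracting jD e removes the terms of order k from th *)
pose e := top_homotopy (k + m - s)%:R^-1 k th.
have eh J : hom1 s (e J).
  rewrite /e /top_homotopy; case: ifP => _; last exact: hom10.
  apply: hom1Z; apply: hom1_sum => j _; apply: hom1Z; exact: hom_contr.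
have eo J : ordf r (e J).
  rewrite /e /top_homotopy; case: ifP => _; last by move=> A; rewrite ffunE.
  move=> A; rewrite ffunE; apply: PZ; apply: ordf_sum => j _ B.
  by rewrite ffunE; apply: PZ; exact: ordf_contr.
have e0 J : (mlen J).+1 != k -> e J = 0 by rewrite /e /top_homotopy => /negPf ->.
have [|J Jk|J|J|eta [h1 h2 h3 h4]] := IH r.+1 (fun J => th J - jD e J).
- move=> J; apply: homD => //; rewrite -scaleN1r; apply: homZ; exact: hom1_jD.
- have jDe : jD e J = \sum_i wedge i (jshift i e J).
    apply: eq_bigr => i _; rewrite /jT e0 ?linear0 ?add0r//.
    by rewrite gtn_eqF// ltnS.
  have [Jk'|] := ltnP k (mlen J).
    rewrite thk// sub0r jDe big1 ?oppr0// => i _; rewrite /jshift.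
    case: ifP => Ji; last by rewrite linear0.
    by rewrite e0 ?linear0// mlen_decr// gtn_eqF.
  move=> Jk2; have Jk' : mlen J = k by apply/eqP; rewrite eqn_leq Jk Jk2.
  rewrite jDe (top_homotopyP sm Jk' hth) ?subrr// => j.
  rewrite -[RHS](cl (mincr J j)); apply: eq_bigr => i _.
  by rewrite /jT thk ?linear0 ?add0r// mlen_incr Jk'.
- by rewrite jDB cl jD_comp subr0.
- move=> A; rewrite ffunE; apply: PA; first by apply: PS; exact: oth.
  by rewrite ffunE -scaleN1r; apply: PZ; exact: ordf_jD.
exists (fun J => e J + eta J); split.
- by move=> J; exact: hom1D.
- move=> J Jk; rewrite e0 ?h2 ?addr0//; first exact: leq_trans Jk.
  by rewrite gtn_eqF.
- by move=> J; rewrite jDD -h3 addrC subrK.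
- move=> J A; rewrite ffunE; apply: PA; last by rewrite addnS; exact: h4.
  elim: (k.+1) => [|q IHq]; first by rewrite addn0; exact: eo.
  by rewrite addnS; exact: PS.
Qed.

End Koszul.

(** * Multi-indices and monomials *)

Section JetIndex.
Context {m : nat}.

Lemma mlen_mindex_of k (I : bmindex m k) : (mlen (mindex_of I) <= k)%N.
Proof.
rewrite /mlen (eq_bigr (fun i => val (val I i))) => [|i _]; last by rewrite ffunE.
exact: (valP I).
Qed.

Lemma mindex_of_inj k : injective (@mindex_of m k).
Proof.
move=> I I' /ffunP E; apply/val_inj/ffunP => i; apply/val_inj.
by have := E i; rewrite !ffunE.
Qed.

Lemma mindex_of_surj k (J : mindex m) : (mlen J <= k)%N ->
  exists I : bmindex m k, mindex_of I = J.
Proof.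
move=> Jk.
have Ji i : (J i < k.+1)%N.
  by rewrite ltnS (leq_trans _ Jk)// /mlen (bigD1 i)//= leq_addr.
pose I0 : {ffun 'I_m -> 'I_k.+1} := [ffun i => Ordinal (Ji i)].
have I0k : (\sum_(i < m) I0 i <= k)%N.
  by rewrite (eq_bigr J)// => i _; rewrite ffunE.
exists (exist _ I0 I0k); apply/ffunP => i; by rewrite !ffunE.
Qed.

(** The rank of a multi-index, if it is not too long, among the coordinates of jets. *)
Definition bmindex_of k (J : mindex m) : option (bmindex m k) :=
  [pick I | mindex_of I == J].

Lemma bmindex_ofK k (I : bmindex m k) : bmindex_of k (mindex_of I) = Some I.
Proof.
rewrite /bmindex_of; case: pickP => [I' /eqP /mindex_of_inj -> //|/(_ I)].
by rewrite eqxx.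
Qed.

Lemma bmindex_of_gt k (J : mindex m) : (k < mlen J)%N -> bmindex_of k J = None.
Proof.
rewrite /bmindex_of; case: pickP => // I /eqP <-.
by rewrite ltnNge mlen_mindex_of.
Qed.

Lemma bmindexP k (J : mindex m) :
  (exists2 I : bmindex m k, J = mindex_of I & bmindex_of k J = Some I) \/
  (k < mlen J)%N /\ bmindex_of k J = None.
Proof.
case: (leqP (mlen J) k) => Jk; last by right; rewrite bmindex_of_gt.
by have [I <-] := mindex_of_surj Jk; left; exists I => //; rewrite bmindex_ofK.
Qed.

Lemma mlen0 (J : mindex m) : mlen J = 0%N -> J = [ffun=> 0%N].
Proof.
move=> /eqP; rewrite /mlen sum_nat_eq0 => /forallP J0.
by apply/ffunP => i; rewrite ffunE; apply/eqP; exact: J0.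
Qed.

Lemma mlen_eq0 : mlen ([ffun=> 0%N] : mindex m) = 0%N.
Proof. by rewrite /mlen big1// => i _; rewrite ffunE. Qed.

(** Reindexing by J = I + 1_i: the boundary terms, with |I| = N, drop out by hypothesis,
    those with J_i = 0 by definition. *)
Lemma sum_mincr (R : pzRingType) N i (f g : mindex m -> R) :
  (forall I, mlen I = N -> f I * g (mincr I i) = 0) ->
  \sum_(I : bmindex m N) f (mindex_of I) * g (mincr (mindex_of I) i) =
  \sum_(J : bmindex m N) (if (0 < mindex_of J i)%N then f (mdecr (mindex_of J) i) else 0)
     * g (mindex_of J).
Proof.
move=> fN.
rewrite (bigID (fun I : bmindex m N => (mlen (mindex_of I) < N)%N)) /=.
rewrite [X in _ + X]big1 ?addr0; last first.
  move=> I; rewrite -leqNgt => NI; apply: fN; apply/eqP.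
  by rewrite eqn_leq NI mlen_mindex_of.
rewrite [RHS](eq_bigr (fun J : bmindex m N => if (0 < mindex_of J i)%N then
  f (mdecr (mindex_of J) i) * g (mindex_of J) else 0)); last first.
  by move=> J _; case: ifP => // _; rewrite mul0r.
rewrite -big_mkcond /=.
pose inc (I : bmindex m N) := odflt I (bmindex_of N (mincr (mindex_of I) i)).
pose dec (I : bmindex m N) := odflt I (bmindex_of N (mdecr (mindex_of I) i)).
have incE I : (mlen (mindex_of I) < N)%N -> mindex_of (inc I) = mincr (mindex_of I) i.
  rewrite /inc => IN; case: (bmindexP N (mincr (mindex_of I) i)) => [[I' -> ->]//|[]].
  by rewrite mlen_incr ltnNge IN.
have decE I : (0 < mindex_of I i)%N -> mindex_of (dec I) = mdecr (mindex_of I) i.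
  rewrite /dec => Ii; case: (bmindexP N (mdecr (mindex_of I) i)) => [[I' -> ->]//|[]].
  by have := mlen_mindex_of I; rewrite -(mlen_decr Ii) => /ltnW + ?; rewrite leqNgt => /negP.
rewrite [RHS](reindex_onto inc dec) /=; last first.
  move=> J Ji; apply: (@mindex_of_inj N); rewrite incE ?decE ?mdecrK//.
  by rewrite (mlen_decr Ji) mlen_mindex_of.
apply: eq_big => I.
  apply/idP/andP => [IN|[]].
    rewrite incE// ffunE eqxx addn1; split=> //; apply/eqP; apply: (@mindex_of_inj N).
    by rewrite decE incE ?mincrK// ffunE eqxx addn1.
  move=> Ii /eqP dI; have := decE _ Ii; rewrite dI => E.
  have := mlen_decr Ii; rewrite -E => ->; exact: mlen_mindex_of.
by move=> IN; rewrite incE// mincrK.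
Qed.

End JetIndex.

Section Monomials.
Context {R : realType} {m : nat}.
Implicit Types (t : 'rV[R]_m) (J : mindex m).

Lemma derive_line (V W : normedModType R) (f : V -> W) a v :
  'D_v f a = 'D_1 (fun h : R => f (h *: v + a)) 0.
Proof.
rewrite /derive; set g1 := fun h => h^-1 *: _; set g2 := fun h => h^-1 *: _.
suff -> : g1 = g2 by [].
by apply/funext => h; rewrite /g1 /g2 /= addr0 scale0r add0r [_%:A]mulr1.
Qed.

(** With the divided powers t^J / J! the partial derivatives carry no coefficient. *)
Definition dmon J t : R^o := \prod_(i < m) (t 0 i ^+ J i / (J i)`!%:R).

Lemma smooth_entry (p q : nat) (i : 'I_p) (j : 'I_q) (U : set 'M[R]_(p, q)) :
  smooth U (fun A : 'M[R]_(p, q) => A i j : R^o).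
Proof. exact: (smooth_cfun (C := coordsM p q) U (i, j)). Qed.

Lemma smooth_prod (V : normedModType R) (I : Type) (r : seq I) (P : pred I)
    (U : set V) (f : I -> V -> R^o) : open U ->
  (forall i, smooth U (f i)) -> smooth U (fun a => \prod_(i <- r | P i) f i a : R^o).
Proof.
move=> oU sf; elim: r => [|i r IH].
  by under eq_fun do rewrite big_nil; exact: smooth_cst.
under eq_fun do rewrite big_cons.
by case: (P i) => //; apply: smoothM.
Qed.

Lemma smooth_dmon J (U : set 'rV[R]_m) : smooth U (dmon J).
Proof.
apply: (smooth_sub (U := setT)) => //; apply: smooth_prod => [|i]; first exact: openT.
apply: smoothM; [exact: openT| |exact: smooth_cst].
by apply: smoothX; [exact: openT|exact: smooth_entry].
Qed.

Lemma derive_dmon J i t : 'D_(delta_mx 0 i) (dmon J) t =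
  if (0 < J i)%N then dmon (mdecr J i) t else 0.
Proof.
rewrite derive_line.
pose c : R := \prod_(j < m | j != i) (t 0 j ^+ J j / (J j)`!%:R).
have -> : (fun h : R => dmon J (h *: delta_mx 0 i + t)) =
    (fun h : R => (c / (J i)`!%:R) * (h + t 0 i) ^+ J i).
  apply/funext => h; rewrite /dmon (bigD1 i)//=.
  have -> : (h *: delta_mx 0 i + t) 0 i = h + t 0 i by rewrite !mxE !eqxx mulr1.
  have -> : \prod_(j < m | j != i) ((h *: delta_mx 0 i + t) 0 j ^+ J j / (J j)`!%:R) = c.
    by apply: eq_bigr => j ji; rewrite !mxE eqxx /= (negPf ji) mulr0 add0r.
  by rewrite mulrC mulrA mulrAC.
rewrite [LHS](_ : _ = (c / (J i)`!%:R) * ((J i)%:R * (t 0 i) ^+ (J i).-1)).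
  case: ifP => Ji; last by move/negbT: Ji; rewrite -eqn0Ngt => /eqP ->; rewrite mul0r mulr0.
  rewrite /dmon (bigD1 i)//= /mdecr !ffunE eqxx subn1.
  rewrite (eq_bigr (fun j => t 0 j ^+ J j / (J j)`!%:R)); last first.
    by move=> j ji; rewrite ffunE (negPf ji) subn0.
  rewrite -/c -[X in c / X%:R]/(_ `!) -(prednK Ji) factS /=.
  have f0 : (((J i).-1)`!%:R : R) != 0 by rewrite pnatr_eq0 -lt0n fact_gt0.
  have j0 : (((J i).-1.+1)%:R : R) != 0 by rewrite pnatr_eq0.
  by rewrite natrM; field; rewrite f0 addrC natr1 j0.
have h1 : is_derive (0 : R) (1 : R) (fun h : R => h + t 0 i) (1 + 0).
  exact: is_deriveD.
have h2 := is_deriveX (J i) h1.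
have h3 := @is_deriveZ _ _ _ _ (c / (J i)`!%:R) _ _ _ h2.
have [_ h4] := h3.
have -> : (fun h : R => c / (J i)`!%:R * (h + t 0 i) ^+ J i) =
    (c / (J i)`!%:R) \*: (fun h : R => h + t 0 i) ^+ J i.
  by apply/funext => h; rewrite /= exprfctE.
by rewrite h4 addr0 add0r [X in _ *: X]mulr1.
Qed.

End Monomials.

(** * Spaces of jets *)

Section DeriveLinear.
Context {R : realType}.

(** Continuous linear maps commute with directional derivatives. *)
Lemma derive_lin (V W W' : normedModType R) (L : {linear W -> W'}) (f : V -> W) a v :
  continuous L -> differentiable f a -> 'D_v (fun z => L (f z)) a = L ('D_v f a).
Proof.
move=> Lc df; have dL : differentiable L (f a) by exact: linear_differentiable.
have dLf : differentiable (L \o f) a := differentiable_comp df dL.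
rewrite [LHS](deriveE _ dLf) (deriveE _ df) (diff_comp df dL) /=.
by rewrite (diff_lin _ Lc).
Qed.

Lemma derive_linE (V W : normedModType R) (L : {linear V -> W}) a v :
  continuous L -> 'D_v L a = L v.
Proof.
move=> Lc; rewrite deriveE ?diff_lin//; exact: linear_differentiable.
Qed.

Lemma derive_sumf (V W : normedModType R) (I : Type) (r : seq I) (Q : pred I)
    (F : I -> V -> W) a v : (forall i, Q i -> differentiable (F i) a) ->
  differentiable (fun z => \sum_(i <- r | Q i) F i z) a /\
  'D_v (fun z => \sum_(i <- r | Q i) F i z) a = \sum_(i <- r | Q i) 'D_v (F i) a.
Proof.
move=> dF; elim: r => [|i r [dr Er]].
  under eq_fun do rewrite big_nil; rewrite big_nil.
  by split; [exact: differentiable_cst|exact: derive_cst].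
under eq_fun do rewrite big_cons; rewrite big_cons.
case: (boolP (Q i)) => // Qi; split; first exact: differentiableD (dF i Qi) dr.
rewrite -Er; apply: deriveD; apply: diff_derivable => //; exact: dF.
Qed.

Lemma deriveMf (V : normedModType R) (f g : V -> R^o) a v :
  differentiable f a -> differentiable g a ->
  'D_v (fun z => f z * g z : R^o) a = f a * 'D_v g a + g a * 'D_v f a.
Proof. by move=> df dg; apply: deriveM; exact: diff_derivable. Qed.

End DeriveLinear.

Section JetSpace.
Context {R : realType} {n m : nat}.
Local Notation jets k := 'M[R]_(n, #|bmindex m k|).
Implicit Types (al : 'I_n) (I J : mindex m) (i : 'I_m).

(** The coordinate u^al_J of a jet, which is 0 by convention if |J| > k: with this
    truncation the shifts below are endomorphisms of a space of jets of fixed order,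
    and still commute exactly. *)
Definition jc k al J (w : jets k) : R^o :=
  if bmindex_of k J is Some e then w al (enum_rank e) else 0.

Lemma jc_linear k al J : linear (@jc k al J).
Proof.
move=> c u v; rewrite /jc; case: bmindex_of => [I|]; first by rewrite !mxE.
by rewrite scaler0 addr0.
Qed.
HB.instance Definition _ k al J :=
  GRing.isLinear.Build R (jets k) R^o _ (@jc k al J) (@jc_linear k al J).

Lemma smooth_jc k al J (U : set (jets k)) : smooth U (@jc k al J).
Proof.
rewrite /jc; case: bmindex_of => [I|]; last exact: smooth_cst.
exact: smooth_entry.
Qed.

Lemma jc_cts k al J : continuous (@jc k al J).
Proof. by move=> w; apply: (smooth_cts (U := setT)) => //; exact: smooth_jc. Qed.

Lemma jc_gt k al J (w : jets k) : (k < mlen J)%N -> jc al J w = 0.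
Proof. by move=> kJ; rewrite /jc bmindex_of_gt. Qed.

Definition jmx k (F : 'I_n -> mindex m -> R) : jets k :=
  \matrix_(al, e) F al (mindex_of (enum_val e)).

Lemma jc_jmx k F al J : (mlen J <= k)%N -> jc al J (jmx k F) = F al J.
Proof.
move=> Jk; rewrite /jc; case: (bmindexP k J) => [[I -> ->]|[]].
  by rewrite mxE enum_rankK.
by rewrite ltnNge Jk.
Qed.

Lemma jc_ext k (w w' : jets k) :
  (forall al J, (mlen J <= k)%N -> jc al J w = jc al J w') -> w = w'.
Proof.
move=> H; apply/matrixP => al e; have := H al _ (mlen_mindex_of (enum_val e)).
by rewrite /jc bmindex_ofK enum_valK.
Qed.

Lemma smooth_jmx (V : normedModType R) k (U : set V) (F : 'I_n -> mindex m -> V -> R^o) :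
  open U -> (forall al J, (mlen J <= k)%N -> smooth U (F al J)) ->
  smooth U (fun z => jmx k (fun al J => F al J z)).
Proof.
move=> oU sF; apply: (smooth_coords (C := coordsM n #|bmindex m k|)) => // -[al e].
have -> : cfun ((al, e) : cidx (coordsM _ _)) \o (fun z => jmx k (fun al J => F al J z)) =
   F al (mindex_of (enum_val e)).
  by apply/funext => z; rewrite /= /entry mxE.
by apply: sF; exact: mlen_mindex_of.
Qed.

Lemma jc_derive (V : normedModType R) k al J (f : V -> jets k) a v :
  differentiable f a -> jc al J ('D_v f a) = 'D_v (fun z => jc al J (f z)) a.
Proof. by move=> df; rewrite (derive_lin (L := @jc k al J) _ (@jc_cts k al J)). Qed.

Definition jtrunc k l (w : jets k) : jets l := jmx l (fun al J => jc al J w).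

(** The vector field with components u^al_(J + 1_i), that is the vertical part of the
    total derivative d_i. *)
Definition jshf k l i (w : jets k) : jets l := jmx l (fun al J => jc al (mincr J i) w).

Lemma jtrunc_linear k l : linear (@jtrunc k l).
Proof.
move=> c u v; apply: jc_ext => al J Jl.
by rewrite linearP /= !jc_jmx// linearP.
Qed.
HB.instance Definition _ k l :=
  GRing.isLinear.Build R (jets k) (jets l) _ (@jtrunc k l) (@jtrunc_linear k l).

Lemma jshf_linear k l i : linear (@jshf k l i).
Proof.
move=> c u v; apply: jc_ext => al J Jl.
by rewrite linearP /= !jc_jmx// linearP.
Qed.
HB.instance Definition _ k l i :=
  GRing.isLinear.Build R (jets k) (jets l) _ (@jshf k l i) (@jshf_linear k l i).

Lemma smooth_jtrunc k l U : smooth U (@jtrunc k l).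
Proof.
apply: (smooth_sub (U := setT)) => //; apply: smooth_jmx => [|al J _].
  exact: openT.
exact: smooth_jc.
Qed.

Lemma smooth_jshf k l i U : smooth U (@jshf k l i).
Proof.
apply: (smooth_sub (U := setT)) => //; apply: smooth_jmx => [|al J _].
  exact: openT.
exact: smooth_jc.
Qed.

Lemma jtrunc_cts k l : continuous (@jtrunc k l).
Proof. by move=> w; apply: (smooth_cts (U := setT)) => //; exact: smooth_jtrunc. Qed.

Lemma jshf_cts k l i : continuous (@jshf k l i).
Proof. by move=> w; apply: (smooth_cts (U := setT)) => //; exact: smooth_jshf. Qed.

Lemma jc_jtrunc k l al J (w : jets k) : (mlen J <= l)%N ->
  jc al J (jtrunc l w) = jc al J w.
Proof. by move=> Jl; rewrite jc_jmx. Qed.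

Lemma jc_jshf k l i al J (w : jets k) : (mlen J <= l)%N ->
  jc al J (jshf l i w) = jc al (mincr J i) w.
Proof. by move=> Jl; rewrite jc_jmx. Qed.

Lemma jc_jshf_same k i al J (w : jets k) :
  jc al J (jshf k i w) = jc al (mincr J i) w.
Proof.
have [Jk|Jk] := leqP (mlen J) k; first exact: jc_jshf.
by rewrite !jc_gt// mlen_incr ltnW.
Qed.

Lemma jshfC k i j (w : jets k) : jshf k i (jshf k j w) = jshf k j (jshf k i w).
Proof. by apply: jc_ext => al J _; rewrite !jc_jshf_same mincrC. Qed.

Definition jdelta k al J : jets k := jmx k (fun be I => ((be == al) && (I == J))%:R).

Lemma jc_jdelta k al J be I : (mlen J <= k)%N ->
  jc be I (jdelta k al J) = ((be == al) && (I == J))%:R.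
Proof.
move=> Jk; have [Ik|Ik] := leqP (mlen I) k; first by rewrite jc_jmx.
rewrite jc_gt//; case: (eqVneq I J) => [IJ|]; last by rewrite andbF.
by move: Ik; rewrite IJ ltnNge Jk.
Qed.

Lemma jdelta_gt k al J : (k < mlen J)%N -> jdelta k al J = 0.
Proof.
move=> kJ; apply: jc_ext => be I Ik; rewrite jc_jmx// linear0.
case: (eqVneq I J) => [IJ|]; last by rewrite andbF.
by move: kJ; rewrite -IJ ltnNge Ik.
Qed.

Lemma jdelta_delta k al (I : bmindex m k) :
  jdelta k al (mindex_of I) = delta_mx al (enum_rank I).
Proof.
apply/matrixP => be e; rewrite !mxE; congr (_ && _)%:R.
apply/eqP/eqP => [/mindex_of_inj <-|->]; first by rewrite enum_valK.
by rewrite enum_rankK.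
Qed.

Lemma jets_sum k (w : jets k) :
  w = \sum_al \sum_(I : bmindex m k) jc al (mindex_of I) w *: jdelta k al (mindex_of I).
Proof.
apply: jc_ext => be J Jk; rewrite linear_sum (bigD1 be)//= [X in _ + X]big1 ?addr0; last first.
  move=> al alb; rewrite linear_sum big1// => I _; rewrite linearZ /= jc_jdelta ?mlen_mindex_of//.
  by rewrite eq_sym (negPf alb) scaler0.
have [I0 I0J] := mindex_of_surj Jk; rewrite linear_sum (bigD1 I0)//= [X in _ + X]big1 ?addr0.
  by rewrite linearZ /= jc_jdelta ?mlen_mindex_of// !eqxx I0J eqxx [RHS]mulr1.
move=> I II0; rewrite linearZ /= jc_jdelta ?mlen_mindex_of// eqxx /= -I0J.
by rewrite (inj_eq (@mindex_of_inj m k)) eq_sym (negPf II0) scaler0.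
Qed.

Lemma jshf_jdelta k i al J : (mlen J <= k)%N ->
  jshf k i (jdelta k al J) = if (0 < J i)%N then jdelta k al (mdecr J i) else 0.
Proof.
move=> Jk; apply: jc_ext => be I Ik; rewrite jc_jshf_same jc_jdelta//.
case: ifP => Ji.
  rewrite jc_jdelta; last by rewrite (leq_trans _ Jk)// -(mlen_decr Ji).
  congr (_ && _)%:R; apply/eqP/eqP => [<-|->]; [by rewrite mincrK|by rewrite mdecrK].
rewrite linear0; case: (eqVneq (mincr I i) J) => [IJ|]; last by rewrite andbF.
by move: Ji; rewrite -IJ ffunE eqxx addn1.
Qed.

Definition madd I J : mindex m := [ffun j => (I j + J j)%N].

(** At t, the jet of the polynomial map whose jet at 0 is w: the integral curve through w
    of the fields given by the shifts. *)
Definition jcurve k (w : jets k) (t : 'rV[R]_m) : jets k :=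
  jmx k (fun al I => \sum_(J : bmindex m k) jc al (madd I (mindex_of J)) w * dmon (mindex_of J) t).

Lemma smooth_jcurve k (w : jets k) U : smooth U (jcurve w).
Proof.
apply: (smooth_sub (U := setT)) => //; apply: smooth_jmx => [|al J _].
  exact: openT.
apply: smooth_sum => [|I _]; first exact: openT.
by apply: smoothM; [exact: openT|exact: smooth_cst|exact: smooth_dmon].
Qed.

Lemma dmon0 J : dmon J (0 : 'rV[R]_m) = (J == [ffun=> 0%N])%:R.
Proof.
rewrite /dmon; case: (eqVneq J) => [->|/eqP J0].
  by rewrite big1// => i _; rewrite ffunE expr0 fact0 divr1.
have [i Ji] : exists i, (0 < J i)%N.
  apply: contrapT => H; apply: J0; apply/ffunP => i; rewrite ffunE.
  by apply/eqP; rewrite -leqn0 leqNgt; apply/negP => Ji; apply: H; exists i.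
by rewrite (bigD1 i)//= mxE expr0n eqn0Ngt Ji !mul0r.
Qed.

Lemma jcurve0 k (w : jets k) : jcurve w 0 = w.
Proof.
apply: jc_ext => al I Ik; rewrite jc_jmx//.
have z0 : (mlen ([ffun=> 0%N] : mindex m) <= k)%N by rewrite mlen_eq0.
have [I0 I0E] := mindex_of_surj z0.
rewrite (bigD1 I0)//= [X in _ + X]big1 ?addr0.
  rewrite I0E dmon0 eqxx mulr1; congr (jc _ _ _).
  by apply/ffunP => j; rewrite !ffunE addn0.
move=> J JI0; rewrite dmon0 -I0E (inj_eq (@mindex_of_inj m k)) (negPf JI0).
by rewrite mulr0.
Qed.

Lemma mlen_madd I J : mlen (madd I J) = (mlen I + mlen J)%N.
Proof. by rewrite /mlen -big_split; apply: eq_bigr => i _; rewrite ffunE. Qed.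

Lemma madd_incr I J i : madd I (mincr J i) = madd (mincr I i) J.
Proof. by apply/ffunP => j; rewrite !ffunE addnCA addnC -addnA addnCA. Qed.

(** On coefficients: the derivative lowers the exponent of the monomial, and
    reindexing the sum raises the index of the jet coordinate. *)
Lemma derive_jcurve_delta k (w : jets k) i t :
  'D_(delta_mx 0 i) (jcurve w) t = jshf k i (jcurve w t).
Proof.
have dj : differentiable (jcurve w) t.
  by apply: (smooth_diff (U := setT)) => //; exact: smooth_jcurve.
apply: jc_ext => al I Ik; rewrite jc_derive// jc_jshf_same.
have -> : (fun t => jc al I (jcurve w t)) = (fun t =>
   \sum_(J : bmindex m k) jc al (madd I (mindex_of J)) w * dmon (mindex_of J) t).
  by apply/funext => s; rewrite jc_jmx.
have dd (J : bmindex m k) : derivable (dmon (mindex_of J)) t (delta_mx 0 i).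
  apply: diff_derivable; apply: (smooth_diff (U := setT)) => //; exact: smooth_dmon.
have -> : 'D_(delta_mx 0 i) (fun t =>
   \sum_(J : bmindex m k) jc al (madd I (mindex_of J)) w * dmon (mindex_of J) t : R^o) t
  = \sum_(J : bmindex m k) (if (0 < mindex_of J i)%N then dmon (mdecr (mindex_of J) i) t else 0)
     * jc al (madd I (mindex_of J)) w.
  have ddf (J : bmindex m k) : differentiable (dmon (mindex_of J)) t.
    apply: (smooth_diff (U := setT)) => //; exact: smooth_dmon.
  rewrite (derive_sumf (F := fun (J : bmindex m k) t => jc al (madd I (mindex_of J)) w * dmon (mindex_of J) t : R^o) _ _ _).2.
    apply: eq_bigr => J _; rewrite (deriveZ (jc al (madd I (mindex_of J)) w) (dd J)).
    by rewrite derive_dmon [RHS]mulrC.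
  by move=> J _; exact: (differentiableZ (jc al (madd I (mindex_of J)) w) (ddf J)).
rewrite -(sum_mincr (f := dmon ^~ t) (g := fun J => jc al (madd I J) w)); last first.
  move=> J Jk; rewrite jc_gt ?mulr0// mlen_madd mlen_incr Jk addnS ltnS leq_addl//.
have [Ik'|Ik'] := leqP (mlen (mincr I i)) k.
  rewrite jc_jmx//; apply: eq_bigr => J _.
  by rewrite mulrC madd_incr.
rewrite jc_gt// big1// => J _.
by rewrite madd_incr jc_gt ?mulr0// mlen_madd ltn_addr.
Qed.

Lemma derive_jcurve k (w : jets k) t v :
  'D_v (jcurve w) t = \sum_i v 0 i *: jshf k i (jcurve w t).
Proof.
have dj : differentiable (jcurve w) t.
  by apply: (smooth_diff (U := setT)) => //; exact: smooth_jcurve.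
rewrite (derive_dec (coordsM 1 m))// -(pair_bigA _ (fun (i : 'I_1) (j : 'I_m) => 
  v i j *: 'D_(delta_mx i j) (jcurve w) t)) /= big_ord1.
by apply: eq_bigr => i _; rewrite derive_jcurve_delta.
Qed.

End JetSpace.

(** * Modules of smooth functions *)

Section SmoothFunctions.
Context {R : realType} {V : normedModType R}.

Record openset := OpenSet { oset :> set V ; oset_open : open oset }.

Variable O : openset.

(** Smooth functions on O are represented by their extension by 0 outside of O. Then
    equality on O is equality, and these functions form a module over R. *)
Definition smooth_on : {pred V -> R^o} :=
  fun f => `[< smooth O f /\ forall z, ~ oset O z -> f z = 0 >].

Lemma smooth_on_closed : submod_closed smooth_on.
Proof.
split; first by apply/asboolP; split=> //; exact: smooth_cst.
move=> k f g /asboolP[sf f0] /asboolP[sg g0]; apply/asboolP; split.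
  apply: (smoothD (f := fun z => k * f z)); [exact: oset_open| |exact: sg].
  by apply: smoothM; [exact: oset_open|exact: smooth_cst|exact: sf].
by move=> z Oz; rewrite -[LHS]/(k * f z + g z) f0// g0// mulr0 addr0.
Qed.
HB.instance Definition _ :=
  GRing.isSubmodClosed.Build R (V -> R^o) smooth_on smooth_on_closed.

Record sfun := SFun { sval_fun :> V -> R^o ; _ : sval_fun \in smooth_on }.
HB.instance Definition _ := [isSub for sval_fun].
HB.instance Definition _ := [Choice of sfun by <:].
HB.instance Definition _ := [SubChoice_isSubLmodule of sfun by <:].

Implicit Types f g : sfun.

Lemma sfun_smooth f : smooth O f.
Proof. by case: f => f /= /asboolP[]. Qed.

Lemma sfun0 f z : ~ oset O z -> f z = 0.
Proof. by case: f => f /= /asboolP[_]; exact. Qed.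

Lemma sfun_ext f g : (forall z, oset O z -> f z = g z) -> f = g.
Proof.
move=> fg; apply/val_inj/funext => z.
by have [/fg//|Oz] := pselect (oset O z); rewrite /= !sfun0.
Qed.

Lemma sfD f g z : (f + g) z = f z + g z. Proof. by []. Qed.
Lemma sfZ (k : R) f z : (k *: f) z = k * f z. Proof. by []. Qed.
Lemma sfN f z : (- f) z = - f z. Proof. by []. Qed.
Lemma sf0 z : (0 : sfun) z = 0. Proof. by []. Qed.
Lemma sf_sum (I : Type) (r : seq I) (P : pred I) (F : I -> sfun) z :
  (\sum_(i <- r | P i) F i) z = \sum_(i <- r | P i) F i z.
Proof. by elim/big_rec2 : _ => // i x y _ <-. Qed.

(** A smooth function on O is cut off outside of O; other functions go to 0. *)
Lemma to_sfun_subproof (f : V -> R^o) :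
  {g : sfun | smooth O f -> forall z, oset O z -> g z = f z}.
Proof.
exists (insubd 0 (fun z => if `[< oset O z >] then f z else 0)) => sf z Oz.
have H : (fun z => if `[< oset O z >] then f z else 0) \in smooth_on.
  apply/asboolP; split; last by move=> y Oy; case: asboolP.
  by apply: (smooth_ext (oset_open O) _ sf) => y Oy; case: asboolP.
by rewrite -[LHS]/(val (insubd 0 _) z) insubdK//; case: asboolP.
Qed.

Definition to_sfun (f : V -> R^o) : sfun := sval (to_sfun_subproof f).

Lemma to_sfunE (f : V -> R^o) z : smooth O f -> oset O z -> to_sfun f z = f z.
Proof. by move=> sf; exact: (svalP (to_sfun_subproof f)). Qed.

End SmoothFunctions.

Section VectorFields.
Context {R : realType} {V : normedModType R} (C : coords V) (O : openset (V := V)).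
Local Notation sfun := (sfun O).
Implicit Types f g : sfun.

Lemma smooth_vder X f : smooth O X -> smooth O (fun z => 'D_(X z) f z : R^o).
Proof.
move=> sX; apply: (smooth_vfield C (oset_open O) sX); exact: sfun_smooth.
Qed.

Lemma vder_subproof X f :
  {g : sfun | smooth O X -> forall z, oset O z -> g z = 'D_(X z) f z}.
Proof.
exists (to_sfun O (fun z => 'D_(X z) f z)) => sX z Oz.
exact: (to_sfunE (smooth_vder f sX)).
Qed.

Definition vder X f : sfun := sval (vder_subproof X f).

Lemma vderE X f z : smooth O X -> oset O z -> vder X f z = 'D_(X z) f z.
Proof. by move=> sX; exact: (svalP (vder_subproof X f)). Qed.

Lemma sfun_diff f z : oset O z -> differentiable f z.
Proof. by apply: smooth_diff; exact: sfun_smooth. Qed.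

Lemma vder_linear X : smooth O X -> linear (vder X).
Proof.
move=> sX k f g; apply: sfun_ext => z Oz.
rewrite sfD sfZ !vderE//.
have df := sfun_diff f Oz; have dg := sfun_diff g Oz.
have -> : (k *: f + g : sfun) = (k *: (f : V -> R^o) + (g : V -> R^o)) :> (V -> R^o) by [].
rewrite deriveD; [|apply: diff_derivable|exact: diff_derivable].
  by rewrite deriveZ//; exact: diff_derivable.
exact: differentiableZ.
Qed.

(** Leibniz rule for D_X f = sum_c X_c d_c f, with Schwarz for the second derivatives. *)
Lemma derive_vfield (f : V -> R^o) (X : V -> V) z v : smooth O f -> smooth O X -> oset O z ->
  'D_v (fun z => 'D_(X z) f z : R^o) z =
  'D_(X z) (fun z => 'D_v f z : R^o) z + 'D_('D_v X z) f z.
Proof.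
move=> sf sX Oz; have oO := oset_open O.
have dX y : oset O y -> differentiable X y by exact: smooth_diff.
have df y : oset O y -> differentiable f y by exact: smooth_diff.
have dD u y : oset O y -> differentiable (fun z => 'D_u f z : R^o) y.
  by apply: smooth_diff; exact: smooth_derive.
have sc (c : cidx C) : smooth O (fun z => cfun c (X z) : R^o).
  exact: (smooth_lin oO (@cfun_cts _ _ C c) sX).
have dc (c : cidx C) : differentiable (fun z => cfun c (X z) : R^o) z.
  exact: smooth_diff (sc c) Oz.
have -> : 'D_v (fun z => 'D_(X z) f z : R^o) z =
   'D_v (fun z => \sum_(c : cidx C) cfun c (X z) * 'D_(cvec c) f z : R^o) z.
  apply: near_eq_derive; near=> y; apply: derive_dec; apply: df.
  by near: y; exact: smooth_open_near.
rewrite (derive_sumf (F := fun c z => cfun c (X z) * 'D_(cvec c) f z : R^o) _ _ _).2; last first.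
  by move=> c _; apply: differentiableM; [exact: dc|exact: dD].
rewrite [X in X + _](derive_dec C); last exact: dD.
rewrite [X in _ + X](derive_dec C); last exact: df.
rewrite -big_split; apply: eq_bigr => c _ /=.
rewrite (deriveMf _ (dc c) (dD _ _ Oz)) (derive_lin _ (@cfun_cts _ _ C c) (dX _ Oz)).
rewrite (derive_swap (a := z) v (cvec c) oO Oz sf).
by congr (_ + _); rewrite mulrC.
Unshelve. all: by end_near. Qed.

(** The second derivatives cancel by Schwarz, and the others by the hypothesis on X, Y. *)
Lemma vder_comm X Y f : smooth O X -> smooth O Y ->
  (forall z, oset O z -> 'D_(X z) Y z = 'D_(Y z) X z) ->
  vder X (vder Y f) = vder Y (vder X f).
Proof.
move=> sX sY XY; apply: sfun_ext => z Oz; have oO := oset_open O.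
have sf := sfun_smooth f.
rewrite (vderE (vder Y f) sX Oz) (vderE (vder X f) sY Oz).
have E Z W : smooth O W -> 'D_(Z z) (vder W f) z = 'D_(Z z) (fun z => 'D_(W z) f z : R^o) z.
  move=> sW; apply: near_eq_derive; near=> y; apply: vderE => //.
  by near: y; exact: smooth_open_near.
rewrite (E X Y sY) (E Y X sX) (derive_vfield _ sf sY Oz) (derive_vfield _ sf sX Oz).
apply: f_equal2; last exact: (congr1 (fun u => 'D_u f z) (XY z Oz)).
exact: (derive_swap (a := z) (Y z) (X z) oO Oz sf).
Unshelve. all: by end_near. Qed.

End VectorFields.

(** * The local model *)

Section Pairs.
Context {R : realType}.
Implicit Types V W : normedModType R.

Lemma smooth_fst V W (U : set (V * W)) : smooth U (fun z : V * W => z.1).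
Proof.
by apply: (@smoothL R (V * W)%type V U fst) => x; exact: cvg_fst.
Qed.

Lemma smooth_snd V W (U : set (V * W)) : smooth U (fun z : V * W => z.2).
Proof.
by apply: (@smoothL R (V * W)%type W U snd) => x; exact: cvg_snd.
Qed.

Lemma smooth_pair V W W' (C : coords W) (C' : coords W') (U : set V)
    (f : V -> W) (g : V -> W') : open U ->
  smooth U f -> smooth U g -> smooth U (fun z => (f z, g z)).
Proof.
move=> oU sf sg; apply: (smooth_coords (C := coordsP C C')) => // -[] c.
  exact: (smooth_lin oU (@cfun_cts _ _ C c) sf).
exact: (smooth_lin oU (@cfun_cts _ _ C' c) sg).
Qed.

Lemma derive_pair V W W' (f : V -> W) (g : V -> W') a v :
  differentiable f a -> differentiable g a ->
  'D_v (fun z => (f z, g z)) a = ('D_v f a, 'D_v g a).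
Proof.
move=> df dg; rewrite deriveE; last exact: differentiable_pair.
by rewrite diff_pair// !deriveE.
Qed.

End Pairs.

Section LocalModel.
Context {R : realType} {n m N : nat}.
Local Notation jets := 'M[R]_(n, #|bmindex m N|).
Local Notation VV := ('rV[R]_m * jets)%type.
Variables (w0 : jets) (d e : R).
Implicit Types (al : 'I_n) (I J : mindex m) (i : 'I_m) (z : VV) (r : nat).

(** Forms in the local model have coefficients depending on a time t in R^m and on a
    jet u of order N. The coefficients of a form on frames do not depend on t; time
    provides room for the reference curve and for the Poincare lemma on R^m. *)
Definition box_set : set VV := [set z | `|z.1| < d /\ `|z.2 - w0| < e].

Lemma box_set_open : open box_set.
Proof.
have -> : box_set = fst @^-1` ball 0 d `&` snd @^-1` ball w0 e.
  apply/seteqP; split=> -[t w]; rewrite -!ball_normE /box_set /= sub0r normrN distrC//.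
apply: openI; apply: open_comp; try exact: ball_open.
- by move=> z _; exact: cvg_fst.
- by move=> z _; exact: cvg_snd.
Qed.

Definition box : openset (V := VV) := OpenSet box_set_open.
Local Notation sfun := (sfun box).
Local Notation form := {ffun {set 'I_m} -> sfun}.
Implicit Types f g : sfun.

Let CM : coords jets := coordsM n #|bmindex m N|.
Let CT : coords 'rV[R]_m := coordsM 1 m.
Let CC : coords VV := coordsP CT CM.

(** The total derivative d_i = d/dt^i + sum u^al_(J + 1_i) d/du^al_J, as a vector field. *)
Definition Xf i z : VV := (delta_mx 0 i, jshf N i z.2).

Lemma smooth_Xf i U : smooth U (Xf i).
Proof.
apply: (smooth_sub (U := setT)) => //.
apply: (smooth_pair CT CM openT); first exact: smooth_cst.
apply: (smooth_map_comp CM CM openT openT (smooth_snd setT) _ (smooth_jshf N i setT)) => //.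
Qed.

Lemma derive_Xf i z v : 'D_v (Xf i) z = (0, jshf N i v.2).
Proof.
have ds : differentiable (fun z : VV => z.2) z.
  by apply: (smooth_diff (U := setT)) => //; exact: smooth_snd.
have dj (w : jets) : differentiable (jshf N i) w.
  by apply: (smooth_diff (U := setT)) => //; exact: smooth_jshf.
rewrite derive_pair; [|exact: differentiable_cst|exact: (differentiable_comp ds (dj _))].
rewrite derive_cst (derive_lin _ (@jshf_cts R n m N N i) ds).
by rewrite (@derive_linE R VV jets snd)// => x; exact: cvg_snd.
Qed.

Definition Dt i f : sfun := vder CC (Xf i) f.

Lemma DtE i f z : oset box z -> Dt i f z = 'D_(Xf i z) f z.
Proof. by apply: vderE; exact: smooth_Xf. Qed.

Lemma Dt_linear i : linear (Dt i).
Proof. by apply: vder_linear; exact: smooth_Xf. Qed.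
HB.instance Definition _ i := GRing.isLinear.Build R sfun sfun _ (Dt i) (Dt_linear i).

(** Because the shifts commute. *)
Lemma DtC i j f : Dt i (Dt j f) = Dt j (Dt i f).
Proof.
apply: vder_comm; [exact: smooth_Xf|exact: smooth_Xf|] => z _.
by rewrite !derive_Xf /= jshfC.
Qed.

Definition agree r z z' :=
  z.1 = z'.1 /\ forall al J, (mlen J <= r)%N -> jc al J z.2 = jc al J z'.2.

(** Functions of t and of the derivatives of order at most r. The truncation of the
    shifts at order N is invisible on them as long as r < N. *)
Definition ord r f := forall z z', oset box z -> oset box z' -> agree r z z' -> f z = f z'.

Lemma ord0 r : ord r 0. Proof. by []. Qed.
Lemma ordD r f g : ord r f -> ord r g -> ord r (f + g).
Proof. by move=> rf rg z z' Oz Oz' zz'; rewrite !sfD (rf z z')// (rg z z'). Qed.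
Lemma ordZ r k f : ord r f -> ord r (k *: f).
Proof. by move=> rf z z' Oz Oz' zz'; rewrite !sfZ (rf z z'). Qed.
Lemma ord_le r r' f : (r <= r')%N -> ord r f -> ord r' f.
Proof.
move=> rr' rf z z' Oz Oz' [z1 z2]; apply: rf => //; split => // al J Jr.
by apply: z2; exact: leq_trans rr'.
Qed.
Lemma ordS r f : ord r f -> ord r.+1 f.
Proof. exact: ord_le. Qed.

Lemma near_box_line z v : oset box z -> \forall h \near (0 : R), oset box (h *: v + z).
Proof.
move=> Oz.
have c : {for (0 : R), continuous (fun h : R => h *: v + z)}.
  by apply: differentiable_continuous.
have := smooth_open_near box_set_open Oz.
move: c; rewrite /prop_for /continuous_at scale0r add0r; exact.
Qed.

(** The difference quotients coincide near 0. *)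
Lemma derive_agree f z z' v v' : oset box z -> oset box z' ->
  (forall h, oset box (h *: v + z) -> oset box (h *: v' + z') ->
    f (h *: v + z) = f (h *: v' + z')) ->
  'D_v f z = 'D_v' f z'.
Proof.
move=> Oz Oz' H; rewrite derive_line [RHS]derive_line; apply: near_eq_derive.
near=> h; apply: H; near: h; exact: near_box_line.
Unshelve. all: by end_near. Qed.

Lemma ord_Dt r i f : ord r f -> ord r.+1 (Dt i f).
Proof.
move=> rf z z' Oz Oz' [z1 z2]; rewrite !DtE//; apply: derive_agree => // h Oh Oh'.
apply: rf => //; split; first by rewrite /= z1.
move=> al J Jr; rewrite /= !linearP /= !jc_jshf_same !z2//; last by rewrite mlen_incr.
exact: leqW.
Qed.

Definition partial al J f : sfun := vder CC (fun=> (0, jdelta N al J)) f.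

Lemma partialE al J f z : oset box z -> partial al J f z = 'D_(0, jdelta N al J) f z.
Proof. by apply: vderE; exact: smooth_cst. Qed.

Lemma partial_linear al J : linear (partial al J).
Proof. by apply: vder_linear; exact: smooth_cst. Qed.
HB.instance Definition _ al J :=
  GRing.isLinear.Build R sfun sfun _ (partial al J) (partial_linear al J).

Lemma ord_partial r al J f : ord r f -> ord r (partial al J f).
Proof.
move=> rf z z' Oz Oz' [z1 z2]; rewrite !partialE//; apply: derive_agree => // h Oh Oh'.
apply: rf => //; split; first by rewrite /= z1.
by move=> be I Ir; rewrite /= !linearP /= z2.
Qed.

Lemma partial_gt r al J f : ord r f -> (r < mlen J)%N -> partial al J f = 0.
Proof.
move=> rf rJ; apply: sfun_ext => z Oz; rewrite partialE// sf0.
have [JN|JN] := leqP (mlen J) N; last by rewrite jdelta_gt// derive0.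
rewrite (@derive_agree f z z _ 0) ?derive0// => h Oh Oh'; apply: rf => //; split.
  by rewrite /= !scaler0.
move=> be I Ir; rewrite /= !linearP /= jc_jdelta// linear0 scaler0.
case: (eqVneq I J) => [IJ|]; last by rewrite andbF scaler0.
by move: rJ; rewrite -IJ ltnNge Ir.
Qed.

Lemma partial_gtN al J f : (N < mlen J)%N -> partial al J f = 0.
Proof.
by move=> NJ; apply: sfun_ext => z Oz; rewrite partialE// jdelta_gt// derive0.
Qed.

(** The commutation rule of d/du_J and D_i, whence the operators jT i. The constant
    vector field d/du_J is shifted to d/du_(J - 1_i). *)
Lemma partial_Dt al J i f : (mlen J <= N)%N ->
  partial al J (Dt i f) = Dt i (partial al J f) +
    (if (0 < J i)%N then partial al (mdecr J i) f else 0).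
Proof.
move=> JN; apply: sfun_ext => z Oz; rewrite sfD (partialE _ _ _ Oz) (DtE _ _ Oz).
have sf := sfun_smooth f.
have e1 : 'D_(0, jdelta N al J) (Dt i f) z =
    'D_(0, jdelta N al J) (fun z => 'D_(Xf i z) f z : R^o) z.
  apply: near_eq_derive; near=> y; apply: DtE.
  by near: y; exact: (smooth_open_near box_set_open).
have e2 : 'D_(Xf i z) (partial al J f) z =
    'D_(Xf i z) (fun z => 'D_(0, jdelta N al J) f z : R^o) z.
  apply: near_eq_derive; near=> y; apply: partialE.
  by near: y; exact: (smooth_open_near box_set_open).
rewrite e1 e2 (derive_vfield CC _ sf (smooth_Xf i _) Oz); congr (_ + _).
rewrite derive_Xf /= jshf_jdelta//; case: ifP => Ji; first by rewrite partialE.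
by rewrite derive0.
Unshelve. all: by end_near. Qed.

Definition vert al J (w : form) : form := mapf (partial al J) w.

(** Differentiating the coefficients of the total derivative of a form: by the
    commutation rule, the vertical differential of a closed form is a closed family. *)
Lemma jD_vert r al w J : (r < N)%N -> ordf ord r w ->
  jD Dt (fun J => vert al J w) J = vert al J (dform Dt w).
Proof.
move=> rN ow; rewrite /vert /dform linear_sum; apply: eq_bigr => i _.
rewrite [RHS](mapf_wedge (partial al J)); congr (wedge i _); apply/ffunP => A; rewrite /jT /jshift !ffunE.
have [JN|NJ] := leqP (mlen J) N.
  apply/esym/(etrans (partial_Dt al i (w A) JN)); congr (_ + _).
  by case: ifP; rewrite ffunE.
have pJ g : partial al J g = 0 by exact: partial_gtN.
rewrite /= !pJ linear0 add0r; case: ifP => Ji; rewrite ffunE//.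
apply: (partial_gt _ (ow A)); apply: leq_trans rN _.
by rewrite -ltnS (mlen_decr Ji).
Qed.

End LocalModel.

(** * The vertical homotopy *)

Section VerticalHomotopy.
Context {R : realType} {n m N : nat}.
Local Notation jets := 'M[R]_(n, #|bmindex m N|).
Local Notation VV := ('rV[R]_m * jets)%type.
Variables (w0 : jets) (d e : R).
Hypothesis small : forall t : 'rV[R]_m, `|t| < d -> `|jcurve w0 t - w0| < e.
Implicit Types (al : 'I_n) (I J : mindex m) (i : 'I_m) (z : VV) (r : nat).
Local Notation box := (@box R n m N w0 d e).
Local Notation Dt := (@Dt R n m N w0 d e).
Local Notation ord := (@ord R n m N w0 d e).
Local Notation sfun := (sfun box).
Local Notation form := {ffun {set 'I_m} -> sfun}.
Let CM : coords jets := coordsM n #|bmindex m N|.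
Let CT : coords 'rV[R]_m := coordsM 1 m.
Let CC : coords VV := coordsP CT CM.

Lemma boxP z : oset box z <-> `|z.1| < d /\ `|z.2 - w0| < e.
Proof. by []. Qed.

(** The reference curve: a solution of the total derivatives, along which d_i becomes
    the derivative d/dt^i. *)
Definition bz z : jets := jcurve w0 z.1.

Lemma smooth_bz U : smooth U bz.
Proof.
apply: (smooth_sub (U := setT)) => //.
exact: (smooth_map_comp CT CM openT openT (smooth_fst setT) (fun _ _ => Logic.I) (smooth_jcurve w0 setT)).
Qed.

Lemma derive_bz z v : 'D_v bz z = \sum_i v.1 0 i *: jshf N i (bz z).
Proof.
have d1 : differentiable (fun z : VV => z.1) z.
  by apply: (smooth_diff (U := setT)) => //; exact: smooth_fst.
have db : differentiable (jcurve w0) z.1.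
  by apply: (smooth_diff (U := setT)) => //; exact: smooth_jcurve.
rewrite (derive_comp v d1 db) derive_jcurve.
have -> // : 'D_v (fun z : VV => z.1) z = v.1.
by apply: (@derive_linE R VV 'rV[R]_m fst) => x; exact: cvg_fst.
Qed.

(** The affine homotopy, in the jet variable, from the reference curve to the identity. *)
Definition hmt (x : R * VV) : VV := (x.2.1, bz x.2 + x.1 *: (x.2.2 - bz x.2)).

Lemma hmt0 z : hmt (0, z) = (z.1, bz z).
Proof. by rewrite /hmt /= scale0r addr0. Qed.

Lemma hmt1 z : hmt (1, z) = z.
Proof. by rewrite /hmt /= scale1r addrC subrK; case: z. Qed.

(** Both ends lie in the ball of radius e around w0, which is convex. *)
Lemma box_hmt (l : R) z : 0 <= l <= 1 -> oset box z -> oset box (hmt (l, z)).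
Proof.
move=> /andP[l0 l1] /boxP[zt zu]; apply/boxP; split => //=.
have bzw : `|bz z - w0| < e by exact: small.
have -> : bz z + l *: (z.2 - bz z) - w0 = (1 - l) *: (bz z - w0) + l *: (z.2 - w0).
  by move: (bz z) z.2 w0 => a b c; apply/matrixP => x y; rewrite !mxE; ring.
apply: le_lt_trans (ler_normD _ _) _.
have l1' : 0 <= 1 - l by rewrite subr_ge0.
rewrite !normrZ (ger0_norm l0) (ger0_norm l1').
have -> : e = (1 - l) * e + l * e by ring.
have [->|ln0] := eqVneq l 0; first by rewrite !mul0r !addr0 subr0 !mul1r.
apply: ler_ltD; first by rewrite ler_wpM2l// ltW.
by rewrite ltr_pM2l// lt_def ln0.
Qed.

Lemma smooth_hmt U : smooth U hmt.
Proof.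
apply: (smooth_sub (U := setT)) => //.
have s2 := @smooth_snd R R^o VV setT.
have sb : smooth setT (fun x : R * VV => bz x.2).
  exact: (smooth_map_comp CC CM openT openT s2 (fun _ _ => Logic.I) (smooth_bz setT)).
have s22 : smooth setT (fun x : R * VV => x.2.2).
  exact: (smooth_map_comp CC CM openT openT s2 (fun _ _ => Logic.I) (smooth_snd setT)).
have s21 : smooth setT (fun x : R * VV => x.2.1).
  exact: (smooth_map_comp CC CT openT openT s2 (fun _ _ => Logic.I) (smooth_fst setT)).
apply: (smooth_pair CT CM openT s21).
apply: smoothD => //; first exact: openT.
apply: (smooth_coords (C := CM)) => [|c]; first exact: openT.
have -> : cfun c \o (fun x : R * VV => x.1 *: (x.2.2 - bz x.2)) =
   (fun x : R * VV => x.1 * (cfun c \o (fun x : R * VV => x.2.2 - bz x.2)) x : R^o).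
  by apply/funext => x; rewrite /= linearZ.
apply: smoothM; [exact: openT|exact: (@smooth_fst R R^o VV setT)|].
apply: (smooth_lin openT (@cfun_cts _ _ CM c)); apply: smoothB => //; exact: openT.
Qed.

Lemma derive_hmt (l : R) z (k : R) (v : VV) : 'D_(k, v) hmt (l, z) =
  (v.1, 'D_v bz z + (k *: (z.2 - bz z) + l *: (v.2 - 'D_v bz z))).
Proof.
have dh : differentiable hmt (l, z).
  by apply: (smooth_diff (U := setT)) => //; exact: smooth_hmt.
have dbz : differentiable bz z by apply: (smooth_diff (U := setT)) => //; exact: smooth_bz.
have dfst : differentiable (@fst R VV) (l, z).
  by apply: (smooth_diff (U := setT)) => //; exact: (@smooth_fst R R^o VV setT).
have dsnd : differentiable (@snd R VV) (l, z).
  by apply: (smooth_diff (U := setT)) => //; exact: (@smooth_snd R R^o VV setT).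
have Dfst : 'D_(k, v) (@fst R VV) (l, z) = k.
  by apply: (@derive_linE R (R * VV)%type R^o fst) => x; exact: cvg_fst.
have Dsnd : 'D_(k, v) (@snd R VV) (l, z) = v.
  by apply: (@derive_linE R (R * VV)%type VV snd) => x; exact: cvg_snd.
have d1 : differentiable (fun x : R * VV => x.2.1) (l, z).
  by apply: (differentiable_comp dsnd); apply: (smooth_diff (U := setT)) => //; exact: smooth_fst.
have d2 : differentiable (fun x : R * VV => x.2.2) (l, z).
  by apply: (differentiable_comp dsnd); apply: (smooth_diff (U := setT)) => //; exact: smooth_snd.
have D1 : 'D_(k, v) (fun x : R * VV => x.2.1) (l, z) = v.1.
  have fc : continuous (@fst 'rV[R]_m jets) by move=> x; exact: cvg_fst.
  by rewrite (@derive_lin R (R * VV)%type VV 'rV[R]_m fst snd _ _ fc dsnd) Dsnd.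
have D2 : 'D_(k, v) (fun x : R * VV => x.2.2) (l, z) = v.2.
  have fc : continuous (@snd 'rV[R]_m jets) by move=> x; exact: cvg_snd.
  by rewrite (@derive_lin R (R * VV)%type VV jets snd snd _ _ fc dsnd) Dsnd.
have db : differentiable (fun x : R * VV => bz x.2) (l, z).
  by apply: (differentiable_comp dsnd).
have Db : 'D_(k, v) (fun x : R * VV => bz x.2) (l, z) = 'D_v bz z.
  by rewrite (@derive_comp R VV (R * VV)%type jets bz snd (l, z) (k, v) dsnd dbz) Dsnd.
pose g2 := fun x : R * VV => bz x.2 + x.1 *: (x.2.2 - bz x.2).
have dg2 : differentiable g2 (l, z).
  by apply: (@differentiable_comp _ _ _ _ hmt snd _ dh); apply: (smooth_diff (U := setT)) => //; exact: smooth_snd.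
rewrite (derive_pair (k, v) d1 dg2) D1; congr (_, _).
have dsub : differentiable (fun x : R * VV => x.2.2 - bz x.2) (l, z).
  exact: differentiableB.
have Dsub : 'D_(k, v) (fun x : R * VV => x.2.2 - bz x.2) (l, z) = v.2 - 'D_v bz z.
  by rewrite deriveB ?D2 ?Db//; exact: diff_derivable.
apply: jc_ext => al J _; rewrite (jc_derive _ _ _ dg2) linearD.
have dj (f : R * VV -> jets) : differentiable f (l, z) ->
    differentiable (fun x => jc al J (f x)) (l, z).
  move=> df; apply: (differentiable_comp df).
  by apply: (smooth_diff (U := setT)) => //; exact: smooth_jc.
have -> : (fun x : R * VV => jc al J (g2 x)) =
   (fun x => jc al J (bz x.2)) + (fun x : R * VV => x.1 * jc al J (x.2.2 - bz x.2) : R^o).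
  by apply/funext => x; rewrite /g2 linearD linearZ.
have dm : differentiable (fun x : R * VV => x.1 * jc al J (x.2.2 - bz x.2) : R^o) (l, z).
  by apply: differentiableM => //; exact: dj.
rewrite deriveD; [|exact: (diff_derivable (dj _ db))|exact: diff_derivable].
rewrite -(jc_derive _ _ _ db) Db; congr (_ + _).
rewrite (deriveMf _ dfst (dj _ dsub)) Dfst -(jc_derive _ _ _ dsub) Dsub /=.
have -> (a b : jets) : jc al J (k *: a + l *: b) = k * jc al J a + l * jc al J b.
  by rewrite linearP linearZ.
by rewrite addrC mulrC.
Qed.

Lemma derive_bz_Xf i z : 'D_(Xf i z) bz z = jshf N i (bz z).
Proof.
rewrite derive_bz (bigD1 i)//= !mxE !eqxx scale1r big1 ?addr0// => j ji.
by rewrite mxE (negPf ji) andbF scale0r.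
Qed.

(** The shift is linear and the reference curve is an integral curve of the fields Xf i,
    so these are invariant by the homotopy at each fixed l. *)
Lemma derive_hmt_Xf i (l : R) z :
  'D_((0 : R), Xf i z) hmt (l, z) = Xf i (hmt (l, z)).
Proof.
rewrite derive_hmt derive_bz_Xf scale0r add0r /Xf /=; congr (_, _).
have E (a b : jets) : jshf N i (a + l *: (b - a)) = jshf N i a + l *: (jshf N i b - jshf N i a).
  by rewrite (addrC a) linearP addrC linearB.
exact/esym/E.
Qed.

Lemma derive_hmt_l (l : R) z :
  'D_((1 : R), (0 : VV)) hmt (l, z) = (0, z.2 - bz z).
Proof.
have Db0 : 'D_(0 : VV) bz z = 0 by exact: derive0.
by rewrite derive_hmt Db0 subr0 scaler0 addr0 add0r scale1r.
Qed.

(** The components of the vertical vector from the reference curve to u. *)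
Definition vc al J z : R^o := jc al J (z.2 - bz z).

Lemma smooth_vc al J U : smooth U (vc al J).
Proof.
apply: (smooth_sub (U := setT)) => //.
apply: (smooth_comp CM openT _ (fun _ _ => Logic.I) (smooth_jc al J setT)).
by apply: smoothB; [exact: openT|exact: smooth_snd|exact: smooth_bz].
Qed.

Lemma derive_vc i al J z : 'D_(Xf i z) (vc al J) z = vc al (mincr J i) z.
Proof.
have dbz : differentiable bz z by apply: (smooth_diff (U := setT)) => //; exact: smooth_bz.
have ds : differentiable (fun z : VV => z.2) z.
  by apply: (smooth_diff (U := setT)) => //; exact: smooth_snd.
have db : differentiable (fun z : VV => z.2 - bz z) z by exact: differentiableB.
rewrite /vc -(jc_derive _ _ _ db) deriveB; [|exact: diff_derivable..].
rewrite derive_bz_Xf (@derive_linE R VV jets snd); last by move=> x; exact: cvg_snd.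
have -> : (Xf i z).2 - jshf N i (bz z) = jshf N i (z.2 - bz z) by rewrite linearB.
exact: jc_jshf_same.
Qed.

Definition hdom : set (R * VV) := [set x | oset box x.2 /\ oset box (hmt x)].

Lemma hdom_open : open hdom.
Proof.
have -> : hdom = snd @^-1` (oset box) `&` hmt @^-1` (oset box) by [].
apply: openI; apply: open_comp; try exact: oset_open.
  by move=> x _; exact: cvg_snd.
by move=> x _; apply: (smooth_cts (U := setT)) => //; exact: smooth_hmt.
Qed.

Lemma hdomP (l : R) z : 0 <= l <= 1 -> oset box z -> hdom (l, z).
Proof. by move=> l01 Oz; split => //; exact: box_hmt. Qed.

(** The family eta evaluated on the velocity of the homotopy, an analogue of the
    interior product in the homotopy formula for differential forms. *)
Definition Itg (eta : 'I_n -> mindex m -> form) A (x : R * VV) : R^o :=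
  \sum_al \sum_(J : bmindex m N) eta al (mindex_of J) A (hmt x) * vc al (mindex_of J) x.2.

Lemma smooth_sfun_hmt (f : sfun) : smooth hdom (fun x => f (hmt x) : R^o).
Proof.
apply: (smooth_comp CC hdom_open (smooth_hmt hdom) _ (sfun_smooth f)).
by move=> x [].
Qed.

Lemma smooth_vc2 al J : smooth hdom (fun x : R * VV => vc al J x.2 : R^o).
Proof.
exact: (smooth_comp CC hdom_open (@smooth_snd R R^o VV hdom) (fun _ _ => Logic.I) (smooth_vc al J setT)).
Qed.

Lemma smooth_Itg eta A : smooth hdom (Itg eta A).
Proof.
apply: smooth_sum => [|al _]; first exact: hdom_open.
apply: smooth_sum => [|J _]; first exact: hdom_open.
by apply: smoothM; [exact: hdom_open|exact: smooth_sfun_hmt|exact: smooth_vc2].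
Qed.

Lemma Itg_cts01 eta A z : oset box z -> cts01 (fun l => Itg eta A (l, z)).
Proof.
exact: (slice_cts01 (O := oset box) hdomP (smooth_Itg eta A)).
Qed.

Lemma derive_sfun_hmt i (f : sfun) (l : R) z : hdom (l, z) ->
  'D_((0 : R), Xf i z) (fun x => f (hmt x) : R^o) (l, z) = Dt i f (hmt (l, z)).
Proof.
move=> lz; have [Oz Oh] := lz.
have dh : differentiable hmt (l, z).
  by apply: (smooth_diff (U := setT)) => //; exact: smooth_hmt.
rewrite (derive_comp _ dh (sfun_diff f Oh)) (derive_hmt_Xf i l z).
by rewrite (DtE i f Oh).
Qed.

Lemma derive_vc2 i al J (l : R) z :
  'D_((0 : R), Xf i z) (fun x : R * VV => vc al J x.2 : R^o) (l, z) = vc al (mincr J i) z.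
Proof.
have dsnd : differentiable (@snd R VV) (l, z).
  by apply: (smooth_diff (U := setT)) => //; exact: (@smooth_snd R R^o VV setT).
have Dsnd : 'D_((0 : R), Xf i z) (@snd R VV) (l, z) = Xf i z.
  by apply: (@derive_linE R (R * VV)%type VV snd) => x; exact: cvg_snd.
have dv : differentiable (vc al J) z.
  by apply: (smooth_diff (U := setT)) => //; exact: smooth_vc.
rewrite (@derive_comp R VV (R * VV)%type R^o (vc al J) snd (l, z) _ dsnd dv) Dsnd.
exact: derive_vc.
Qed.

(** The derivation falls on the coefficients, giving D_i eta_J, and on the components of
    the velocity, giving (u - b)_(J + 1_i); reindexing turns the second term into
    eta_(J - 1_i), so the sum is jT i eta. *)
Lemma derive_Itg i eta A (l : R) z : hdom (l, z) ->
  (forall al J, (N <= mlen J)%N -> eta al J = 0) ->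
  'D_((0 : R), Xf i z) (Itg eta A) (l, z) =
  Itg (fun al => jT Dt i (eta al)) A (l, z).
Proof.
move=> lz eta0.
have df (f : sfun) : differentiable (fun x => f (hmt x) : R^o) (l, z).
  exact: smooth_diff (smooth_sfun_hmt f) lz.
have dv al J : differentiable (fun x : R * VV => vc al J x.2 : R^o) (l, z).
  exact: smooth_diff (smooth_vc2 al J) lz.
have dm al J : differentiable (fun x : R * VV => eta al J A (hmt x) * vc al J x.2 : R^o) (l, z).
  by apply: differentiableM; [exact: df|exact: dv].
have ds al : differentiable (fun x : R * VV => \sum_(J : bmindex m N) eta al (mindex_of J) A (hmt x) * vc al (mindex_of J) x.2 : R^o) (l, z).
  by have [] := derive_sumf (index_enum _) ((0 : R), Xf i z) (fun (J : bmindex m N) (_ : true) => dm al (mindex_of J)).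
rewrite /Itg (derive_sumf _ _ (fun al (_ : true) => ds al)).2; apply: eq_bigr => al _.
rewrite (derive_sumf _ _ (fun (J : bmindex m N) (_ : true) => dm al (mindex_of J))).2.
pose h := hmt (l, z).
transitivity (\sum_(J : bmindex m N) (eta al (mindex_of J) A h * vc al (mincr (mindex_of J) i) z
    + Dt i (eta al (mindex_of J) A) h * vc al (mindex_of J) z)).
  apply: eq_bigr => J _; rewrite (deriveMf _ (df _) (dv _ _)).
  by rewrite derive_vc2 derive_sfun_hmt// [X in _ + X]mulrC.
rewrite big_split /= (sum_mincr (f := fun J => eta al J A h) (g := fun J => vc al J z)); last first.
  by move=> J JN; rewrite eta0 ?JN// ffunE sf0 mul0r.
rewrite -big_split; apply: eq_bigr => J _ /=; rewrite -mulrDl; congr (_ * _).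
by rewrite /jT /jshift !ffunE sfD addrC; congr (_ + _); case: ifP; rewrite // ffunE sf0.
Qed.

Definition hpsi (eta : 'I_n -> mindex m -> form) : form :=
  [ffun A => to_sfun box (fun z => int01 (fun l => Itg eta A (l, z)))].

Lemma smooth_int_Itg eta A : smooth (oset box) (fun z => int01 (fun l => Itg eta A (l, z)) : R^o).
Proof.
by have [] := smooth_int01 CC (oset_open box) hdomP (smooth_Itg eta A).
Qed.

Lemma hpsiE eta A z : oset box z -> hpsi eta A z = int01 (fun l => Itg eta A (l, z)).
Proof. by move=> Oz; rewrite ffunE; exact: (to_sfunE (smooth_int_Itg eta A)). Qed.

Lemma Dt_hpsi i eta A z : oset box z ->
  (forall al J, (N <= mlen J)%N -> eta al J = 0) ->
  Dt i (hpsi eta A) z = int01 (fun l => Itg (fun al => jT Dt i (eta al)) A (l, z)).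
Proof.
move=> Oz eta0; rewrite (DtE _ _ Oz).
have -> : 'D_(Xf i z) (hpsi eta A) z = 'D_(Xf i z) (fun z => int01 (fun l => Itg eta A (l, z)) : R^o) z.
  apply: near_eq_derive; near=> y; apply: hpsiE.
  by near: y; exact: (smooth_open_near (oset_open box)).
have [_ ->] := smooth_int01 CC (oset_open box) hdomP (smooth_Itg eta A); last exact: Oz.
by apply: eq_int01 => l l01; apply: derive_Itg => //; exact: hdomP.
Unshelve. all: by end_near. Qed.

Lemma form_sum_val (I : Type) (q : seq I) (P : pred I) (F : I -> form) A z :
  (\sum_(i <- q | P i) F i) A z = \sum_(i <- q | P i) F i A z.
Proof. by rewrite sum_ffunE sf_sum. Qed.

Lemma wedge_val i (w : form) A z :
  wedge i w A z = if i \in A then sgn i (A :\ i) * w (A :\ i) z else 0.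
Proof. by rewrite ffunE; case: ifP. Qed.

(** Differentiation under the integral sign turns the total derivative of the integral
    into the integral of jD eta. *)
Lemma dform_hpsi eta A z : oset box z ->
  (forall al J, (N <= mlen J)%N -> eta al J = 0) ->
  dform Dt (hpsi eta) A z = int01 (fun l => Itg (fun al => jD Dt (eta al)) A (l, z)).
Proof.
move=> Oz eta0; rewrite /dform form_sum_val.
pose F i l := if i \in A then sgn i (A :\ i) * Itg (fun al => jT Dt i (eta al)) (A :\ i) (l, z) else 0.
have cF i : cts01 (F i).
  rewrite /F; case: (i \in A); last exact: cts01_cst.
  by apply: cts01Z; exact: Itg_cts01.
have [_] := int01_sum (index_enum 'I_m) (fun i (_ : true) => cF i).
have -> : int01 (fun l => Itg (fun al => jD Dt (eta al)) A (l, z)) =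
    int01 (fun l => \sum_i F i l).
  apply: eq_int01 => l _; rewrite /F /Itg.
  rewrite (eq_bigr (fun al => \sum_i (if i \in A then sgn i (A :\ i) *
     \sum_(J : bmindex m N) jT Dt i (eta al) (mindex_of J) (A :\ i) (hmt (l, z)) * vc al (mindex_of J) z else 0))).
    rewrite exchange_big; apply: eq_bigr => i _ /=; case: ifP => // _.
      by rewrite mulr_sumr.
    by rewrite big1.
  move=> al _; rewrite (eq_bigr (fun J : bmindex m N => \sum_i (if i \in A then sgn i (A :\ i) *
     (jT Dt i (eta al) (mindex_of J) (A :\ i) (hmt (l, z)) * vc al (mindex_of J) z) else 0))).
    rewrite exchange_big; apply: eq_bigr => i _ /=; case: ifP => // _.
      by rewrite mulr_sumr.
    by rewrite big1.
  move=> J _; rewrite /jD form_sum_val mulr_suml; apply: eq_bigr => i _.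
  by rewrite wedge_val; case: ifP => _; rewrite ?mul0r// mulrA.
move=> ->; apply: eq_bigr => i _; rewrite wedge_val /F.
case: (i \in A); last by rewrite int01_cst.
by rewrite ffunE Dt_hpsi// int01Z//; exact: Itg_cts01.
Qed.

End VerticalHomotopy.

Section VerticalExactness.
Context {R : realType} {n m N : nat}.
Local Notation jets := 'M[R]_(n, #|bmindex m N|).
Local Notation VV := ('rV[R]_m * jets)%type.
Variables (w0 : jets) (d e : R).
Hypothesis small : forall t : 'rV[R]_m, `|t| < d -> `|jcurve w0 t - w0| < e.
Implicit Types (al : 'I_n) (I J : mindex m) (i : 'I_m) (z : VV) (r : nat).
Local Notation box := (@box R n m N w0 d e).
Local Notation Dt := (@Dt R n m N w0 d e).
Local Notation ord := (@ord R n m N w0 d e).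
Local Notation sfun := (sfun box).
Local Notation bz := (@bz R n m N w0).
Local Notation hmt := (@hmt R n m N w0).
Local Notation vc := (@vc R n m N w0).
Local Notation hdom := (@hdom R n m N w0 d e).
Local Notation form := {ffun {set 'I_m} -> sfun}.

(** If the total derivative of Phi does not depend on the jet, the derivatives of Phi
    with respect to the jet coordinates form a closed family, hence equal jD eta.
    Then Phi - Phi(t, b(t)), the integral over l of the derivative of Phi along the
    homotopy, is the total derivative of the integral of eta on its velocity. The
    primitive has order 2r + 1, and vanishes if Phi has order 0, as eta_J is then 0
    for all J. *)
Lemma vertical_homotopy s r (Phi : form) : (s < m)%N -> (r < N)%N ->
  ordf ord r Phi -> hom s Phi ->
  (forall al J, vert al J (dform Dt Phi) = 0) ->
  exists Psi : form, [/\ hom1 s Psi, ordf ord (r + r.+1) Psi,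
    (r = 0%N -> Psi = 0) &
    forall A z, oset box z -> Phi A z - Phi A (z.1, bz z) = dform Dt Psi A z].
Proof.
move=> sm rN oPhi hPhi cl.
pose th al J := vert al J Phi.
have H al : exists eta : mindex m -> form, [/\ forall J, hom1 s (eta J),
    forall J, (r.+1 <= (mlen J).+1)%N -> eta J = 0,
    forall J, th al J = jD Dt eta J & forall J, ordf ord (r + r.+1) (eta J)].
  apply: (@koszul _ _ _ Dt (@DtC R n m N w0 d e) ord).
  - exact: ord0.
  - exact: ordD.
  - exact: ordZ.
  - exact: ordS.
  - exact: ord_Dt.
  - exact: sm.
  - by move=> J; exact: hom_mapf.
  - by move=> J rJ; apply/ffunP => A; rewrite !ffunE; apply: partial_gt rJ; exact: oPhi.
  - by move=> J; exact: etrans (jD_vert (r := r) al J rN oPhi) (cl al J).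
  - by move=> J A; rewrite ffunE; apply: ord_partial; exact: oPhi.
pose eta al := sval (cid (H al)).
have etaP al : [/\ forall J, hom1 s (eta al J),
    forall J, (r.+1 <= (mlen J).+1)%N -> eta al J = 0,
    forall J, th al J = jD Dt (eta al) J & forall J, ordf ord (r + r.+1) (eta al J)].
  by rewrite /eta; case: cid.
have eta0 al J : (N <= mlen J)%N -> eta al J = 0.
  by move=> NJ; have [_ -> //] := etaP al; rewrite ltnS (leq_trans (ltnW rN)).
exists (hpsi eta); split.
- move=> A sA; apply: sfun_ext => z Oz; rewrite (hpsiE small eta A Oz) sf0 -[RHS](int01_cst 0).
  apply: eq_int01 => l _; rewrite /Itg big1// => al _; rewrite big1// => J _.
  by have [h _ _ _] := etaP al; rewrite h// sf0 mul0r.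
- move=> A z z' Oz Oz' [z1 z2]; rewrite (hpsiE small eta A Oz) (hpsiE small eta A Oz'); apply: eq_int01 => l l01.
  apply: eq_bigr => al _; apply: eq_bigr => J _.
  have [_ h0 _ ho] := etaP al.
  have [rJ|Jr] := leqP r (mlen (mindex_of J)); first by rewrite h0// ffunE !sf0 !mul0r.
  have bzz : bz z = bz z' by rewrite /bz z1.
  congr (_ * _).
    apply: ho; try exact: (box_hmt small).
    split => /=; first exact: z1.
    move=> be I Ir; rewrite bzz.
    have E (a b : jets) : jc be I (a + l *: (b - a)) = jc be I a + l * (jc be I b - jc be I a).
      by rewrite (addrC a) linearP addrC linearB.
    by rewrite !E (z2 _ _ Ir).
  have E (a b : jets) : jc al (mindex_of J) (b - a) = jc al (mindex_of J) b - jc al (mindex_of J) a.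
    by rewrite linearB.
  rewrite /vc bzz !E z2//; apply: leq_trans (ltnW Jr) _; exact: leq_addr.
- move=> r0; apply/ffunP => A; apply: sfun_ext => z Oz; rewrite (hpsiE small eta A Oz) ffunE sf0 -[RHS](int01_cst 0).
  apply: eq_int01 => l _; rewrite /Itg big1// => al _; rewrite big1// => J _.
  by have [_ h _ _] := etaP al; rewrite h ?r0// ffunE sf0 mul0r.
- move=> A z Oz; rewrite (dform_hpsi small _ Oz eta0).
  pose g (x : R * VV) : R^o := Phi A (hmt x).
  have sg : smooth hdom g by exact: smooth_sfun_hmt.
  have Dg (l : R) : 0 <= l <= 1 -> 'D_((1 : R), (0 : VV)) g (l, z) =
     Itg (fun al => jD Dt (eta al)) A (l, z).
    move=> l01; have lz := hdomP small l01 Oz; have [_ Oh] := lz.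
    have dh : differentiable hmt (l, z).
      by apply: (smooth_diff (U := setT)) => //; exact: smooth_hmt.
    have dP := sfun_diff (Phi A) Oh.
    rewrite (derive_comp _ dh dP) derive_hmt_l.
    have -> : ((0 : 'rV[R]_m), z.2 - bz z) = \sum_al \sum_(J : bmindex m N)
       vc al (mindex_of J) z *: ((0 : 'rV[R]_m), jdelta N al (mindex_of J)).
      rewrite [in LHS](jets_sum (z.2 - bz z)).
      have pair_sum (I : finType) (F : I -> jets) :
          ((0 : 'rV[R]_m), \sum_i F i) = \sum_i ((0 : 'rV[R]_m), F i).
        elim/big_rec2 : _ => // i x y _ <-.
        by rewrite -[RHS]/(0 + 0, _ + _) addr0.
      rewrite pair_sum; apply: eq_bigr => al _; rewrite pair_sum; apply: eq_bigr => J _.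
      by rewrite -[RHS]/(_ *: 0, _ *: _) scaler0.
    rewrite (deriveE _ dP) linear_sum; apply: eq_bigr => al _.
    rewrite linear_sum; apply: eq_bigr => J _.
    rewrite linearZ -(deriveE _ dP) -(partialE _ _ _ Oh).
    by have [_ _ <- _] := etaP al; rewrite /th /vert ffunE [LHS]mulrC.
  rewrite -(eq_int01 Dg).
  have line (l : R) : 0 <= l <= 1 -> is_derive l 1 (fun l : R => g (l, z)) ('D_((1 : R), (0 : VV)) g (l, z)).
    move=> l01; have dg := smooth_diff sg (hdomP small l01 Oz).
    have E (k : R) : ((0 : R), z) + k *: ((1 : R), (0 : VV)) = (k, z).
      by rewrite -[LHS]/(0 + k *: 1, z + k *: 0) add0r scaler0 addr0 [k *: 1]mulr1.
    have := @is_derive_line R (R * VV)%type g (0, z) (1, 0) l.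
    rewrite E => /(_ (diff_derivable dg)).
    by under eq_fun do rewrite E.
  rewrite (int01_FTC (F := fun l => g (l, z)) _ line); last first.
    move=> l l01.
    exact: (slice_cts (G := fun x : R * VV => 'D_((1 : R), (0 : VV)) g x) (O := oset box)
      (hdomP small) (smooth_derive ((1 : R), (0 : VV)) sg) l01 Oz).
  by rewrite /g hmt1 hmt0.
Qed.

End VerticalExactness.

(** * The radial homotopy *)

Section ContrClosed.
Context {R : realFieldType} {m : nat} {M : lmodType R}.
Variable D : 'I_m -> {linear M -> M}.

(** Cartan: contracting the closedness of w by d/dt^j gives its derivative along d/dt^j. *)
Lemma contr_closed j (w : {ffun {set 'I_m} -> M}) : dform D w = 0 ->
  \sum_i wedge i (contr j (mapf (D i) w)) = mapf (D j) w.
Proof.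
move=> dw; have := congr1 (contr j) dw; rewrite linear0 linear_sum (bigD1 j)//= => E.
rewrite (bigD1 j)//= -[RHS](wedge_contr_eq j); congr (_ + _).
rewrite (eq_bigr (fun i => - contr j (wedge i (mapf (D i) w)))); last first.
  by move=> i ij; rewrite wedge_contr_neq.
by rewrite sumrN; apply/esym/eqP; rewrite -addr_eq0; apply/eqP.
Qed.

End ContrClosed.

Section RadialHomotopy.
Context {R : realType} {n m N : nat}.
Local Notation jets := 'M[R]_(n, #|bmindex m N|).
Local Notation VV := ('rV[R]_m * jets)%type.
Variables (w0 : jets) (d e : R).
Hypothesis small : forall t : 'rV[R]_m, `|t| < d -> `|jcurve w0 t - w0| < e.
Implicit Types (al : 'I_n) (I J : mindex m) (i j : 'I_m) (z : VV) (r : nat).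
Local Notation box := (@box R n m N w0 d e).
Local Notation Dt := (@Dt R n m N w0 d e).
Local Notation ord := (@ord R n m N w0 d e).
Local Notation bz := (@bz R n m N w0).
Local Notation sfun := (sfun box).
Local Notation form := {ffun {set 'I_m} -> sfun}.
Let CM : coords jets := coordsM n #|bmindex m N|.
Let CT : coords 'rV[R]_m := coordsM 1 m.
Let CC : coords VV := coordsP CT CM.

(** The radial homotopy of the time variable, along the reference curve. *)
Definition rmt (x : R * VV) : VV := (x.1 *: x.2.1, jcurve w0 (x.1 *: x.2.1)).

Lemma rmt0 z : rmt (0, z) = (0, w0).
Proof. by rewrite /rmt /= scale0r jcurve0. Qed.

Lemma rmt1 z : rmt (1, z) = (z.1, bz z).
Proof. by rewrite /rmt /= scale1r. Qed.

Lemma box_rmt (l : R) z : 0 <= l <= 1 -> oset box z -> oset box (rmt (l, z)).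
Proof.
move=> /andP[l0 l1] /boxP[zt zu]; apply/boxP; rewrite /rmt /=.
have lt : `|l *: z.1| < d.
  by rewrite normrZ (ger0_norm l0) (le_lt_trans _ zt)// ler_piMl.
by split => //; exact: small.
Qed.

Let st (x : R * VV) : 'rV[R]_m := x.1 *: x.2.1.

Lemma smooth_st : smooth setT st.
Proof.
have s21 : smooth setT (fun x : R * VV => x.2.1).
  exact: (smooth_map_comp CC CT openT openT (@smooth_snd R R^o VV setT) (fun _ _ => Logic.I) (smooth_fst setT)).
apply: (smooth_coords (C := CT)) => [|c]; first exact: openT.
have -> : cfun c \o st = (fun x : R * VV => x.1 * (cfun c \o (fun x : R * VV => x.2.1)) x : R^o).
  by apply/funext => x; rewrite /= linearZ.
apply: smoothM; [exact: openT|exact: (@smooth_fst R R^o VV setT)|].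
exact: (smooth_lin openT (@cfun_cts _ _ CT c)).
Qed.

Lemma smooth_rmt U : smooth U rmt.
Proof.
apply: (smooth_sub (U := setT)) => //.
apply: (smooth_pair CT CM openT smooth_st).
exact: (smooth_map_comp CT CM openT openT smooth_st (fun _ _ => Logic.I) (smooth_jcurve w0 setT)).
Qed.

Lemma derive_rmt (l : R) z (k : R) (v : VV) : 'D_(k, v) rmt (l, z) =
  \sum_j (l * v.1 0 j + k * z.1 0 j) *: Xf j (rmt (l, z)).
Proof.
have dst : differentiable st (l, z) := smooth_diff smooth_st Logic.I.
have Dst : 'D_(k, v) st (l, z) = l *: v.1 + k *: z.1.
  have dfst : differentiable (@fst R VV) (l, z).
    by apply: (smooth_diff (U := setT)) => //; exact: (@smooth_fst R R^o VV setT).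
  have dsnd : differentiable (@snd R VV) (l, z).
    by apply: (smooth_diff (U := setT)) => //; exact: (@smooth_snd R R^o VV setT).
  have Dfst : 'D_(k, v) (@fst R VV) (l, z) = k.
    by apply: (@derive_linE R (R * VV)%type R^o fst) => x; exact: cvg_fst.
  have Dsnd : 'D_(k, v) (@snd R VV) (l, z) = v.
    by apply: (@derive_linE R (R * VV)%type VV snd) => x; exact: cvg_snd.
  have d1 : differentiable (fun x : R * VV => x.2.1) (l, z).
    by apply: (differentiable_comp dsnd); apply: (smooth_diff (U := setT)) => //; exact: smooth_fst.
  have D1 : 'D_(k, v) (fun x : R * VV => x.2.1) (l, z) = v.1.
    have fc : continuous (@fst 'rV[R]_m jets) by move=> x; exact: cvg_fst.
    by rewrite (@derive_lin R (R * VV)%type VV 'rV[R]_m fst snd _ _ fc dsnd) Dsnd.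
  apply/matrixP => i j; rewrite ord1 !mxE.
  have ec : continuous (entry (R := R) (p := 1) (q := m) (0, j)) by exact: (@cfun_cts _ _ CT (0, j)).
  have dj (f : R * VV -> 'rV[R]_m) : differentiable f (l, z) -> differentiable (fun x => f x 0 j : R^o) (l, z).
    move=> df; apply: (@differentiable_comp _ _ _ _ f (fun A : 'rV[R]_m => A 0 j : R^o) _ df).
    exact: (differentiable_coord _ 0 j).
  rewrite -[LHS]/(entry (0, j) ('D_(k, v) st (l, z))).
  rewrite -(@derive_lin R (R * VV)%type 'rV[R]_m R^o (entry (0, j)) st (l, z) (k, v) ec dst).
  have -> : (fun x => entry (0, j) (st x)) = (fun x : R * VV => x.1 * x.2.1 0 j : R^o).
    by apply/funext => x; rewrite /entry /st mxE.
  rewrite (deriveMf _ dfst (dj _ d1)) Dfst.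
  have E := @derive_lin R (R * VV)%type 'rV[R]_m R^o (entry (0, j)) (fun x => x.2.1) (l, z) (k, v) ec d1.
  by rewrite [X in _ * X + _]E D1 [X in _ + X]mulrC.
have djc : differentiable (jcurve w0) (st (l, z)).
  by apply: (smooth_diff (U := setT)) => //; exact: smooth_jcurve.
have dj2 : differentiable (jcurve w0 \o st) (l, z) by exact: differentiable_comp.
rewrite (derive_pair (k, v) dst dj2) (derive_comp _ dst djc) Dst derive_jcurve.
have pair_sum (F : 'I_m -> VV) : \sum_i F i = (\sum_i (F i).1, \sum_i (F i).2).
  by elim/big_rec3 : _ => // i x y q _ ->.
rewrite pair_sum; congr (_, _) => /=.
  rewrite [LHS]row_sum_delta; apply: eq_bigr => i _; by rewrite !mxE.
by apply: eq_bigr => i _; rewrite !mxE.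
Qed.

Lemma derive_rmt_Xf i (l : R) z :
  'D_((0 : R), Xf i z) rmt (l, z) = l *: Xf i (rmt (l, z)).
Proof.
rewrite derive_rmt (bigD1 i)//= big1 ?addr0.
  by rewrite mul0r addr0 mxE !eqxx mulr1.
by move=> j ji; rewrite mul0r addr0 mxE (negPf ji) andbF mulr0 scale0r.
Qed.

Lemma derive_rmt_l (l : R) z :
  'D_((1 : R), (0 : VV)) rmt (l, z) = \sum_j z.1 0 j *: Xf j (rmt (l, z)).
Proof.
by rewrite derive_rmt; apply: eq_bigr => j _; rewrite mul1r mxE mulr0 add0r.
Qed.

Definition rdom : set (R * VV) := [set x | oset box x.2 /\ oset box (rmt x)].

Lemma rdom_open : open rdom.
Proof.
have -> : rdom = snd @^-1` (oset box) `&` rmt @^-1` (oset box) by [].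
apply: openI; apply: open_comp; try exact: oset_open.
  by move=> x _; exact: cvg_snd.
by move=> x _; apply: (smooth_cts (U := setT)) => //; exact: smooth_rmt.
Qed.

Lemma rdomP (l : R) z : 0 <= l <= 1 -> oset box z -> rdom (l, z).
Proof. by move=> l01 Oz; split => //; exact: box_rmt. Qed.

Lemma smooth_sfun_rmt (f : sfun) : smooth rdom (fun x => f (rmt x) : R^o).
Proof.
apply: (smooth_comp CC rdom_open (smooth_rmt rdom) _ (sfun_smooth f)).
by move=> x [].
Qed.

Lemma derive_sfun_rmt i (f : sfun) (l : R) z : rdom (l, z) ->
  'D_((0 : R), Xf i z) (fun x => f (rmt x) : R^o) (l, z) = l * Dt i f (rmt (l, z)).
Proof.
move=> lz; have [Oz Oh] := lz.
have dh : differentiable rmt (l, z).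
  by apply: (smooth_diff (U := setT)) => //; exact: smooth_rmt.
rewrite (derive_comp _ dh (sfun_diff f Oh)) (derive_rmt_Xf i l z).
by rewrite (derivableZ_dir _ _ (sfun_diff f Oh)) (DtE i f Oh).
Qed.

Lemma derive_sfun_rmt_l (f : sfun) (l : R) z : rdom (l, z) ->
  'D_((1 : R), (0 : VV)) (fun x => f (rmt x) : R^o) (l, z) =
  \sum_j z.1 0 j * Dt j f (rmt (l, z)).
Proof.
move=> lz; have [Oz Oh] := lz.
have dh : differentiable rmt (l, z).
  by apply: (smooth_diff (U := setT)) => //; exact: smooth_rmt.
have df := sfun_diff f Oh.
rewrite (derive_comp _ dh df) (derive_rmt_l l z) (deriveE _ df) linear_sum.
by apply: eq_bigr => j _; rewrite linearZ -(deriveE _ df) -(DtE j f Oh).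
Qed.

Definition tc j (x : R * VV) : R^o := x.2.1 0 j.

Lemma smooth_tc j U : smooth U (tc j).
Proof.
apply: (smooth_sub (U := setT)) => //.
have s21 : smooth setT (fun x : R * VV => x.2.1).
  exact: (smooth_map_comp CC CT openT openT (@smooth_snd R R^o VV setT) (fun _ _ => Logic.I) (smooth_fst setT)).
exact: (smooth_comp CT openT s21 (fun _ _ => Logic.I) (smooth_entry 0 j setT)).
Qed.

Lemma derive_tc j (l k : R) z (v : VV) : 'D_(k, v) (tc j) (l, z) = v.1 0 j.
Proof.
have lin : linear (tc j).
  by move=> c x y; rewrite /tc /= !mxE.
pose L : {linear (R * VV)%type -> R^o} := HB.pack (tc j) (GRing.isLinear.Build _ _ _ _ (tc j) lin).
apply: (@derive_linE R (R * VV)%type R^o L) => x.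
by apply: (smooth_cts (U := setT)) => //; exact: smooth_tc.
Qed.

Definition rItg (s : nat) (Phi : form) A (x : R * VV) : R^o :=
  x.1 ^+ s * \sum_j tc j x * contr j Phi A (rmt x).

Lemma smooth_rItg s Phi A : smooth rdom (rItg s Phi A).
Proof.
apply: smoothM; first exact: rdom_open.
  by apply: smoothX; [exact: rdom_open|exact: (@smooth_fst R R^o VV rdom)].
apply: smooth_sum => [|j _]; first exact: rdom_open.
by apply: smoothM; [exact: rdom_open|exact: smooth_tc|exact: smooth_sfun_rmt].
Qed.

(** The derivative of the integrand along Xf i. *)
Definition rItgD (s : nat) (Phi : form) i A (x : R * VV) : R^o :=
  x.1 ^+ s * (contr i Phi A (rmt x) +
    x.1 * \sum_j tc j x * contr j (mapf (Dt i) Phi) A (rmt x)).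

Lemma derive_rItg s i Phi A (l : R) z : rdom (l, z) ->
  'D_((0 : R), Xf i z) (rItg s Phi A) (l, z) = rItgD s Phi i A (l, z).
Proof.
move=> lz.
have df (f : sfun) : differentiable (fun x => f (rmt x) : R^o) (l, z).
  exact: smooth_diff (smooth_sfun_rmt f) lz.
have dt j : differentiable (tc j) (l, z).
  exact: smooth_diff (smooth_tc j rdom) lz.
have dm j : differentiable (fun x => tc j x * contr j Phi A (rmt x) : R^o) (l, z).
  by apply: differentiableM; [exact: dt|exact: df].
have [ds Ds] := derive_sumf (index_enum 'I_m) ((0 : R), Xf i z) (fun j (_ : true) => dm j).
have dl : differentiable (fun x : R * VV => x.1 ^+ s : R^o) (l, z).
  apply: smooth_diff lz; apply: smoothX; first exact: rdom_open.
  exact: (@smooth_fst R R^o VV rdom).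
have Dl : 'D_((0 : R), Xf i z) (fun x : R * VV => x.1 ^+ s : R^o) (l, z) = 0.
  rewrite derive_line.
  have -> : (fun h : R => (h *: ((0 : R), Xf i z) + (l, z)).1 ^+ s : R^o) = (fun=> l ^+ s).
    by apply/funext => h; rewrite /= -[h *: 0]/(h * 0) mulr0 add0r.
  exact: derive_cst.
rewrite (deriveMf _ dl ds) Dl mulr0 addr0 Ds /rItgD; congr (_ * _).
rewrite (eq_bigr (fun j => tc j (l, z) * (l * contr j (mapf (Dt i) Phi) A (rmt (l, z))) +
    contr j Phi A (rmt (l, z)) * (delta_mx 0 i : 'rV[R]_m) 0 j)); last first.
  move=> j _; rewrite (deriveMf _ (dt j) (df _)) derive_sfun_rmt// derive_tc.
  by rewrite -mapf_contr [in RHS]ffunE.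
rewrite big_split /= addrC; congr (_ + _).
  rewrite (bigD1 i)//= big1 ?addr0 => [|j ji]; rewrite !mxE.
    by rewrite !eqxx mulr1.
  by rewrite (negPf ji) andbF mulr0.
by rewrite mulr_sumr; apply: eq_bigr => j _; rewrite mulrCA.
Qed.

End RadialHomotopy.

Section RadialExactness.
Context {R : realType} {n m N : nat}.
Local Notation jets := 'M[R]_(n, #|bmindex m N|).
Local Notation VV := ('rV[R]_m * jets)%type.
Variables (w0 : jets) (d e : R).
Hypothesis small : forall t : 'rV[R]_m, `|t| < d -> `|jcurve w0 t - w0| < e.
Implicit Types (al : 'I_n) (I J : mindex m) (i j : 'I_m) (z : VV) (r : nat).
Local Notation box := (@box R n m N w0 d e).
Local Notation Dt := (@Dt R n m N w0 d e).
Local Notation ord := (@ord R n m N w0 d e).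
Local Notation bz := (@bz R n m N w0).
Local Notation sfun := (sfun box).
Local Notation rdom := (@rdom R n m N w0 d e).
Local Notation rmt := (@rmt R n m N w0).
Local Notation form := {ffun {set 'I_m} -> sfun}.
Implicit Types (Phi : form) (A : {set 'I_m}).
Let CM : coords jets := coordsM n #|bmindex m N|.
Let CT : coords 'rV[R]_m := coordsM 1 m.
Let CC : coords VV := coordsP CT CM.

Definition rpsi s (Phi : form) : form :=
  [ffun A => to_sfun box (fun z => int01 (fun l => rItg s Phi A (l, z)))].

Let rP := @rdomP R n m N w0 d e small.

Lemma smooth_int_rItg s Phi A :
  smooth (oset box) (fun z => int01 (fun l => rItg s Phi A (l, z)) : R^o).
Proof.
by have [] := smooth_int01 CC (oset_open box) rP (smooth_rItg s Phi A).
Qed.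

Lemma rpsiE s Phi A z : oset box z -> rpsi s Phi A z = int01 (fun l => rItg s Phi A (l, z)).
Proof. by move=> Oz; rewrite ffunE; exact: (to_sfunE (smooth_int_rItg s Phi A)). Qed.

Lemma Dt_rpsi s i Phi A z : oset box z ->
  Dt i (rpsi s Phi A) z = int01 (fun l => rItgD s Phi i A (l, z)).
Proof.
move=> Oz; rewrite (DtE _ _ Oz).
have -> : 'D_(Xf i z) (rpsi s Phi A) z = 'D_(Xf i z) (fun z => int01 (fun l => rItg s Phi A (l, z)) : R^o) z.
  apply: near_eq_derive; near=> y; apply: rpsiE.
  by near: y; exact: (smooth_open_near (oset_open box)).
have [_ ->] := smooth_int01 CC (oset_open box) rP (smooth_rItg s Phi A); last exact: Oz.
by apply: eq_int01 => l l01; apply: derive_rItg; exact: rP.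
Unshelve. all: by end_near. Qed.

Lemma rItgD_cts01 s Phi i A z : oset box z -> cts01 (fun l => rItgD s Phi i A (l, z)).
Proof.
move=> Oz.
have sD : smooth rdom (rItgD s Phi i A).
  apply: smoothM; first exact: rdom_open.
    by apply: smoothX; [exact: rdom_open|exact: (@smooth_fst R R^o VV rdom)].
  apply: smoothD; [exact: rdom_open|exact: smooth_sfun_rmt|].
  apply: smoothM; [exact: rdom_open|exact: (@smooth_fst R R^o VV rdom)|].
  apply: smooth_sum => [|j _]; first exact: rdom_open.
  by apply: smoothM; [exact: rdom_open|exact: smooth_tc|exact: smooth_sfun_rmt].
exact: (slice_cts01 (O := oset box) rP sD).
Qed.

(** The two terms of rItgD give, after exterior multiplication, s + 1 times Phi by the
    Euler identity and the radial derivative of Phi by closedness. *)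
Lemma dform_rpsi s (Phi : form) A z : oset box z -> hom s.+1 Phi -> dform Dt Phi = 0 ->
  dform Dt (rpsi s Phi) A z = int01 (fun l => l ^+ s *
    (s.+1%:R * Phi A (rmt (l, z)) + l * \sum_j z.1 0 j * Dt j (Phi A) (rmt (l, z)))).
Proof.
move=> Oz hPhi cl; rewrite /dform form_sum_val.
pose F i l := if i \in A then sgn i (A :\ i) * rItgD s Phi i (A :\ i) (l, z) else 0.
have cF i : cts01 (F i).
  rewrite /F; case: (i \in A); last exact: cts01_cst.
  by apply: cts01Z; exact: rItgD_cts01.
have [_] := int01_sum (index_enum 'I_m) (fun i (_ : true) => cF i).
have EF l : \sum_i F i l = l ^+ s *
    (s.+1%:R * Phi A (rmt (l, z)) + l * \sum_j z.1 0 j * Dt j (Phi A) (rmt (l, z))).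
  pose y := rmt (l, z).
  transitivity (l ^+ s * \sum_i (wedge i (contr i Phi) A y +
     l * \sum_j z.1 0 j * wedge i (contr j (mapf (Dt i) Phi)) A y)).
    rewrite mulr_sumr; apply: eq_bigr => i _; rewrite /F wedge_val.
    case: (boolP (i \in A)) => iA; last first.
      rewrite big1 ?mulr0 ?addr0 ?mulr0// => j _.
      by rewrite wedge_val (negPf iA) mulr0.
    rewrite /rItgD mulrCA mulrDr mulrCA; congr (_ * (_ + _ * _)).
    rewrite mulr_sumr; apply: eq_bigr => j _; rewrite wedge_val iA.
    by rewrite [LHS]mulrCA.
  congr (_ * _); rewrite big_split /=; congr (_ + _).
    by rewrite -form_sum_val (euler_contr hPhi) ffunE sfZ.
  rewrite -mulr_sumr exchange_big /=; congr (_ * _); apply: eq_bigr => j _.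
  by rewrite -mulr_sumr -form_sum_val (contr_closed j cl) ffunE.
have -> : int01 (fun l => \sum_i F i l) = int01 (fun l => l ^+ s *
    (s.+1%:R * Phi A (rmt (l, z)) + l * \sum_j z.1 0 j * Dt j (Phi A) (rmt (l, z)))).
  by apply: eq_int01 => l _; exact: EF.
move=> ->; apply: eq_bigr => i _; rewrite wedge_val /F.
case: (i \in A); last by rewrite int01_cst.
by rewrite ffunE Dt_rpsi// int01Z//; exact: rItgD_cts01.
Qed.

(** Integral of d/dl of l^s f(l t, b(l t)); the lower end contributes only when s = 0. *)
Lemma int_radial s (f : sfun) z : oset box z ->
  int01 (fun l => s%:R * l ^+ s.-1 * f (rmt (l, z)) +
     l ^+ s * \sum_j z.1 0 j * Dt j f (rmt (l, z))) =
  f (z.1, bz z) - (s == 0%N)%:R * f (0, w0).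
Proof.
move=> Oz.
pose g (x : R * VV) : R^o := x.1 ^+ s * f (rmt x).
have sg : smooth rdom g.
  apply: smoothM; [exact: rdom_open| |exact: smooth_sfun_rmt].
  by apply: smoothX; [exact: rdom_open|exact: (@smooth_fst R R^o VV rdom)].
have Dg (l : R) : 0 <= l <= 1 -> 'D_((1 : R), (0 : VV)) g (l, z) =
   s%:R * l ^+ s.-1 * f (rmt (l, z)) + l ^+ s * \sum_j z.1 0 j * Dt j f (rmt (l, z)).
  move=> l01; have lz := rP l01 Oz.
  have dl : differentiable (fun x : R * VV => x.1 ^+ s : R^o) (l, z).
    apply: smooth_diff lz; apply: smoothX; first exact: rdom_open.
    exact: (@smooth_fst R R^o VV rdom).
  have df := smooth_diff (smooth_sfun_rmt f) lz.
  rewrite (deriveMf _ dl df) (derive_sfun_rmt_l f lz) addrC; congr (_ + _).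
  rewrite mulrC; congr (_ * _).
  rewrite derive_line.
  have -> : (fun h : R => (h *: ((1 : R), (0 : VV)) + (l, z)).1 ^+ s : R^o) =
      (fun h : R => h + l) ^+ s.
    by apply/funext => h; rewrite exprfctE /= [h *: 1]mulr1.
  have h1 : is_derive (0 : R) (1 : R) (fun h : R => h + l) (1 + 0) by exact: is_deriveD.
  have [_ ->] := is_deriveX s h1.
  by rewrite addr0 add0r [_ *: 1]mulr1.
rewrite -(eq_int01 Dg).
have line (l : R) : 0 <= l <= 1 -> is_derive l 1 (fun l : R => g (l, z)) ('D_((1 : R), (0 : VV)) g (l, z)).
  move=> l01; have dg := smooth_diff sg (rP l01 Oz).
  have E (k : R) : ((0 : R), z) + k *: ((1 : R), (0 : VV)) = (k, z).
    by rewrite -[LHS]/(0 + k *: 1, z + k *: 0) add0r scaler0 addr0 [k *: 1]mulr1.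
  have := @is_derive_line R (R * VV)%type g (0, z) (1, 0) l.
  rewrite E => /(_ (diff_derivable dg)).
  by under eq_fun do rewrite E.
rewrite (int01_FTC (F := fun l => g (l, z)) _ line); last first.
  move=> l l01.
  exact: (slice_cts (G := fun x : R * VV => 'D_((1 : R), (0 : VV)) g x) (O := oset box)
    rP (smooth_derive ((1 : R), (0 : VV)) sg) l01 Oz).
by rewrite /g /= expr1n mul1r expr0n rmt1 rmt0.
Qed.

(** The Poincare lemma on a ball of R^m, for the restriction of Phi to the reference
    curve. In degree 0 the form is constant there. *)
Lemma radial_homotopy s (Phi : form) : hom s Phi -> dform Dt Phi = 0 ->
  exists (Psi : form) (c : {ffun {set 'I_m} -> R^o}), [/\ hom1 s Psi, ordf ord 0 Psi, hom s c &
    forall A z, oset box z -> Phi A (z.1, bz z) = dform Dt Psi A z + c A].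
Proof.
move=> hPhi cl; case: s hPhi => [|s] hPhi.
  exists 0, [ffun A => Phi A (0, w0)]; split.
  - exact: hom10.
  - by move=> A; rewrite ffunE; exact: ord0.
  - by move=> A A0; rewrite ffunE hPhi// sf0.
  - move=> A z Oz; rewrite linear0 ffunE sf0 add0r ffunE.
    have cj j : mapf (Dt j) Phi = 0.
      rewrite -(contr_closed j cl) big1// => i _.
      have -> : contr j (mapf (Dt i) Phi) = 0; last by rewrite linear0.
      apply/ffunP => B; rewrite [RHS]ffunE.
      by apply: (hom_contr (s := 0)) => //; exact: hom_mapf.
    have := int_radial 0 (Phi A) Oz; rewrite eqxx mul1r.
    have -> : int01 (fun l => 0%:R * l ^+ 0.-1 * Phi A (rmt (l, z)) +
       l ^+ 0 * \sum_j z.1 0 j * Dt j (Phi A) (rmt (l, z))) = 0.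
      rewrite -[RHS](int01_cst 0); apply: eq_int01 => l _.
      rewrite !mul0r add0r big1 ?mulr0// => j _.
      by have /ffunP/(_ A) := cj j; rewrite !ffunE => ->; rewrite sf0 mulr0.
    by move/esym/eqP; rewrite subr_eq0 => /eqP.
exists (rpsi s Phi), 0; split.
- move=> A sA; apply: sfun_ext => z Oz; rewrite rpsiE// sf0 -[RHS](int01_cst 0).
  apply: eq_int01 => l _; rewrite /rItg big1 ?mulr0// => j _.
  by rewrite (hom_contr j hPhi)// sf0 mulr0.
- move=> A z z' Oz Oz' [z1 _]; rewrite (rpsiE _ _ _ Oz) (rpsiE _ _ _ Oz').
  apply: eq_int01 => l _; rewrite /rItg /tc /= z1.
  by rewrite (_ : rmt (l, z) = rmt (l, z')); [|exact: (congr1 (fun t => (l *: t, jcurve w0 (l *: t))) z1)].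
- exact: hom0.
- move=> A z Oz; rewrite ffunE addr0 (dform_rpsi A Oz hPhi cl).
  have := int_radial s.+1 (Phi A) Oz; rewrite mul0r subr0 => <-.
  apply: eq_int01 => l _ /=; rewrite mulrDr; congr (_ + _); first by rewrite mulrA [s.+1%:R * _]mulrC.
  by rewrite mulrA -exprSr.
Qed.

End RadialExactness.

(** * Time-independent primitives *)

Section TimeVariables.
Context {R : realType} {n m N : nat}.
Local Notation jets := 'M[R]_(n, #|bmindex m N|).
Local Notation VV := ('rV[R]_m * jets)%type.
Variables (w0 : jets) (d e : R).
Hypotheses (d0 : 0 < d) (e0 : 0 < e).
Implicit Types (al : 'I_n) (I J : mindex m) (i j : 'I_m) (z : VV) (r : nat).
Local Notation box := (@box R n m N w0 d e).
Local Notation Dt := (@Dt R n m N w0 d e).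
Local Notation ord := (@ord R n m N w0 d e).
Local Notation bz := (@bz R n m N w0).
Local Notation sfun := (sfun box).
Local Notation form := {ffun {set 'I_m} -> sfun}.
Implicit Types (Phi : form) (A : {set 'I_m}).
Let CM : coords jets := coordsM n #|bmindex m N|.
Let CT : coords 'rV[R]_m := coordsM 1 m.
Let CC : coords VV := coordsP CT CM.

Lemma box_center : oset box (0, w0).
Proof. by apply/boxP; rewrite /= normr0 subrr normr0. Qed.

Definition cstf (c : R^o) : sfun := to_sfun box (fun=> c).

Lemma cstfE (c : R^o) z : oset box z -> cstf c z = c.
Proof. by move=> Oz; apply: to_sfunE => //; exact: smooth_cst. Qed.

Lemma cstf_linear : linear cstf.
Proof. by move=> k x y; apply: sfun_ext => z Oz; rewrite sfD sfZ !cstfE. Qed.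
HB.instance Definition _ := GRing.isLinear.Build R R^o sfun _ cstf cstf_linear.

Lemma cstf_inj (c : R^o) : cstf c = 0 -> c = 0.
Proof. by move=> E; rewrite -(cstfE c box_center) E sf0. Qed.

Local Notation cform := {ffun {set 'I_m} -> R^o}.
Implicit Types (c k : cform).

Definition kform c : form := [ffun A => cstf (c A)].

Lemma kform_linear : linear kform.
Proof. by move=> k x y; apply/ffunP => A; rewrite !ffunE linearP. Qed.
HB.instance Definition _ := GRing.isLinear.Build R cform form _ kform kform_linear.

Lemma kform0 : kform 0 = 0. Proof. exact: linear0. Qed.
Lemma kformN c : kform (- c) = - kform c. Proof. exact: linearN. Qed.
Lemma kformD c k : kform (c + k) = kform c + kform k. Proof. exact: linearD. Qed.
Lemma kformB c k : kform (c - k) = kform c - kform k. Proof. exact: linearB. Qed.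

Lemma kform_wedge i c : kform (wedge i c) = wedge i (kform c).
Proof. by apply/ffunP => A; rewrite !ffunE; case: ifP; rewrite ?linear0 ?linearZ. Qed.

Lemma kform_inj c : kform c = 0 -> c = 0.
Proof.
by move=> /ffunP E; apply/ffunP => A; have := E A; rewrite !ffunE => /cstf_inj.
Qed.

Lemma vder_eq0 (X : VV -> VV) (f : sfun) : smooth (oset box) X ->
  (forall z h, oset box z -> oset box (h *: X z + z) -> f (h *: X z + z) = f z) ->
  vder CC X f = 0.
Proof.
move=> sX H; apply: sfun_ext => z Oz; rewrite vderE// sf0.
rewrite (@derive_agree R n m N w0 d e f z z _ 0) ?derive0// => h Oh Oh'.
by rewrite scaler0 add0r; exact: H.
Qed.

Definition tsf (p : 'I_m) : sfun := to_sfun box (fun z => z.1 0 p : R^o).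

Lemma smooth_t p U : smooth U (fun z : VV => z.1 0 p : R^o).
Proof.
apply: (smooth_sub (U := setT)) => //.
exact: (smooth_comp CT openT (smooth_fst setT) (fun _ _ => Logic.I) (smooth_entry 0 p setT)).
Qed.

Lemma tsfE p z : oset box z -> tsf p z = z.1 0 p.
Proof. by move=> Oz; apply: to_sfunE => //; exact: smooth_t. Qed.

Lemma derive_t p z (v : VV) : 'D_v (fun z : VV => z.1 0 p : R^o) z = v.1 0 p.
Proof.
have lin : linear (fun z : VV => z.1 0 p : R^o) by move=> c x y; rewrite /= !mxE.
pose L : {linear VV -> R^o} := HB.pack (fun z : VV => z.1 0 p : R^o)
  (GRing.isLinear.Build _ _ _ _ (fun z : VV => z.1 0 p : R^o) lin).
apply: (@derive_linE R VV R^o L) => x.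
by apply: (smooth_cts (U := setT)) => //; exact: smooth_t.
Qed.

Lemma vder_tsf (X : VV -> VV) p b : smooth (oset box) X -> (forall z, (X z).1 0 p = b) ->
  vder CC X (tsf p) = cstf b.
Proof.
move=> sX Xb; apply: sfun_ext => z Oz; rewrite vderE// cstfE//.
rewrite (_ : 'D_(X z) (tsf p) z = 'D_(X z) (fun z : VV => z.1 0 p : R^o) z).
  by rewrite derive_t.
apply: near_eq_derive; near=> y; apply: tsfE.
by near: y; exact: (smooth_open_near (oset_open box)).
Unshelve. all: by end_near. Qed.

Lemma Dt_tsf i p : Dt i (tsf p) = cstf (i == p)%:R.
Proof.
by apply: vder_tsf => [|z]; [exact: smooth_Xf|rewrite mxE eqxx eq_sym].
Qed.

Definition tder p (f : sfun) : sfun := vder CC (fun=> (delta_mx 0 p, 0)) f.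

Lemma tder_linear p : linear (tder p).
Proof. by apply: vder_linear; exact: smooth_cst. Qed.
HB.instance Definition _ p := GRing.isLinear.Build R sfun sfun _ (tder p) (tder_linear p).

Lemma tderE p (f : sfun) z : oset box z -> tder p f z = 'D_(delta_mx 0 p, 0) f z.
Proof. by move=> Oz; apply: vderE => //; exact: smooth_cst. Qed.

Lemma tder_Dt p i (f : sfun) : tder p (Dt i f) = Dt i (tder p f).
Proof.
apply: vder_comm; [exact: smooth_cst|exact: smooth_Xf|] => z _.
by rewrite derive_Xf derive_cst /= linear0.
Qed.

Lemma tder_dform p Phi : mapf (tder p) (dform Dt Phi) = dform Dt (mapf (tder p) Phi).
Proof.
rewrite /dform linear_sum; apply: eq_bigr => i _.
rewrite [LHS](mapf_wedge (tder p)); congr (wedge i _).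
by apply/ffunP => A; rewrite !ffunE; exact: tder_Dt.
Qed.

Lemma tder_kform p c : mapf (tder p) (kform c) = 0.
Proof.
apply/ffunP => A; rewrite !ffunE; apply: vder_eq0 => [|z h Oz Oh]; first exact: smooth_cst.
by rewrite !cstfE.
Qed.

Lemma ord_tder r p (f : sfun) : ord r f -> ord r (tder p f).
Proof.
move=> rf z z' Oz Oz' [z1 z2]; rewrite !tderE//; apply: derive_agree => // h Oh Oh'.
apply: rf => //; split; first by rewrite /= z1.
by move=> be I Ir; rewrite /= !linearP /= z2.
Qed.

(** Independence of the first q time variables. *)
Definition ind (q : nat) (f : sfun) := forall z z', oset box z -> oset box z' ->
  z.2 = z'.2 -> (forall j, (q <= j)%N -> z.1 0 j = z'.1 0 j) -> f z = f z'.
Definition indf q Phi := forall A, ind q (Phi A).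

Lemma indD q (f g : sfun) : ind q f -> ind q g -> ind q (f + g).
Proof. by move=> hf hg z z' Oz Oz' z2 z1; rewrite !sfD (hf z z')// (hg z z'). Qed.
Lemma indZ q a (f : sfun) : ind q f -> ind q (a *: f).
Proof. by move=> hf z z' Oz Oz' z2 z1; rewrite !sfZ (hf z z'). Qed.

Lemma ind_tder q p (f : sfun) : ind q f -> ind q (tder p f).
Proof.
move=> rf z z' Oz Oz' z2 z1; rewrite !tderE//; apply: derive_agree => // h Oh Oh'.
apply: rf => //=; first by rewrite z2.
by move=> j qj; rewrite !mxE z1.
Qed.

Lemma tder_ind q (p : 'I_m) (f : sfun) : (p < q)%N -> ind q f -> tder p f = 0.
Proof.
move=> pq rf; apply: vder_eq0 => [|z h Oz Oh]; first exact: smooth_cst.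
apply: rf => //=; first by rewrite scaler0 add0r.
move=> j qj; rewrite !mxE eqxx /=.
by rewrite (_ : (j == p) = false) ?mulr0 ?add0r//; apply/eqP => jp; move: qj; rewrite jp leqNgt pq.
Qed.

Definition tform p c : form := [ffun A => c A *: tsf p].

Lemma dform_tform p c : dform Dt (tform p c) = kform (wedge p c).
Proof.
rewrite kform_wedge /dform (bigD1 p)//= big1 ?addr0 => [|i ip].
  congr (wedge p _); apply/ffunP => A; rewrite !ffunE linearZ /= Dt_tsf eqxx.
  by rewrite -linearZ; congr cstf; rewrite [LHS]mulr1.
have -> : mapf (Dt i) (tform p c) = 0; last by rewrite linear0.
by apply/ffunP => A; rewrite !ffunE linearZ /= Dt_tsf (negPf ip) linear0 scaler0.
Qed.

Lemma tder_tform p c : mapf (tder p) (tform p c) = kform c.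
Proof.
apply/ffunP => A; rewrite !ffunE linearZ /=.
have -> : tder p (tsf p) = cstf 1.
  by apply: vder_tsf => [|z]; [exact: smooth_cst|rewrite mxE !eqxx].
by rewrite -linearZ; congr cstf; rewrite [LHS]mulr1.
Qed.

(** Setting t^p = 0 makes a function independent of t^p. *)
Definition tzero (p : 'I_m) (z : VV) : VV := (z.1 - z.1 0 p *: delta_mx 0 p, z.2).

Lemma tzeroE p z j : (tzero p z).1 0 j = if j == p then 0 else z.1 0 j.
Proof.
rewrite /= !mxE eqxx /=; case: eqP => [->|_]; first by rewrite mulr1 subrr.
by rewrite mulr0 subr0.
Qed.

Lemma box_tzero p z : oset box z -> oset box (tzero p z).
Proof.
move=> /boxP[z1 z2]; apply/boxP; split => //; apply: le_lt_trans z1.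
rewrite [leLHS]/Num.Def.normr/= mx_normrE (bigmax_le _ (normr_ge0 _))//= => -[i j] _.
rewrite ord1 tzeroE; case: eqP => _; first by rewrite normr0.
by rewrite [leRHS]/Num.Def.normr/= mx_normrE; exact: (le_bigmax _ _ (0, j)).
Qed.

Lemma tzero_linear p : linear (tzero p).
Proof.
move=> k x y; rewrite /tzero; congr (_, _); apply/matrixP => i j; rewrite !mxE /=.
by ring.
Qed.
HB.instance Definition _ p := GRing.isLinear.Build R VV VV _ (tzero p) (tzero_linear p).

Lemma smooth_tzero p U : smooth U (tzero p).
Proof.
apply: (smooth_sub (U := setT)) => //.
apply: (smooth_pair CT CM openT); last exact: smooth_snd.
apply: smoothB; [exact: openT|exact: smooth_fst|].
apply: (smooth_coords (C := CT)) => [|c]; first exact: openT.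
have -> : cfun c \o (fun z : VV => z.1 0 p *: (delta_mx 0 p : 'rV[R]_m)) =
   (fun z : VV => z.1 0 p * cfun c (delta_mx 0 p) : R^o).
  by apply/funext => x; rewrite /= linearZ.
by apply: smoothM; [exact: openT|exact: smooth_t|exact: smooth_cst].
Qed.

Definition pull p (f : sfun) : sfun := to_sfun box (fun z => f (tzero p z)).

Lemma smooth_pull p (f : sfun) : smooth (oset box) (fun z => f (tzero p z) : R^o).
Proof.
apply: (smooth_comp CC (oset_open box) (smooth_tzero p _) _ (sfun_smooth f)).
by move=> z; exact: box_tzero.
Qed.

Lemma pullE p (f : sfun) z : oset box z -> pull p f z = f (tzero p z).
Proof. by move=> Oz; apply: to_sfunE => //; exact: smooth_pull. Qed.

Lemma pull_linear p : linear (pull p).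
Proof. by move=> k x y; apply: sfun_ext => z Oz; rewrite sfD sfZ !pullE. Qed.
HB.instance Definition _ p := GRing.isLinear.Build R sfun sfun _ (pull p) (pull_linear p).

(** The chain rule: D_i and the restriction to t^p = 0 commute except for i = p, where
    the restriction kills d/dt^p. *)
Lemma Dt_pull i p (f : sfun) : Dt i (pull p f) = pull p (Dt i f) - (i == p)%:R *: pull p (tder p f).
Proof.
apply: sfun_ext => z Oz; have Oz' := box_tzero p Oz.
rewrite sfD sfN sfZ (DtE _ _ Oz) (pullE _ _ Oz) (pullE _ _ Oz) (DtE _ _ Oz') (tderE _ _ Oz').
have -> : 'D_(Xf i z) (pull p f) z = 'D_(Xf i z) (fun z => f (tzero p z) : R^o) z.
  apply: near_eq_derive; near=> y; apply: pullE.
  by near: y; exact: (smooth_open_near (oset_open box)).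
have dt : differentiable (tzero p) z.
  by apply: (smooth_diff (U := setT)) => //; exact: smooth_tzero.
have df := sfun_diff f Oz'.
have tc : continuous (tzero p).
  by move=> x; apply: (smooth_cts (U := setT)) => //; exact: smooth_tzero.
rewrite (@derive_comp R VV VV R^o f (tzero p) z (Xf i z) dt df).
have -> : 'D_(Xf i z) (tzero p) z = Xf i (tzero p z) - (i == p)%:R *: (delta_mx 0 p, 0).
  apply: (etrans (@derive_linE R VV VV (tzero p) z (Xf i z) tc)).
  apply/pair_equal_spec; split => /=; last by rewrite scaler0 subr0.
  apply/matrixP => a b; rewrite ord1 !mxE eqxx /= (eq_sym p).
  by case: (eqVneq i p) => [->|_].
by rewrite !(deriveE _ df) linearB linearZ.
Unshelve. all: by end_near. Qed.

Lemma dform_pull p Phi : dform Dt (mapf (pull p) Phi) =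
  mapf (pull p) (dform Dt Phi) - wedge p (mapf (pull p) (mapf (tder p) Phi)).
Proof.
have -> : wedge p (mapf (pull p) (mapf (tder p) Phi)) =
   \sum_i wedge i ((i == p)%:R *: mapf (pull p) (mapf (tder p) Phi)).
  rewrite (bigD1 p)//= eqxx scale1r big1 ?addr0// => i ip.
  by rewrite (negPf ip) scale0r linear0.
rewrite /dform linear_sum -sumrB; apply: eq_bigr => i _.
rewrite [X in _ = X - _](mapf_wedge (pull p)) -linearB; congr (wedge i _).
by apply/ffunP => A; rewrite !ffunE; exact: Dt_pull.
Qed.

Lemma pull_kform p c : mapf (pull p) (kform c) = kform c.
Proof.
apply/ffunP => A; rewrite !ffunE; apply: sfun_ext => z Oz.
by rewrite (pullE _ _ Oz) !cstfE//; exact: box_tzero.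
Qed.

Lemma pull_ind q (p : 'I_m) (f : sfun) : (p < q)%N -> ind q f -> pull p f = f.
Proof.
move=> pq hf; apply: sfun_ext => z Oz; rewrite (pullE _ _ Oz); apply: hf => //.
  exact: box_tzero.
move=> j qj; rewrite tzeroE.
by case: eqP => // jp; move: qj; rewrite jp leqNgt pq.
Qed.

Lemma ind_pull (p : 'I_m) (f : sfun) : ind p f -> ind p.+1 (pull p f).
Proof.
move=> hf z z' Oz Oz' z2 z1; rewrite (pullE _ _ Oz) (pullE _ _ Oz').
apply: hf; [exact: box_tzero|exact: box_tzero|exact: z2|] => j pj.
rewrite !tzeroE; case: eqP => // /eqP jp; apply: z1.
by rewrite ltn_neqAle pj andbT eq_sym; exact: jp.
Qed.

Lemma ord_pull r p (f : sfun) : ord r f -> ord r (pull p f).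
Proof.
move=> hf z z' Oz Oz' [z1 z2]; rewrite (pullE _ _ Oz) (pullE _ _ Oz').
apply: hf; [exact: box_tzero|exact: box_tzero|].
by split => //; rewrite /tzero /= z1.
Qed.

End TimeVariables.

Section LocalExactness.
Context {R : realType} {n m N : nat}.
Local Notation jets := 'M[R]_(n, #|bmindex m N|).
Local Notation VV := ('rV[R]_m * jets)%type.
Variables (w0 : jets) (d e : R).
Hypotheses (d0 : 0 < d) (e0 : 0 < e).
Hypothesis small : forall t : 'rV[R]_m, `|t| < d -> `|jcurve w0 t - w0| < e.
Implicit Types (al : 'I_n) (I J : mindex m) (i j : 'I_m) (z : VV) (r : nat).
Local Notation box := (@box R n m N w0 d e).
Local Notation Dt := (@Dt R n m N w0 d e).
Local Notation ord := (@ord R n m N w0 d e).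
Local Notation bz := (@bz R n m N w0).
Local Notation sfun := (sfun box).
Local Notation form := {ffun {set 'I_m} -> sfun}.
Local Notation cform := {ffun {set 'I_m} -> R^o}.
Local Notation kform := (@kform R n m N w0 d e).
Local Notation ind := (@ind R n m N w0 d e).
Local Notation indf := (@indf R n m N w0 d e).
Local Notation tform := (@tform R n m N w0 d e).
Implicit Types (c k : cform).
Implicit Types (Phi : form) (A : {set 'I_m}).

(** The two homotopies, one after the other. *)
Lemma closed_exact0 s r Phi : (s < m)%N -> (r < N)%N ->
  ordf ord r Phi -> hom s Phi -> dform Dt Phi = 0 ->
  exists (Psi : form) c, [/\ hom1 s Psi, ordf ord (r + r.+1) Psi &
    hom s c /\ Phi = dform Dt Psi + kform c].
Proof.
move=> sm rN oPhi hPhi cl.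
have cl' al J : vert al J (dform Dt Phi) = 0 by rewrite cl /vert mapf0.
have [Psi1 [h1 o1 _ E1]] := vertical_homotopy small sm rN oPhi hPhi cl'.
have [Psi2 [c [h2 o2 hc E2]]] := radial_homotopy small hPhi cl.
exists (Psi1 + Psi2), c; split; first exact: hom1D.
  move=> A; rewrite ffunE; apply: ordD; first exact: o1.
  exact: ord_le (o2 A).
split=> //; apply/ffunP => A; apply: sfun_ext => z Oz.
rewrite dformD !ffunE !sfD (cstfE _ Oz) -addrA -(E2 _ _ Oz) -(E1 _ _ Oz).
by rewrite subrK.
Qed.

(** The order of the primitive obtained by removing q time variables, each at the price
    of two primitives. *)
Fixpoint exact_order (q r : nat) : nat :=
  if q is q'.+1 then exact_order q' (exact_order q' r) else (r + r.+1)%N.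

Lemma exact_order_ge q r : (r <= exact_order q r)%N.
Proof.
elim: q r => [|q IH] r /=; first exact: leq_addr.
exact: leq_trans (IH r) (IH _).
Qed.

(** Constant forms in dt^0, ..., dt^(q-1) only. *)
Definition kin (q : nat) c := forall A j, j \in A -> (q <= j)%N -> c A = 0.

(** Induction on the number q of time variables which do not occur. Suppose that Phi does
    not depend on t^0, ..., t^p, and that d Phi = k1 + dt^p /\ k2, where k1 and k2
    involve dt^0, ..., dt^(p-1) only. Then Phi - t^p k2 has total derivative k1, so by
    induction k1 = 0 and Phi = d Psi + c + t^p k2 with Psi independent of t^0, ...,
    t^(p-1). Differentiating by t^p gives d chi = - k2 for chi = d Psi / dt^p, so by
    induction again k2 = 0 and chi = d Eta + c'. Restricting the formula for Phi to
    t^p = 0 trades d/dt^p against chi: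
    Phi = d (Psi_0 - dt^p /\ Eta_0) + c + dt^p /\ c', where the index 0 stands for the
    restriction. For q = m there is no time left, and every k satisfies kin. *)
Lemma closed_exact q s r Phi k : (q <= m)%N -> (s < m)%N -> (exact_order q r < N)%N ->
  ordf ord r Phi -> hom s Phi -> indf q Phi ->
  hom s.+1 k -> kin q k -> dform Dt Phi = kform k ->
  k = 0 /\ exists (Psi : form) c, [/\ hom1 s Psi, ordf ord (exact_order q r) Psi,
    indf q Psi & hom s c /\ Phi = dform Dt Psi + kform c].
Proof.
elim: q s r Phi k => [|q IH] s r Phi k qm sm rN oPhi hPhi iPhi hk kq E.
  have k0 : k = 0.
    apply/ffunP => A; rewrite ffunE.
    have [->|/set0Pn[j jA]] := eqVneq A finset.set0; first by rewrite hk// cards0.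
    exact: kq jA _.
  split; first exact: k0.
  rewrite k0 kform0 in E.
  have rN' : (r < N)%N by rewrite (leq_ltn_trans (exact_order_ge 0 r)).
  have [Psi [c [h1 o1 [hc Ec]]]] := closed_exact0 sm rN' oPhi hPhi E.
  exists Psi, c; split => //.
  move=> A z z' Oz Oz' z2 z1; congr (Psi A _).
  rewrite [z]surjective_pairing [z' in RHS]surjective_pairing z2; congr (_, _).
  by apply/matrixP => i j; rewrite ord1; exact: z1.
pose p := Ordinal qm.
pose k2 := contr p k; pose k1 := k - wedge p k2.
have k1E : k1 = contr p (wedge p k).
  by rewrite /k1 -{1}(wedge_contr_eq p k) addrC addrA addNr add0r.
have kin2 : kin q k2.
  move=> A j jA qj; rewrite ffunE; case: (boolP (p \in A)) => // pA.
  rewrite (kq _ j) ?scaler0//; first by rewrite !inE jA orbT.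
  rewrite ltn_neqAle qj andbT; apply: contraNneq pA => qj'.
  by rewrite (_ : p = j)//; exact: val_inj.
have kin1 : kin q k1.
  move=> A j jA qj; rewrite k1E ffunE; case: (boolP (p \in A)) => // pA.
  rewrite ffunE !inE eqxx /= finset.setU1K// (kq A j jA) ?scaler0//.
  rewrite ltn_neqAle qj andbT; apply: contraNneq pA => qj'.
  by rewrite (_ : p = j)//; exact: val_inj.
have hk2 : hom s k2 by move=> A sA; apply: (hom_contr p hk); rewrite eqSS.
have hk1 : hom s.+1 k1.
  rewrite /k1 -scaleN1r; apply: homD => //; apply: homZ; exact: hom_wedge.
have k1D : k1 = k - wedge p k2 by [].
clearbody k1 k2; clear k1E.
(* tform p k2 is t^p k2, of total derivative dt^p /\ k2 *)
pose Phi' := Phi - tform p k2.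
have Phi'E : Phi' = Phi - tform p k2 by [].
have EPhi' A : Phi' A = Phi A - k2 A *: tsf w0 d e p by rewrite !ffunE.
have E' : dform Dt Phi' = kform k1.
  by rewrite Phi'E dformB dform_tform E k1D kformB.
have hPhi' : hom s Phi' by move=> A sA; rewrite EPhi' hPhi// hk2// scale0r subr0.
have ot : ord r (tsf w0 d e p).
  by move=> z z' Oz Oz' [z1 _]; rewrite !tsfE// z1.
have oPhi' : ordf ord r Phi'.
  move=> A; rewrite EPhi'; apply: ordD; first exact: oPhi.
  by rewrite -scaleNr; exact: ordZ.
have it : ind q (tsf w0 d e p).
  by move=> z z' Oz Oz' z2 z1; rewrite !tsfE// z1.
have iPhi' : indf q Phi'.
  move=> A; rewrite EPhi'; apply: indD; last by rewrite -scaleNr; exact: indZ.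
  by move=> z z' Oz Oz' z2 z1; apply: iPhi => // j qj; apply: z1; exact: ltnW.
clearbody Phi'.
have rN1 : (exact_order q r < N)%N.
  exact: leq_ltn_trans (exact_order_ge q (exact_order q r)) rN.
have [k10 [Psi [c [h1 o1 i1 [hc Ec]]]]] := IH s r Phi' k1 (ltnW qm) sm rN1 oPhi' hPhi' iPhi' hk1 kin1 E'.
have kE : k = wedge p k2 by apply/eqP; rewrite -subr_eq0 -k1D k10.
pose chi := mapf (tder p) Psi.
have Echi : dform Dt chi = kform (- k2).
  have := congr1 (mapf (tder p)) Ec.
  rewrite [RHS]mapfD tder_kform addr0 tder_dform -/chi => <-.
  rewrite Phi'E mapfB tder_tform kformN.
  have -> : mapf (tder p) Phi = 0; last by rewrite sub0r.
  by apply/ffunP => A; rewrite !ffunE; apply: (tder_ind (q := q.+1)) (iPhi A).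
have hchi : hom1 s chi by exact: hom1_mapf.
have PhiE : k2 = 0 -> Phi = dform Dt Psi + kform c.
  move=> k20; rewrite -Ec Phi'E k20.
  have -> : tform p 0 = 0 by apply/ffunP => A; rewrite !ffunE scale0r.
  by rewrite subr0.
have pPhi : mapf (pull p) Phi = Phi.
  by apply/ffunP => A; rewrite ffunE; apply: (pull_ind (q := q.+1)) (iPhi A).
case: s sm hPhi hk h1 hc hchi hk2 hk1 hPhi' => [|s] sm hPhi hk h1 hc hchi hk2 hk1 hPhi'.
  have Psi0 : Psi = 0 by apply/ffunP => A; rewrite h1// ffunE.
  have k20 : k2 = 0.
    have : kform (- k2) = 0.
      by rewrite -Echi /chi Psi0 mapf0 dform0.
    by move/(kform_inj d0 e0)/eqP; rewrite oppr_eq0 => /eqP.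
  split; first by rewrite kE k20 wedge0.
  exists 0, c; split; first exact: hom10.
  - by move=> A; rewrite ffunE; exact: ord0.
  - by move=> A; rewrite ffunE => z z' _ _ _ _; rewrite !sf0.
  - by split; [exact: hc|rewrite (PhiE k20) Psi0].
have hchi' : hom s chi by move=> A sA; apply: hchi; rewrite eqSS.
have ochi : ordf ord (exact_order q r) chi by move=> A; rewrite ffunE; exact: ord_tder.
have ichi : indf q chi by move=> A; rewrite ffunE; exact: ind_tder.
have hNk2 : hom s.+1 (- k2) by rewrite -scaleN1r; exact: homZ.
have kinN : kin q (- k2) by move=> A j jA qj; rewrite ffunE (kin2 A j)// oppr0.
have [Nk20 [Eta [c' [h2 o2 i2 [hc' Ec']]]]] := IH s (exact_order q r) chi (- k2)
  (ltnW qm) (ltnW sm) rN ochi hchi' ichi hNk2 kinN Echi.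
have k20 : k2 = 0 by apply/eqP; rewrite -oppr_eq0 Nk20.
split; first by rewrite kE k20 wedge0.
exists (mapf (pull p) Psi - wedge p (mapf (pull p) Eta)), (c + wedge p c'); split.
- rewrite -scaleN1r; apply: hom1D; first exact: hom1_mapf.
  apply: hom1Z => A sA; apply: (hom1_wedge (s := s)) => //; exact: hom1_mapf.
- move=> A; rewrite ffunE; apply: ordD.
    rewrite ffunE; apply: ord_pull; apply: ord_le (o1 A); exact: exact_order_ge.
  rewrite ffunE -scaleN1r; apply: ordZ; rewrite ffunE; case: ifP => _; last exact: ord0.
  by apply: ordZ; rewrite ffunE; apply: ord_pull; exact: o2.
- move=> A; rewrite ffunE; apply: indD.
    by rewrite ffunE; apply: (ind_pull (p := p)); exact: i1.
  rewrite ffunE -scaleN1r; apply: indZ; rewrite ffunE; case: ifP => _.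
    by apply: indZ; rewrite ffunE; apply: (ind_pull (p := p)); exact: i2.
  by move=> z z' _ _ _ _; rewrite !sf0.
- split.
    by apply: homD => // ; exact: hom_wedge.
  rewrite dformB dform_wedge opprK !dform_pull kformD kform_wedge wedgeB wedgeii subr0.
  have -> : mapf (pull p) (dform Dt Psi) = Phi - kform c.
    by rewrite -{1}pPhi {1}(PhiE k20) mapfD pull_kform addrK.
  have -> : mapf (pull p) (dform Dt Eta) = mapf (pull p) chi - kform c'.
    by rewrite {1}Ec' mapfD pull_kform addrK.
  rewrite wedgeB -/chi.
  move: (wedge p (mapf (pull p) chi)) (wedge p (kform c')) (kform c) => a b x.
  by rewrite !addrA subrK addrAC !subrK.
Qed.

End LocalExactness.

(** * Iterated partial derivatives *)

Section IteratedPartials.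
Context {R : realType} {m : nat} {V : normedModType R}.
Variable dir : 'I_m -> V.
Implicit Types (f g : V -> R^o) (U : set V) (I J : mindex m) (i j : 'I_m).

(** The iterated derivatives along arbitrary directions, in order to differentiate with
    respect to some of the variables, in presence of parameters. *)
Definition mpart I f : V -> R^o :=
  foldr (fun i g => iter (I i) (fun h => 'D_(dir i) h) g) f (enum 'I_m).

Lemma eq_derive U f g v : open U -> (forall a, U a -> f a = g a) ->
  forall a, U a -> 'D_v f a = 'D_v g a.
Proof.
move=> oU fg a Ua; apply: near_eq_derive; near=> b; apply: fg.
by near: b; exact: smooth_open_near.
Unshelve. all: by end_near. Qed.

Lemma eq_iter_derive U f g v p : open U -> (forall a, U a -> f a = g a) ->
  forall a, U a -> iter p (fun h => 'D_v h) f a = iter p (fun h => 'D_v h) g a.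
Proof. by move=> oU fg; elim: p => //= p IH; apply: eq_derive. Qed.

Lemma smooth_iter_derive U f v p : smooth U f ->
  smooth U (iter p (fun h : V -> R^o => ('D_v h : V -> R^o)) f).
Proof. by move=> sf; elim: p => //= p IH; exact: smooth_derive. Qed.

Lemma iter_derive_swap U f v w p : open U -> smooth U f ->
  forall a, U a -> iter p (fun h : V -> R^o => ('D_v h : V -> R^o)) ('D_w f) a =
   'D_w (iter p (fun h : V -> R^o => ('D_v h : V -> R^o)) f) a.
Proof.
move=> oU sf; elim: p => //= p IH a Ua.
rewrite (eq_derive v oU IH Ua).
exact: (derive_swap v w oU Ua (smooth_iter_derive v p sf)).
Qed.

Lemma mpart0 f : mpart [ffun=> 0%N] f = f.
Proof. by rewrite /mpart; elim: (enum 'I_m) => //= i s ->; rewrite ffunE. Qed.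

Let mp (s : seq 'I_m) I f : V -> R^o :=
  foldr (fun i g => iter (I i) (fun h : V -> R^o => ('D_(dir i) h : V -> R^o)) g) f s.

Let smooth_mp U s I f : smooth U f -> smooth U (mp s I f).
Proof. by move=> sf; elim: s => //= i s IH; exact: smooth_iter_derive. Qed.

Let mp_notin s I i f : i \notin s -> mp s (mincr I i) f = mp s I f.
Proof.
elim: s => //= j s IH; rewrite inE negb_or => /andP[ij /IH ->].
by rewrite ffunE eq_sym (negPf ij) addn0.
Qed.

Let mp_incr U s I i f : open U -> smooth U f -> uniq s -> i \in s ->
  forall a, U a -> mp s (mincr I i) f a = 'D_(dir i) (mp s I f) a.
Proof.
move=> oU sf; elim: s => //= j s IH /andP[js us].
have [ij _ a Ua|ij] := eqVneq i j.
  rewrite -ij in js *.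
  have -> : mincr I i i = (I i).+1 by rewrite ffunE eqxx addn1.
  by rewrite mp_notin.
rewrite inE (negPf ij) /= => si a Ua.
have -> : mincr I i j = I j by rewrite ffunE eq_sym (negPf ij) addn0.
rewrite (eq_iter_derive (dir j) (I j) oU (IH us si) Ua).
exact: (iter_derive_swap (dir j) (dir i) (I j) oU (smooth_mp s I sf)).
Qed.

Lemma smooth_mpart U I f : smooth U f -> smooth U (mpart I f).
Proof. exact: (smooth_mp (enum 'I_m)). Qed.

Lemma mpart_incr U I i f : open U -> smooth U f ->
  forall a, U a -> mpart (mincr I i) f a = 'D_(dir i) (mpart I f) a.
Proof.
by move=> oU sf; apply: (mp_incr (s := enum 'I_m)) => //; [exact: enum_uniq|rewrite mem_enum].
Qed.

(** Induction on |I|. This evaluates the iterated derivatives of a function given with a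
    guess F for all of them, whatever the order of the variables. *)
Lemma mpart_unique U (F : mindex m -> V -> R^o) f k : open U -> smooth U f ->
  (forall a, U a -> F [ffun=> 0%N] a = f a) ->
  (forall I i a, (mlen I < k)%N -> U a -> 'D_(dir i) (F I) a = F (mincr I i) a) ->
  forall I a, (mlen I <= k)%N -> U a -> mpart I f a = F I a.
Proof.
move=> oU sf F0 FS I a Ik; move: a; move En : (mlen I) => p.
elim: p I En Ik => [|p IH] I Ip Ik a Ua.
  by rewrite (mlen0 Ip) mpart0 F0.
have [i Ii] : exists i, (0 < I i)%N.
  apply: contrapT => H; have : mlen I = 0%N; last by rewrite Ip.
  rewrite /mlen big1// => i _; apply/eqP; rewrite -leqn0 leqNgt; apply/negP => Ii.
  by apply: H; exists i.
have E := mlen_decr Ii; rewrite Ip in E; case: E => E.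
have pk : (mlen (mdecr I i) <= k)%N by rewrite E; apply: leq_trans Ik; rewrite Ip.
rewrite -(mdecrK Ii) (mpart_incr _ i oU sf Ua) -FS//; last first.
  by rewrite E -Ip.
by apply: (eq_derive _ oU _ Ua) => b Ub; apply: IH.
Qed.

Lemma eq_mpart U I f g : open U -> (forall a, U a -> f a = g a) ->
  forall a, U a -> mpart I f a = mpart I g a.
Proof.
move=> oU fg; rewrite /mpart; elim: (enum 'I_m) => //= i s IH.
exact: eq_iter_derive.
Qed.

Lemma mpart_derive U I i f : open U -> smooth U f ->
  forall a, U a -> mpart I ('D_(dir i) f) a = mpart (mincr I i) f a.
Proof.
move=> oU sf a Ua.
apply: (mpart_unique (k := mlen I) (F := fun I => mpart (mincr I i) f) oU (smooth_derive _ sf)) => //.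
  move=> b Ub; rewrite (mpart_incr _ i oU sf Ub); apply: (eq_derive _ oU) Ub => c Uc.
  by rewrite mpart0.
move=> J j b _ Ub; rewrite mincrC.
by rewrite (mpart_incr _ j oU sf Ub).
Qed.

Definition same_partials k a f g :=
  forall I, (mlen I <= k)%N -> mpart I f a = mpart I g a.

Lemma same_partials_le k k' a f g : (k' <= k)%N ->
  same_partials k a f g -> same_partials k' a f g.
Proof. by move=> kk H I Ik; apply: H; exact: leq_trans kk. Qed.

(** Contact of order k + 1 is equality of the values and contact of order k of the first
    derivatives: so the Leibniz and chain rules for contact follow by induction from
    those of first order. *)
Lemma same_partialsS U k a f g : open U -> U a -> smooth U f -> smooth U g ->
  same_partials k.+1 a f g <->
  f a = g a /\ forall i, same_partials k a ('D_(dir i) f) ('D_(dir i) g).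
Proof.
move=> oU Ua sf sg; split=> [H|[e0 H] I Ik].
  split; first by have := H [ffun=> 0%N]; rewrite !mpart0 mlen_eq0; exact.
  move=> i I Ik; rewrite (mpart_derive _ _ oU sf Ua) (mpart_derive _ _ oU sg Ua).
  by apply: H; rewrite mlen_incr.
have [I0|] := posnP (mlen I); first by rewrite (mlen0 I0) !mpart0.
move=> I0; have [i Ii] : exists i, (0 < I i)%N.
  apply: contrapT => H'; move: I0; rewrite /mlen big1// => i _.
  apply/eqP; rewrite -leqn0 leqNgt; apply/negP => Ii; by apply: H'; exists i.
rewrite -(mdecrK Ii) -(mpart_derive _ _ oU sf Ua) -(mpart_derive _ _ oU sg Ua).
by apply: H; rewrite -ltnS (mlen_decr Ii).
Qed.

Lemma eq_same_partials U k a f g f' g' : open U -> U a ->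
  (forall b, U b -> f b = f' b) -> (forall b, U b -> g b = g' b) ->
  same_partials k a f g -> same_partials k a f' g'.
Proof.
move=> oU Ua ff' gg' H I Ik.
by rewrite -(eq_mpart I oU ff' Ua) -(eq_mpart I oU gg' Ua) H.
Qed.

Lemma same_partialsD U k a f g f' g' : open U -> U a ->
  smooth U f -> smooth U g -> smooth U f' -> smooth U g' ->
  same_partials k a f f' -> same_partials k a g g' ->
  same_partials k a (fun b => f b + g b) (fun b => f' b + g' b).
Proof.
move=> oU Ua; elim: k f g f' g' => [|k IH] f g f' g' sf sg sf' sg' H1 H2.
  move=> I; rewrite leqn0 => /eqP /mlen0 ->; rewrite !mpart0.
  have := H1 [ffun=> 0%N]; have := H2 [ffun=> 0%N].
  by rewrite !mpart0 mlen_eq0 => -> // ->.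
apply/(same_partialsS k oU Ua (smoothD oU sf sg) (smoothD oU sf' sg')).
have [e1 d1] := (same_partialsS k oU Ua sf sf').1 H1.
have [e2 d2] := (same_partialsS k oU Ua sg sg').1 H2.
split; first by rewrite e1 e2.
move=> i; apply: (eq_same_partials oU Ua _ _ (IH _ _ _ _ (smooth_derive (dir i) sf)
  (smooth_derive (dir i) sg) (smooth_derive (dir i) sf') (smooth_derive (dir i) sg') (d1 i) (d2 i))).
  by move=> b Ub; rewrite [RHS]deriveD//; apply: diff_derivable; exact: smooth_diff Ub.
by move=> b Ub; rewrite [RHS]deriveD//; apply: diff_derivable; exact: smooth_diff Ub.
Qed.

Lemma same_partialsM U k a f g f' g' : open U -> U a ->
  smooth U f -> smooth U g -> smooth U f' -> smooth U g' ->
  same_partials k a f f' -> same_partials k a g g' ->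
  same_partials k a (fun b => f b * g b) (fun b => f' b * g' b).
Proof.
move=> oU Ua; elim: k f g f' g' => [|k IH] f g f' g' sf sg sf' sg' H1 H2.
  move=> I; rewrite leqn0 => /eqP /mlen0 ->; rewrite !mpart0.
  have := H1 [ffun=> 0%N]; have := H2 [ffun=> 0%N].
  by rewrite !mpart0 mlen_eq0 => -> // ->.
apply/(same_partialsS k oU Ua (smoothM oU sf sg) (smoothM oU sf' sg')).
have [e1 d1] := (same_partialsS k oU Ua sf sf').1 H1.
have [e2 d2] := (same_partialsS k oU Ua sg sg').1 H2.
split; first by rewrite e1 e2.
move=> i.
have D (u : V -> R^o) : smooth U u -> smooth U ('D_(dir i) u : V -> R^o).
  exact: smooth_derive.
have H1' := same_partials_le (leqnSn k) H1; have H2' := same_partials_le (leqnSn k) H2.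
have A1 := IH _ _ _ _ sf (D _ sg) sf' (D _ sg') H1' (d2 i).
have A2 := IH _ _ _ _ sg (D _ sf) sg' (D _ sf') H2' (d1 i).
apply: (eq_same_partials oU Ua _ _ (same_partialsD oU Ua (smoothM oU sf (D _ sg))
  (smoothM oU sg (D _ sf)) (smoothM oU sf' (D _ sg')) (smoothM oU sg' (D _ sf')) A1 A2)).
  by move=> b Ub; rewrite [RHS]deriveMf//; exact: smooth_diff Ub.
by move=> b Ub; rewrite [RHS]deriveMf//; exact: smooth_diff Ub.
Qed.

Lemma same_partials_sum U k a (T : Type) (r : seq T) (F G : T -> V -> R^o) :
  open U -> U a -> (forall t, smooth U (F t)) -> (forall t, smooth U (G t)) ->
  (forall t, same_partials k a (F t) (G t)) ->
  same_partials k a (fun b => \sum_(t <- r) F t b) (fun b => \sum_(t <- r) G t b).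
Proof.
move=> oU Ua sF sG FG; elim: r => [|t r IH].
  have E (H : T -> V -> R^o) : (fun b => \sum_(t <- [::]) H t b) = (fun=> 0).
    by apply/funext => b; rewrite big_nil.
  by rewrite !E.
have E (H : T -> V -> R^o) : (fun b => \sum_(t <- t :: r) H t b) =
    (fun b => H t b + \sum_(t <- r) H t b).
  by apply/funext => b; rewrite big_cons.
by rewrite !E; apply: (same_partialsD oU Ua) => //; apply: smooth_sum.
Qed.

(** The chain rule for contact: the derivative of phi o u along i is the sum over the
    coordinates c of d_i u_c * (d_c phi o u), a sum of products of functions whose
    contact is known, by hypothesis or by induction. No formula for the higher
    derivatives of a composite is involved. *)
Lemma same_partials_comp (W : normedModType R) (C : coords W) (O : set W) U k a
    (phi : W -> R^o) (u u' : V -> W) :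
  open U -> U a -> open O -> smooth O phi -> smooth U u -> smooth U u' ->
  (forall b, U b -> O (u b)) -> (forall b, U b -> O (u' b)) -> u a = u' a ->
  (forall c : cidx C, same_partials k a (cfun c \o u) (cfun c \o u')) ->
  same_partials k a (fun b => phi (u b)) (fun b => phi (u' b)).
Proof.
move=> oU Ua oO sphi su su' uO u'O e0.
elim: k phi sphi => [|k IH] phi sphi H.
  by move=> I; rewrite leqn0 => /eqP /mlen0 ->; rewrite !mpart0 e0.
have sphu (psi : W -> R^o) : smooth O psi -> smooth U (fun b => psi (u b)).
  by move=> sp; exact: (smooth_comp C oU su uO sp).
have sphu' (psi : W -> R^o) : smooth O psi -> smooth U (fun b => psi (u' b)).
  by move=> sp; exact: (smooth_comp C oU su' u'O sp).
have scu (c : cidx C) : smooth U (cfun c \o u) by exact: (smooth_lin oU (@cfun_cts _ _ C c) su).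
have scu' (c : cidx C) : smooth U (cfun c \o u') by exact: (smooth_lin oU (@cfun_cts _ _ C c) su').
apply/(same_partialsS k oU Ua (sphu _ sphi) (sphu' _ sphi)); split; first by rewrite e0.
move=> i.
have chain (w : V -> W) b : smooth U w -> (forall b, U b -> O (w b)) -> U b ->
    \sum_(c : cidx C) 'D_(dir i) (cfun c \o w) b * 'D_(cvec c) phi (w b) =
    'D_(dir i) (fun b => phi (w b)) b.
  move=> sw wO Ub; have dw := smooth_diff sw Ub; have dphi := smooth_diff sphi (wO _ Ub).
  rewrite [RHS](derive_comp _ dw dphi) (derive_dec C _ dphi); apply: eq_bigr => c _.
  by rewrite (derive_lin _ (@cfun_cts _ _ C c) dw).
apply: (eq_same_partials oU Ua (fun b Ub => chain u b su uO Ub) (fun b Ub => chain u' b su' u'O Ub)).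
apply: (same_partials_sum _ oU Ua) => c.
- apply: smoothM => //; first exact: smooth_derive.
  by apply: (sphu (fun w => 'D_(cvec c) phi w)); exact: smooth_derive.
- apply: smoothM => //; first exact: smooth_derive.
  by apply: (sphu' (fun w => 'D_(cvec c) phi w)); exact: smooth_derive.
- apply: (same_partialsM oU Ua).
  + exact: smooth_derive.
  + by apply: (sphu (fun w => 'D_(cvec c) phi w)); exact: smooth_derive.
  + exact: smooth_derive.
  + by apply: (sphu' (fun w => 'D_(cvec c) phi w)); exact: smooth_derive.
  + by have [_] := (same_partialsS k oU Ua (scu c) (scu' c)).1 (H c); exact.
  + apply: (IH (fun w => 'D_(cvec c) phi w)); first exact: smooth_derive.
    by move=> c'; apply: same_partials_le (H c').
Qed.

End IteratedPartials.

Section Slices.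
Context {R : realType} {m : nat} {W : normedModType R}.

Lemma mpartialE I (f : 'rV[R]_m -> R^o) : mpartial I f = mpart (fun i => delta_mx 0 i) I f.
Proof. by []. Qed.

Lemma derive_slice (G : 'rV[R]_m * W -> R^o) (w : W) v :
  'D_v (fun t => G (t, w)) = (fun t => 'D_(v, (0 : W)) G (t, w)).
Proof.
apply/funext => t; rewrite derive_line [RHS]derive_line.
have -> // : (fun h : R => G (h *: v + t, w)) =
  (fun h : R => G (h *: (v, (0 : W)) + (t, w))).
apply/funext => h; congr (G _).
by rewrite -[RHS]/(h *: v + t, h *: 0 + w) scaler0 add0r.
Qed.

Lemma mpartial_slice I (G : 'rV[R]_m * W -> R^o) (w : W) :
  mpartial I (fun t => G (t, w)) =
  (fun t => mpart (fun i => (delta_mx 0 i, (0 : W))) I G (t, w)).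
Proof.
rewrite /mpartial /mpart; elim: (enum 'I_m) => //= i s ->.
by elim: (I i) => //= p ->; rewrite derive_slice.
Qed.

Lemma mpartial_shift I (f : 'rV[R]_m -> R^o) c :
  mpartial I (fun t => f (t + c)) = (fun t => mpartial I f (t + c)).
Proof.
rewrite /mpartial; elim: (enum 'I_m) => //= i s ->.
elim: (I i) => //= p ->; apply/funext => t; exact: derive_shift_pt.
Qed.

End Slices.

(** * Frames and their coordinates *)

Section FrameBasics.
Context {R : realType} {n : nat} {E : topologicalType}.
Variables (M : smooth_manifold R n E) (m : nat).
Implicit Types (x y : chart R n E) (g h : immersion M m) (k l : nat)
  (al : 'I_n) (I J : mindex m).

Lemma jetK k (j : frame M m k) : jet k (repr j) = j.
Proof. exact: reprK. Qed.

Lemma jet_eqP k g h : jet k g = jet k h <-> same_jet k g h.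
Proof.
split=> [/eqP|gh]; first by rewrite eqmodE.
by apply/eqP; rewrite eqmodE.
Qed.

Lemma repr_jet k g : same_jet k (repr (jet k g)) g.
Proof. by apply/jet_eqP; exact: jetK. Qed.

Lemma base_jet k g : base (jet k g) = val g 0.
Proof. by have /asboolP[] := repr_jet k g. Qed.

Lemma ucoord_jet k g x al I : atlas M x -> cdom x (val g 0) -> (mlen I <= k)%N ->
  ucoord x (jet k g) al I = dcoord x g al I.
Proof.
move=> Mx xg Ik; have /asboolP[g0 H] := repr_jet k g.
by apply: H => //; rewrite g0.
Qed.

Lemma fcoordE k (j : frame M m k) x : fcoord x j = jmx k (ucoord x j).
Proof. by []. Qed.

Lemma jc_fcoord_jet k g x al I : atlas M x -> cdom x (val g 0) -> (mlen I <= k)%N ->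
  jc al I (fcoord x (jet k g)) = dcoord x g al I.
Proof. by move=> Mx xg Ik; rewrite fcoordE jc_jmx// ucoord_jet. Qed.

Lemma same_jet_le k l g h : (k <= l)%N -> same_jet l g h -> same_jet k g h.
Proof.
move=> kl /asboolP[e H]; apply/asboolP; split => // x Mx xg al I Ik.
by apply: H => //; exact: leq_trans kl.
Qed.

Lemma tau_jet k l g : (k <= l)%N -> tau k (jet l g) = jet k g.
Proof.
by move=> kl; apply/jet_eqP; apply: (same_jet_le kl); exact: repr_jet.
Qed.

Lemma base_tau k l (j : frame M m l) : (k <= l)%N -> base (tau k j) = base j.
Proof. by move=> kl; rewrite -[j in LHS]jetK tau_jet// base_jet. Qed.

Lemma tau_tau k l p (j : frame M m p) : (k <= l)%N -> (l <= p)%N ->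
  tau k (tau l j) = tau k j.
Proof.
move=> kl lp; rewrite -(jetK j) tau_jet// tau_jet// tau_jet//.
exact: leq_trans lp.
Qed.

Lemma fcoord_tau k l (j : frame M m l) x : (k <= l)%N -> atlas M x -> fdom x j ->
  fcoord x (tau k j) = jtrunc k (fcoord x j).
Proof.
move=> kl Mx xj; apply: jc_ext => al I Ik; rewrite jc_jtrunc//.
have Il := leq_trans Ik kl.
by rewrite fcoordE !jc_jmx// /tau ucoord_jet.
Qed.

Lemma chart_cinvK x w : (x @` cdom x) w -> x (cinv x w) = w /\ cdom x (cinv x w).
Proof. by move=> [p xp <-]; rewrite cmapK. Qed.

Lemma cinv_continuous x w : (x @` cdom x) w -> {for w, continuous (cinv x)}.
Proof. by move=> [p xp <-]; exact: cinv_cts. Qed.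

Lemma overlapP x y w : (x @` (cdom x `&` cdom y)) w <->
  (x @` cdom x) w /\ cdom y (cinv x w).
Proof.
split=> [[p [xp yp] <-]|[[p xp <-]]].
  by split; [exists p|rewrite cmapK].
by rewrite cmapK// => yp; exists p.
Qed.

Lemma overlap_open x y : open (x @` (cdom x `&` cdom y)).
Proof.
rewrite openE => w /overlapP[xw yw]; rewrite /interior.
have o1 : nbhs w (x @` cdom x) by apply: open_nbhs_nbhs; split => //; exact: cimg_open.
have o2 : nbhs w (cinv x @^-1` cdom y).
  apply: (cinv_continuous xw); apply: open_nbhs_nbhs; split => //; exact: cdom_open.
by apply: filterS2 o1 o2 => v xv yv; apply/overlapP.
Qed.

Lemma immersion_nbhd g x : atlas M x -> cdom x (val g 0) ->
  exists V : set 'rV[R]_m, [/\ open V, V 0, forall t, V t -> cdom x (val g t),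
    smooth V (x \o val g) & forall t, V t -> injective ('d (x \o val g) t)].
Proof.
move=> Mx xg; have /asboolP[V [oV V0 cg H]] := valP g.
exists (V `&` val g @^-1` cdom x); have [sg ig] := H x Mx; split => //.
- rewrite openE => t [Vt xt]; rewrite /interior.
  have o1 : nbhs t V by exact: open_nbhs_nbhs.
  have o2 : nbhs t (val g @^-1` cdom x).
    by apply: (cg t Vt); apply: open_nbhs_nbhs; split => //; exact: cdom_open.
  by apply: filterS2 o1 o2 => s Vs xs.
- by move=> t [].
- by move=> t [Vt xt]; exact: ig.
Qed.

Lemma smooth_entry_comp (W : normedModType R) (V : set W) (u : W -> 'rV[R]_n) al :
  open V -> smooth V u -> smooth V (fun t => u t 0 al : R^o).
Proof.
move=> oV su; have := smooth_lin (L := @cfun _ _ (coordsM 1 n) (0, al)) oV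
  (@cfun_cts _ _ (coordsM 1 n) (0, al)) su.
by apply: smooth_ext.
Qed.

(** Contact of order k in one chart implies it in the others, by the chain rule for
    contact applied to the transition map. *)
Lemma same_jet_chart k g h x : atlas M x -> cdom x (val g 0) -> cdom x (val h 0) ->
  (forall al I, (mlen I <= k)%N -> dcoord x g al I = dcoord x h al I) ->
  same_jet k g h.
Proof.
move=> Mx xg xh H.
have x0 : x (val g 0) = x (val h 0).
  apply/matrixP => i al; rewrite ord1.
  by have := H al [ffun=> 0%N]; rewrite /dcoord !mpartialE !mpart0 mlen_eq0; exact.
have g0 : val g 0 = val h 0 by rewrite -(cmapK xg) x0 cmapK.
apply/asboolP; split => // y My yg al I Ik.
have yh : cdom y (val h 0) by rewrite -g0.
have [V [oV V0 Vg sg _]] := immersion_nbhd Mx xg.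
have [V' [oV' V'0 V'h sh _]] := immersion_nbhd Mx xh.
have [Y [oY Y0 Yg _ _]] := immersion_nbhd My yg.
have [Y' [oY' Y'0 Y'h _ _]] := immersion_nbhd My yh.
pose U := V `&` V' `&` (Y `&` Y').
have oU : open U by do 2?apply: openI.
have U0 : U 0 by [].
have sug : smooth U (x \o val g) by apply: smooth_sub sg => t [[]].
have suh : smooth U (x \o val h) by apply: smooth_sub sh => t [[]].
have st := atlas_compat Mx My.
have stal : smooth (x @` (cdom x `&` cdom y)) (fun w => (y \o cinv x) w 0 al : R^o).
  by apply: smooth_entry_comp => //; exact: overlap_open.
have Og t : U t -> (x @` (cdom x `&` cdom y)) ((x \o val g) t).
  by move=> [[Vt _] [Yt _]]; exists (val g t) => //; split; [exact: Vg|exact: Yg].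
have Oh t : U t -> (x @` (cdom x `&` cdom y)) ((x \o val h) t).
  by move=> [[_ Vt] [_ Yt]]; exists (val h t) => //; split; [exact: V'h|exact: Y'h].
have := same_partials_comp (C := coordsM 1 n) (dir := fun i => delta_mx 0 i) (k := k)
  oU U0 (@overlap_open x y) stal sug suh Og Oh x0.
move=> SP; rewrite /dcoord !mpartialE.
have eg t : U t -> (y \o cinv x) ((x \o val g) t) 0 al = y (val g t) 0 al.
  by move=> [[Vt _] _]; rewrite /= cmapK//; exact: Vg.
have eh t : U t -> (y \o cinv x) ((x \o val h) t) 0 al = y (val h t) 0 al.
  by move=> [[_ Vt] _]; rewrite /= cmapK//; exact: V'h.
apply: (eq_same_partials oU U0 eg eh (SP _)) => // -[i be] J Jk.
by rewrite (ord1 i); exact: H.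
Qed.

Lemma fcoord_inj k x (j j' : frame M m k) : atlas M x -> fdom x j -> fdom x j' ->
  fcoord x j = fcoord x j' -> j = j'.
Proof.
move=> Mx xj xj' e; rewrite -(jetK j) -(jetK j'); apply/jet_eqP.
apply: (same_jet_chart Mx) => // al I Ik.
by have := congr1 (jc al I) e; rewrite !fcoordE !jc_jmx.
Qed.

End FrameBasics.

(** * Deforming an immersion *)

Section Matrices.
Context {R : realType}.

Lemma smooth_det (V : normedModType R) (U : set V) p (A : V -> 'M[R]_p) : open U ->
  (forall i j, smooth U (fun a => A a i j : R^o)) -> smooth U (fun a => \det (A a) : R^o).
Proof.
move=> oU sA; apply: smooth_sum => // s _; apply: smoothM => //; first exact: smooth_cst.
by apply: smooth_prod.
Qed.

Lemma row_free_inj_mx p q (A : 'M[R]_(p, q)) :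
  (forall v : 'rV_p, v *m A = 0 -> v = 0) -> row_free A.
Proof.
move=> H; rewrite -kermx_eq0; apply/eqP/row_matrixP => i; rewrite row0.
by apply: H; rewrite -row_mul mulmx_ker row0.
Qed.

Lemma nbhs_prod (T T' : topologicalType) (P : set (T * T')) a b : nbhs (a, b) P ->
  exists A B, [/\ open A, A a, open B, B b & forall s t, A s -> B t -> P (s, t)].
Proof.
move=> [[A B] /= [nA nB] AB]; move: nA nB; rewrite !nbhsE => -[A' [oA Aa] AA'] [B' [oB Bb] BB'].
by exists A', B'; split => // s t /AA' As /BB' Bt; exact: (AB (s, t)).
Qed.

End Matrices.

Section Perturbation.
Context {R : realType} {n : nat} {E : topologicalType}.
Variables (M : smooth_manifold R n E) (m k : nat).
Local Notation jets := 'M[R]_(n, #|bmindex m k|).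
Implicit Types (x y : chart R n E) (al : 'I_n) (I J : mindex m).

(** The polynomial map with jet w at 0. *)
Definition jpoly (w : jets) (t : 'rV[R]_m) : 'rV[R]_n :=
  \row_al jc al [ffun=> 0%N] (jcurve w t).

Lemma smooth_jpoly (U : set ('rV[R]_m * jets)) (w : jets) :
  smooth U (fun p => jpoly (p.2 - w) p.1).
Proof.
apply: (smooth_sub (U := setT)) => //.
apply: (smooth_coords (C := coordsM 1 n)) => [|[i al]]; first exact: openT.
have -> : cfun ((i, al) : cidx (coordsM 1 n)) \o (fun p : 'rV[R]_m * jets => jpoly (p.2 - w) p.1) =
  (fun p => \sum_(J : bmindex m k) jc al (madd [ffun=> 0%N] (mindex_of J)) (p.2 - w)
     * dmon (mindex_of J) p.1 : R^o).
  by apply/funext => p; rewrite /= /entry /= mxE jc_jmx// mlen_eq0.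
apply: smooth_sum => [|J _]; first exact: openT.
apply: smoothM; first exact: openT.
  apply: (smooth_comp (coordsM n #|bmindex m k|) openT _ (fun _ _ => Logic.I) (smooth_jc al _ setT)).
  by apply: smoothB; [exact: openT|exact: smooth_snd|exact: smooth_cst].
exact: (smooth_comp (coordsM 1 m) openT (smooth_fst setT) (fun _ _ => Logic.I) (smooth_dmon (mindex_of J) setT)).
Qed.

(** Adding to x o g the polynomial map with jet z - z0, where g is an immersion with jet
    z0 at 0, gives the jet z, and depends smoothly on z. It remains an immersion for z
    close to z0 and t close to 0, since a left inverse B of the Jacobian matrix at (0, z0)
    keeps J * B invertible nearby. *)
Lemma perturbation x (b : frame M m k) : atlas M x -> fdom x b ->
  exists (V : set 'rV[R]_m) (Z : set jets) (u : 'rV[R]_m * jets -> 'rV[R]_n),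
    [/\ open V /\ V 0, open Z /\ Z (fcoord x b), smooth [set p | V p.1 /\ Z p.2] u &
    forall z, Z z -> exists h : immersion M m,
      (forall t, V t -> cdom x (val h t) /\ x (val h t) = u (t, z)) /\
      fcoord x (jet k h) = z].
Proof.
move=> Mx xb; pose g := repr b; pose z0 := fcoord x b.
have [V0 [oV0 V00 V0x sg ig]] := immersion_nbhd Mx (xb : cdom x (val g 0)).
pose u (p : 'rV[R]_m * jets) : 'rV[R]_n := x (val g p.1) + jpoly (p.2 - z0) p.1.
pose U0 := [set p : 'rV[R]_m * jets | V0 p.1].
have oU0 : open U0.
  have -> : U0 = fst @^-1` V0 by [].
  by apply: open_comp => // p _; exact: cvg_fst.
have su : smooth U0 u.
  apply: smoothD => //; last exact: smooth_jpoly.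
  exact: (smooth_map_comp (coordsM 1 m) (coordsM 1 n) oV0 oU0 (smooth_fst U0) (fun _ h => h) sg).
have sual al : smooth U0 (fun p => u p 0 al : R^o) by exact: smooth_entry_comp.
pose Jm p : 'M[R]_(m, n) := \matrix_(i, al) 'D_(delta_mx 0 i, 0) (fun p => u p 0 al : R^o) p.
have jp0 t : jpoly (z0 - z0) t = 0.
  by apply/matrixP => i al; rewrite subrr !mxE jc_jmx ?mlen_eq0// big1// => J _; rewrite linear0 mul0r.
have uz0 t : u (t, z0) = x (val g t) by rewrite /u /= jp0 addr0.
have derJ (z : jets) t v : V0 t -> 'D_v (fun t => u (t, z)) t = v *m Jm (t, z).
  move=> Vt.
  have du : differentiable u (t, z) by exact: (smooth_diff su (Vt : U0 (t, z))).
  have dp : differentiable (fun t : 'rV[R]_m => (t, z)) t.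
    by apply: differentiable_pair.
  have dut : differentiable (fun t => u (t, z)) t by exact: (differentiable_comp dp du).
  rewrite (derive_dec (coordsM 1 m) _ dut) -(pair_bigA _ (fun (i : 'I_1) (j : 'I_m) =>
    v i j *: 'D_(delta_mx i j) (fun t => u (t, z)) t)) /= big_ord1.
  apply/matrixP => i al; rewrite (ord1 i) !mxE summxE; apply: eq_bigr => j _; rewrite !mxE; congr (_ * _).
  have /(congr1 (fun f => f t)) <- := @derive_slice R m jets (fun p => u p 0 al : R^o) z (delta_mx 0 j).
  exact/esym/(derive_lin _ (@cfun_cts _ _ (coordsM 1 n) (0, al)) dut).
(* the Jacobian matrix of the immersion x o g at 0 is injective on row vectors *)
have [B JB] : exists B, Jm (0, z0) *m B = 1%:M.
  apply/row_freeP; apply: row_free_inj_mx => v; rewrite -derJ//.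
  have -> : (fun t => u (t, z0)) = x \o val g by apply/funext => t; rewrite uz0.
  have dxg : differentiable (x \o val g) 0 by exact: smooth_diff sg V00.
  rewrite (deriveE _ dxg) => dv0; apply: (ig 0 V00); by rewrite dv0 linear0.
have sdet : smooth U0 (fun p => \det (Jm p *m B) : R^o).
  apply: smooth_det => // i j.
  have -> : (fun p => (Jm p *m B) i j : R^o) =
     (fun p => \sum_al 'D_(delta_mx 0 i, 0) (fun p => u p 0 al : R^o) p * B al j : R^o).
    by apply/funext => p; rewrite mxE; apply: eq_bigr => al _; rewrite mxE.
  apply: smooth_sum => // al _; apply: smoothM => //; last exact: smooth_cst.
  exact: smooth_derive (sual al).
have n1 : \forall p \near ((0 : 'rV[R]_m), z0), U0 p by exact: smooth_open_near.
have n2 : \forall p \near ((0 : 'rV[R]_m), z0), (x @` cdom x) (u p).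
  have := smooth_cts su (V00 : U0 (0, z0)); apply; apply: open_nbhs_nbhs; split.
    exact: cimg_open.
  by rewrite uz0; exists (val g 0).
have n3 : \forall p \near ((0 : 'rV[R]_m), z0), \det (Jm p *m B) != 0.
  have o : nbhs (\det (Jm (0, z0) *m B)) (fun r : R => r != 0).
    apply: open_nbhs_nbhs; split; last by rewrite JB det1 oner_neq0.
    exact: open_neq.
  exact: (smooth_cts sdet (V00 : U0 (0, z0)) o).
have [V [Z [oV V0' oZ Zz0 VZ]]] := nbhs_prod (filterI (filterI n1 n2) n3).
have VV0 t : V t -> V0 t by move=> Vt; have [[]] := VZ t z0 Vt Zz0.
exists V, Z, u; split => //.
  by apply: smooth_sub su => p [Vp _]; exact: VV0.
move=> z Zz; pose h0 t := cinv x (u (t, z)).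
have xu t : V t -> (x @` cdom x) (u (t, z)) by move=> Vt; have [[]] := VZ t z Vt Zz.
have dJ t : V t -> \det (Jm (t, z) *m B) != 0 by move=> Vt; have [] := VZ t z Vt Zz.
have suz : smooth V (fun t => u (t, z)).
  have sp : smooth V (fun t : 'rV[R]_m => (t, z)).
    apply: (smooth_pair (coordsM 1 m) (coordsM n #|bmindex m k|) oV); last exact: smooth_cst.
    by apply: (@smoothL R _ _ V idfun) => t; exact: cvg_id.
  exact: (smooth_map_comp (coordsP (coordsM 1 m) (coordsM n #|bmindex m k|)) (coordsM 1 n) oU0 oV sp VV0 su).
have ch0 t : V t -> {for t, continuous h0}.
  move=> Vt; apply: continuous_comp; first exact: smooth_cts suz Vt.
  exact: cinv_continuous (xu t Vt).
have oVy y : open (V `&` h0 @^-1` cdom y).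
  rewrite openE => t [Vt yt]; rewrite /interior.
  have o1 : nbhs t V by exact: open_nbhs_nbhs.
  have o2 : nbhs t (h0 @^-1` cdom y).
    by apply: (ch0 t Vt); apply: open_nbhs_nbhs; split => //; exact: cdom_open.
  by apply: filterS2 o1 o2 => s Vs xs.
have h0imm : is_immersion M h0.
  exists V; split => // y My.
  have syh : smooth (V `&` h0 @^-1` cdom y) (y \o h0).
    apply: (smooth_map_comp (coordsM 1 n) (coordsM 1 n) (@overlap_open _ _ _ x y) (oVy y) _ _ (atlas_compat Mx My)).
      by apply: smooth_sub suz => t [].
    by move=> t [Vt yt]; apply/overlapP; split => //; exact: xu.
  split => // t Vt yt v v' vv'.
  have dyh : differentiable (y \o h0) t by apply: smooth_diff syh _.
  have [xK xc] := chart_cinvK (xu t Vt).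
  have Oyx : (y @` (cdom y `&` cdom x)) ((y \o h0) t) by exists (h0 t).
  have dxy : differentiable (x \o cinv y) ((y \o h0) t).
    exact: smooth_diff (atlas_compat My Mx) Oyx.
  have eu w : 'D_w (fun t => u (t, z)) t = 'D_('D_w (y \o h0) t) (x \o cinv y) ((y \o h0) t).
    rewrite -(derive_comp w dyh dxy); apply: near_eq_derive.
    near=> s; have [Vs ys] : (V `&` h0 @^-1` cdom y) s.
      by near: s; apply: (smooth_open_near (oVy y)).
    by rewrite /= cmapK//; have [-> _] := chart_cinvK (xu s Vs).
  apply/eqP; rewrite -subr_eq0; apply/eqP.
  have E0 : 'D_(v - v') (fun t => u (t, z)) t = 0.
    by rewrite eu (deriveE (v - v') dyh) linearB vv' subrr derive0.
  have : (v - v') *m (Jm (t, z) *m B) = 0 by rewrite mulmxA -derJ ?E0 ?mul0mx//; exact: VV0.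
  have uJ : Jm (t, z) *m B \in unitmx by rewrite unitmxE unitfE; exact: dJ.
  by move/(congr1 (mulmxr (invmx (Jm (t, z) *m B)))); rewrite /= mulmxK// mul0mx.
have h0P : `[< is_immersion M h0 >] by apply/asboolP.
pose h : immersion M m := exist _ h0 h0P.
have hx t : V t -> cdom x (val h t) /\ x (val h t) = u (t, z).
  by move=> Vt; have [? ?] := chart_cinvK (xu t Vt).
exists h; split => //; apply: jc_ext => al I Ik.
rewrite jc_fcoord_jet//; last by have [] := hx 0 V0'.
rewrite /dcoord mpartialE.
have sxg : smooth V (fun t => x (val g t) 0 al : R^o).
  apply: (smooth_entry_comp (u := x \o val g)) => //.
  exact: smooth_sub sg.
have e1 t : V t -> u (t, z) 0 al = x (val h t) 0 al by move=> Vt; have [_ ->] := hx t Vt.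
rewrite -(eq_mpart (fun i => delta_mx 0 i) I oV e1 V0').
(* all the iterated derivatives of the deformed immersion *)
pose F J t : R^o := mpartial J (fun t => x (val g t) 0 al) t + jc al J (jcurve (z - z0) t).
have sw : smooth V (fun t => u (t, z) 0 al : R^o) by exact: smooth_entry_comp.
rewrite (mpart_unique (dir := fun i => delta_mx 0 i) (F := F) (k := k) oV sw _ _ Ik V0').
- rewrite /F jcurve0 linearB /= -/(dcoord x g al I) -[dcoord _ _ _ _](@ucoord_jet _ _ _ M _ k)// jetK.
  by rewrite /z0 fcoordE jc_jmx// addrC subrK.
- by move=> t Vt; rewrite /F mpartialE mpart0 /u !mxE.
- move=> J i t Jk Vt; rewrite /F.
  have dj : differentiable (jcurve (z - z0)) t.
    by apply: (smooth_diff (U := setT)) => //; exact: smooth_jcurve.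
  have djc : differentiable (fun t => jc al J (jcurve (z - z0) t)) t.
    apply: (differentiable_comp dj); apply: (smooth_diff (U := setT)) => //; exact: smooth_jc.
  have dm : differentiable (mpartial J (fun t => x (val g t) 0 al)) t.
    exact: smooth_diff (smooth_mpart (fun i => delta_mx 0 i) J sxg) Vt.
  rewrite deriveD; [|exact: diff_derivable..].
  rewrite -(jc_derive _ _ _ dj) derive_jcurve_delta jc_jshf_same; congr (_ + _).
  by rewrite -(mpart_incr (fun i => delta_mx 0 i) J i oV sxg Vt).
Unshelve. all: by end_near. Qed.

End Perturbation.

(** * Transition maps and topology *)

Section Transition.
Context {R : realType} {n : nat} {E : topologicalType}.
Variables (M : smooth_manifold R n E) (m k : nat).
Local Notation jets := 'M[R]_(n, #|bmindex m k|).
Implicit Types (x y : chart R n E) (al : 'I_n) (I J : mindex m) (b j : frame M m k).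

(** The derivatives at t = 0 of y o x^(-1) applied to the deformed immersions depend
    smoothly on the parameter z. *)
Lemma transition x y b : atlas M x -> atlas M y -> fdom x b -> fdom y b ->
  exists (Z : set jets) (T : jets -> jets), [/\ open Z, Z (fcoord x b), smooth Z T &
    forall z, Z z -> exists j, [/\ fdom x j, fdom y j, fcoord x j = z & fcoord y j = T z]].
Proof.
move=> Mx My xb yb.
have [V [Z0 [u [[oV V0] [oZ0 Z0b] su H]]]] := perturbation Mx xb.
pose O := [set p : 'rV[R]_m * jets | V p.1 /\ Z0 p.2].
have oO : open O.
  have -> : O = (fst @^-1` V) `&` (snd @^-1` Z0) by [].
  by apply: openI; apply: open_comp => // p _; [exact: cvg_fst|exact: cvg_snd].
have O0 : O (0, fcoord x b) by [].
have ov0 : (x @` (cdom x `&` cdom y)) (u (0, fcoord x b)).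
  have [h [hx hb]] := H _ Z0b; have [xh <-] := hx 0 V0.
  exists (val h 0) => //; split => //.
  have -> : val h 0 = base (jet k h) by rewrite base_jet.
  suff -> : jet k h = b by [].
  by apply: (fcoord_inj Mx) => //; rewrite /fdom /= base_jet.
have n1 : \forall p \near ((0 : 'rV[R]_m), fcoord x b), O p by exact: smooth_open_near.
have n2 : \forall p \near ((0 : 'rV[R]_m), fcoord x b), (x @` (cdom x `&` cdom y)) (u p).
  have := smooth_cts su O0; apply; apply: open_nbhs_nbhs; split => //.
  exact: (@overlap_open _ _ _ x y).
have [A [Z [oA A0 oZ Zb AZ]]] := nbhs_prod (filterI n1 n2).
pose O' := [set p : 'rV[R]_m * jets | A p.1 /\ Z p.2].
have oO' : open O'.
  have -> : O' = (fst @^-1` A) `&` (snd @^-1` Z) by [].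
  by apply: openI; apply: open_comp => // p _; [exact: cvg_fst|exact: cvg_snd].
pose Q al p : R^o := (y \o cinv x) (u p) 0 al.
have sQ al : smooth O' (Q al).
  apply: smooth_entry_comp => //.
  apply: (smooth_map_comp (coordsM 1 n) (coordsM 1 n) (@overlap_open _ _ _ x y) oO' _ _ (atlas_compat Mx My)).
    by apply: smooth_sub su => -[t z] [At Zz]; have [] := AZ t z At Zz.
  by move=> [t z] [At Zz]; have [] := AZ t z At Zz.
pose dir (i : 'I_m) : 'rV[R]_m * jets := (delta_mx 0 i, 0).
exists Z, (fun z => jmx k (fun al I => mpart dir I (Q al) (0, z))); split => //.
  apply: smooth_jmx => // al I _.
  have sp : smooth Z (fun z : jets => ((0 : 'rV[R]_m), z)).
    apply: (smooth_pair (coordsM 1 m) (coordsM n #|bmindex m k|) oZ); first exact: smooth_cst.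
    by apply: (@smoothL R _ _ Z idfun) => t; exact: cvg_id.
  exact: (smooth_comp (coordsP (coordsM 1 m) (coordsM n #|bmindex m k|)) oZ sp
    (fun z Zz => conj A0 Zz : O' (0, z)) (smooth_mpart dir I (sQ al))).
move=> z Zz; have [[_ Z0z] _] := AZ 0 z A0 Zz; have [h [hx hz]] := H _ Z0z.
have yh t : A t -> cdom x (val h t) /\ (cdom y (val h t) /\ forall al, Q al (t, z) = y (val h t) 0 al).
  move=> At; have [[Vt _] /overlapP[_]] := AZ t z At Zz; rewrite /Q /=.
  by have [xt <-] := hx t Vt; rewrite cmapK.
have [xh0 [yh0 _]] := yh 0 A0.
exists (jet k h); split => //; rewrite /fdom /= ?base_jet//.
apply: jc_ext => al I Ik; rewrite jc_fcoord_jet// jc_jmx// /dcoord.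
rewrite mpartialE -(eq_mpart (fun i => delta_mx 0 i) I oA (f := fun t => Q al (t, z))) //.
  by rewrite -mpartialE mpartial_slice.
by move=> t At; have [_ [_ ->]] := yh t At.
Qed.

Lemma realized x b : atlas M x -> fdom x b ->
  \forall z \near fcoord x b, exists j, fdom x j /\ fcoord x j = z.
Proof.
move=> Mx xb; have [Z [T [oZ Zb _ H]]] := transition Mx Mx xb xb.
have : \forall z \near fcoord x b, Z z by exact: smooth_open_near.
by apply: filterS => z /H[j [xj _ jz _]]; exists j.
Qed.

Lemma open_chart_box x (A : set jets) : atlas M x -> open A ->
  open (fdom x `&` fcoord x @^-1` A : set (frame M m k)).
Proof.
move=> Mx oA; exists [set fdom x `&` fcoord x @^-1` A : set (frame M m k)].
  by move=> _ ->; apply: (finI_from1 id); exists x, A.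
exact: bigcup_set1.
Qed.

(** The topology of the frame bundle is generated by the domains of all the charts, but
    near a point any chart suffices, because the transition maps are continuous. *)
Lemma nbhs_frame x b (B : set (frame M m k)) : atlas M x -> fdom x b ->
  nbhs b B <-> \forall z \near fcoord x b, forall j, fdom x j -> fcoord x j = z -> B j.
Proof.
move=> Mx xb; split; last first.
  move=> H; pose B' := [set z | forall j : frame M m k, fdom x j -> fcoord x j = z -> B j].
  have [[oA Ab] AB] := (@open_interior _ B', H : B'^° (fcoord x b), @interior_subset _ B').
  move: (B'^°) oA Ab AB => A oA Ab AB.
  apply: (@filterS _ (nbhs b) _ (fdom x `&` fcoord x @^-1` A)).
    by move=> j [xj Aj]; exact: (AB _ Aj).
  by apply: open_nbhs_nbhs; split => //; exact: open_chart_box.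
move=> nB; have [[oU Ub] UB] := (@open_interior _ B, nB : B^° b, @interior_subset _ B).
move: (B^°) oU Ub UB => U [D sD <-] [C DC Cb] UB.
pose P (B : set (frame M m k)) : set jets := [set z | forall j, fdom x j -> fcoord x j = z -> B j].
pose F : set_system (frame M m k) := fun B => nbhs (fcoord x b) (P B).
have F1 : F setT.
  by rewrite /F (_ : P setT = setT); [exact: filterT|apply/seteqP; split].
have F2 A A' : F A -> F A' -> F (A `&` A').
  by rewrite /F => FA FA'; apply: filterS2 FA FA' => z Pz Qz j xj jz; split; [exact: Pz|exact: Qz].
have F3 A A' : A `<=` A' -> F A -> F A'.
  by rewrite /F => AA' FA; apply: filterS FA => z Pz j xj jz; apply: AA'; exact: Pz.
have FF : Filter F := Build_Filter F1 F2 F3.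
suff : F C by rewrite /F; apply: filterS => z Cz j xj jz; apply: UB; exists C => //; exact: Cz.
have [S sS SC] := sD _ DC; rewrite -SC; apply: filter_bigI => G SG.
have Gb : G b by move: Cb; rewrite -SC; exact.
have /set_mem[y [A [My oA GE]]] := sS _ SG.
move: Gb; rewrite GE => -[yb Ab].
have [Z [T [oZ Zb sT H]]] := transition Mx My xb yb.
have Tb : T (fcoord x b) = fcoord y b.
  have [j [xj _ jb <-]] := H _ Zb; by rewrite (fcoord_inj Mx xj xb jb).
have nA : \forall z \near fcoord x b, A (T z).
  by apply: (smooth_cts sT Zb); rewrite Tb; apply: open_nbhs_nbhs.
have nZ : \forall z \near fcoord x b, Z z by exact: smooth_open_near.
rewrite /F; apply: filterS2 nA nZ => z Az Zz j xj jz.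
have [j' [xj' yj' jz' yT]] := H z Zz.
have -> : j = j' by apply: (fcoord_inj Mx) => //; rewrite jz jz'.
by split => //; rewrite /preimage /= yT.
Unshelve. all: by end_near.
Qed.

Lemma fcoord_continuous x b : atlas M x -> fdom x b ->
  {for b, continuous (fcoord x : frame M m k -> jets)}.
Proof.
move=> Mx xb A nA; apply/(nbhs_frame _ Mx xb); apply: filterS nA => z Az j xj jz.
by rewrite /= jz.
Qed.

Lemma fcoord_open x (U : set (frame M m k)) : atlas M x -> open U ->
  open (fcoord x @` (U `&` fdom x)).
Proof.
move=> Mx oU; rewrite openE => _ [b [Ub xb] <-]; rewrite /interior.
have nU : nbhs b U by exact: open_nbhs_nbhs.
move/(nbhs_frame _ Mx xb) : nU => nU.
apply: filterS2 nU (realized Mx xb) => z Uz [j [xj jz]]; exists j => //; split => //.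
exact: Uz.
Qed.

Lemma fdom_open x : atlas M x -> open (fdom x : set (frame M m k)).
Proof.
move=> Mx; have := open_chart_box Mx (@openT jets); by rewrite preimage_setT setIT.
Qed.

End Transition.

Lemma tau_continuous (R : realType) n (E : topologicalType)
    (M : smooth_manifold R n E) m k l (b : frame M m l) : (k <= l)%N ->
  {for b, continuous (tau k : frame M m l -> frame M m k)}.
Proof.
move=> kl B; have [x Mx xb] := atlas_cover M (base b).
have xtb : fdom x (tau k b) by rewrite /fdom /= base_tau.
rewrite (nbhs_frame _ Mx xtb) (fcoord_tau kl Mx xb) => nB.
change (nbhs b (tau k @^-1` B)); apply/(nbhs_frame _ Mx xb).
apply: (@filterS _ (nbhs (fcoord x b)) _ _ _ _ (@jtrunc_cts _ _ _ l k (fcoord x b) _ nB)).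
move=> z Bz j xj jz; apply: Bz.
  by rewrite /fdom /= base_tau.
by rewrite fcoord_tau// jz.
Qed.

(** * Total derivatives in charts *)

Section Representatives.
Context {R : realType} {n : nat} {E : topologicalType}.
Variables (M : smooth_manifold R n E) (m k : nat).
Implicit Types (x y : chart R n E) (f : frame M m k -> R) (b j : frame M m k).

Lemma frepE x f j : atlas M x -> fdom x j -> frep x f (fcoord x j) = f j.
Proof.
move=> Mx xj; rewrite /frep; case: pselect => [h|[]]; last by exists j.
by congr f; case: (cid h) => j' /= [xj' e]; apply: (fcoord_inj Mx).
Qed.

(** Smoothness passes from one chart to the others by the transition maps. *)
Lemma smooth_fun_chart x (U : set (frame M m k)) f : atlas M x -> open U ->
  U `<=` fdom x -> smooth (fcoord x @` U) (frep x f) -> smooth_fun U f.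
Proof.
move=> Mx oU Ux sf y My; apply: smooth_glue => _ [b [Ub yb] <-].
have xb := Ux _ Ub.
have [Z [T [oZ Zb sT H]]] := transition My Mx yb xb.
have oO : open (Z `&` fcoord y @` (U `&` fdom y)).
  by apply: openI => //; exact: fcoord_open.
exists (Z `&` fcoord y @` (U `&` fdom y)); first by split => //; split => //; exists b.
have TE j : U j -> fdom y j -> Z (fcoord y j) -> T (fcoord y j) = fcoord x j.
  move=> Uj yj /H[j' [yj' xj' e <-]]; congr fcoord.
  exact: (fcoord_inj My).
apply: (smooth_ext (f := fun z => frep x f (T z))) => //.
  by move=> z [+ [j [Uj yj] jz]]; rewrite -jz => Zj; rewrite TE// !frepE//; exact: Ux.
apply: (smooth_comp (coordsM n #|bmindex m k|) oO _ _ sf).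
  by apply: smooth_sub sT => z [].
by move=> z [+ [j [Uj yj] jz]]; rewrite -jz => Zj; rewrite TE//; exists j.
Qed.

Lemma smooth_fun_sub (U U' : set (frame M m k)) f : U' `<=` U ->
  smooth_fun U f -> smooth_fun U' f.
Proof.
move=> UU sf x Mx; apply: smooth_sub (sf x Mx) => _ [j [Uj xj] <-].
by exists j => //; split => //; exact: UU.
Qed.

End Representatives.

Section Translation.
Context {R : realType} {n : nat} {E : topologicalType}.
Variables (M : smooth_manifold R n E) (m : nat).
Implicit Types (x y : chart R n E) (g : immersion M m).

Lemma is_immersion_translate g : exists V : set 'rV[R]_m, [/\ open V, V 0 &
  forall t, V t -> is_immersion M (fun s => val g (s + t))].
Proof.
have /asboolP[V [oV V0 cg H]] := valP g.
exists V; split => // t Vt.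
have st (U : set 'rV[R]_m) : smooth U (fun s : 'rV[R]_m => s + t).
  apply: (smooth_sub (U := setT)) => //; apply: smoothD; first exact: openT.
    by apply: (@smoothL R _ _ _ idfun) => s; exact: cvg_id.
  exact: smooth_cst.
have ct : continuous (fun s : 'rV[R]_m => s + t).
  by move=> s; exact: (smooth_cts (st setT)).
exists [set s | V (s + t)]; split.
- by apply: (@open_comp _ _ (fun s : 'rV[R]_m => s + t) V) => // s _; exact: ct.
- by rewrite /= add0r.
- by move=> s Vs; apply: continuous_comp; [exact: ct|exact: cg].
- move=> x Mx; have [sx ix] := H x Mx.
  have oVx : open (V `&` val g @^-1` cdom x).
    rewrite openE => s [Vs xs]; rewrite /interior.
    have o1 : nbhs s V by exact: open_nbhs_nbhs.
    have o2 : nbhs s (val g @^-1` cdom x).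
      by apply: (cg s Vs); apply: open_nbhs_nbhs; split => //; exact: cdom_open.
    by apply: filterS2 o1 o2 => s' ? ?.
  have oVx' : open ([set s | V (s + t)] `&` (fun s => val g (s + t)) @^-1` cdom x).
    by apply: (@open_comp _ _ (fun s : 'rV[R]_m => s + t) (V `&` val g @^-1` cdom x)) => // s _; exact: ct.
  split; first exact: (smooth_map_comp (coordsM 1 m) (coordsM 1 n) oVx oVx' (st _) (fun _ h => h) sx).
  move=> s Vs xs v v'.
  have dxg : differentiable (x \o val g) (s + t) by apply: (smooth_diff sx).
  rewrite -!deriveE.
  + by rewrite !(@derive_shift_pt R _ _ (x \o val g)) !deriveE//; exact: ix.
  + exact: (diff_shift_pt (f := x \o val g)).
  + exact: (diff_shift_pt (f := x \o val g)).
Qed.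

(** The base point of the immersion g is moved to t, if the result is an immersion on a
    neighbourhood of 0, as happens for t close to 0. *)
Definition translate g (t : 'rV[R]_m) : immersion M m :=
  if pselect `[< is_immersion M (fun s => val g (s + t)) >] is left h
  then exist (fun g : 'rV[R]_m -> E => is_true `[< is_immersion M g >]) (fun s => val g (s + t)) h
  else g.

Lemma translateE g : \forall t \near (0 : 'rV[R]_m),
  forall s, val (translate g t) s = val g (s + t).
Proof.
have [V [oV V0 H]] := is_immersion_translate g.
have : \forall t \near (0 : 'rV[R]_m), V t by exact: open_nbhs_nbhs.
apply: filterS => t /H ht s; rewrite /translate; case: pselect => //.
by move=> []; apply/asboolP.
Qed.

(** The jet at t of g, in coordinates. *)
Definition prolong k x g (t : 'rV[R]_m) : 'M[R]_(n, #|bmindex m k|) :=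
  jmx k (fun al I => mpartial I (fun s => x (val g s) 0 al) t).

Lemma fcoord_translate k x g : atlas M x -> cdom x (val g 0) ->
  \forall t \near (0 : 'rV[R]_m), fdom x (jet k (translate g t)) /\
    fcoord x (jet k (translate g t)) = prolong k x g t.
Proof.
move=> Mx xg; have [V [oV V0 Vx _ _]] := immersion_nbhd Mx xg.
have : \forall t \near (0 : 'rV[R]_m), V t by exact: open_nbhs_nbhs.
apply: filterS2 (translateE g) => t gt Vt.
have x0 : cdom x (val (translate g t) 0) by rewrite gt add0r; exact: Vx.
split; first by rewrite /fdom /= base_jet.
apply: jc_ext => al I Ik; rewrite jc_fcoord_jet// jc_jmx// /dcoord.
rewrite [in LHS](_ : (fun _ => _) = fun s => x (val g (s + t)) 0 al).
  by rewrite (mpartial_shift I (fun s => x (val g s) 0 al)) add0r.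
by apply/funext => s; rewrite gt.
Qed.

Lemma prolong0 k x g : atlas M x -> cdom x (val g 0) -> prolong k x g 0 = fcoord x (jet k g).
Proof.
by move=> Mx xg; apply: jc_ext => al I Ik; rewrite jc_fcoord_jet// jc_jmx.
Qed.

Lemma derive_prolong k x g i : atlas M x -> cdom x (val g 0) ->
  differentiable (prolong k x g) 0 /\
  'D_(delta_mx 0 i) (prolong k x g) 0 = jshf k i (fcoord x (jet k.+1 g)).
Proof.
move=> Mx xg; have [V [oV V0 Vx sg _]] := immersion_nbhd Mx xg.
have sal al : smooth V (fun s => x (val g s) 0 al : R^o).
  exact: (smooth_entry_comp (u := x \o val g)).
have dp : differentiable (prolong k x g) 0.
  apply: (smooth_diff (U := V)) => //; apply: smooth_jmx => // al I _.
  exact: (smooth_mpart (fun i => delta_mx 0 i) I (sal al)).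
split => //; apply: jc_ext => al I Ik.
rewrite jc_derive// jc_jshf// jc_fcoord_jet// ?mlen_incr//.
rewrite (_ : (fun z => jc al I (prolong k x g z)) = mpartial I (fun s => x (val g s) 0 al)).
  exact/esym/(mpart_incr (fun i => delta_mx 0 i) I i oV (sal al) V0).
by apply/funext => t; rewrite jc_jmx.
Qed.

End Translation.

Section TotalDerivative.
Context {R : realType} {n : nat} {E : topologicalType}.
Variables (M : smooth_manifold R n E) (m k : nat).
Implicit Types (x y : chart R n E) (f : frame M m k -> R) (j : frame M m k.+1).

Lemma frep_diff (U : set (frame M m k)) x f b : atlas M x -> U b -> fdom x b ->
  smooth_fun U f -> differentiable (frep x f) (fcoord x b).
Proof.
move=> Mx Ub xb sf; apply: (smooth_diff (sf x Mx)).
by exists b.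
Qed.

(** Both sides are the derivative at 0 of f along the jets of the translates of an
    immersion representing j: this curve does not depend on the chart. *)
Lemma derive_translate x f (U : set (frame M m k)) i j : atlas M x -> fdom x j ->
  open U -> U (tau k j) -> smooth_fun U f ->
  'D_(jshf k i (fcoord x j)) (frep x f) (fcoord x (tau k j)) =
  'D_(delta_mx 0 i) (fun t => f (jet k (translate (repr j) t)) : R^o) 0.
Proof.
move=> Mx xj oU Uj sf.
have [dp Dp] := derive_prolong k i Mx (xj : cdom x (val (repr j) 0)).
have df : differentiable (frep x f) (prolong k x (repr j) 0).
  by rewrite prolong0//; apply: (frep_diff Mx Uj _ sf); rewrite /fdom /= base_tau.
rewrite -[in LHS](jetK j) tau_jet// -Dp -prolong0//.
rewrite -(derive_comp _ dp df); apply: near_eq_derive.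
apply: filterS (fcoord_translate k Mx (xj : cdom x (val (repr j) 0))) => t [xt ft].
by rewrite -(frepE f Mx xt) ft.
Qed.

(** In the chart used by the definition, the sum is the decomposition of the shift over the
    coordinate vectors; then the chart may be changed. *)
Lemma total_derivativeE x f (U : set (frame M m k)) i j : atlas M x -> fdom x j ->
  open U -> U (tau k j) -> smooth_fun U f ->
  total_derivative i f j = 'D_(jshf k i (fcoord x j)) (frep x f) (fcoord x (tau k j)).
Proof.
move=> Mx xj oU Uj sf; rewrite (derive_translate i Mx xj oU Uj sf).
rewrite /total_derivative; set y := chart_at M (base j).
have [My yj] : atlas M y /\ fdom y j.
  by rewrite /y /chart_at; case: cid2.
have yt : fdom y (tau k j) by rewrite /fdom /= base_tau.
rewrite -(derive_translate i My yj oU Uj sf).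
have df := frep_diff My Uj yt sf.
rewrite [in RHS](jets_sum (jshf k i (fcoord y j))) (deriveE _ df) linear_sum /=.
apply: eq_bigr => al _; rewrite linear_sum /=; apply: eq_bigr => I _.
rewrite linearZ /= -(deriveE _ df) jdelta_delta; congr (_ * _).
by rewrite jc_jshf ?mlen_mindex_of// fcoordE jc_jmx// mlen_incr ltnS mlen_mindex_of.
Qed.

End TotalDerivative.

(** * From frames to the local model *)

Section Widen.
Context {R : realType} {m : nat}.
Local Notation cform := {ffun {set 'I_m} -> R^o}.

(** Extension by 0 to all sets of indices, as in the local model. *)
Definition widen s (w : ext R m s) : cform :=
  [ffun A => if insub A is Some B then w B else 0].

Lemma widen_val s (w : ext R m s) (B : sset m s) : widen w (val B) = w B.
Proof. by rewrite ffunE valK. Qed.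

Lemma hom_widen s (w : ext R m s) : hom s (widen w).
Proof. by move=> A sA; rewrite ffunE insubN. Qed.

Lemma widen_sum s (I : Type) (r : seq I) (F : I -> ext R m s) :
  widen (\sum_(i <- r) F i) = \sum_(i <- r) widen (F i).
Proof.
apply/ffunP => A; rewrite ffunE sum_ffunE.
case: insubP => [B _ BA|sA]; last by rewrite big1// => i _; rewrite hom_widen.
by rewrite sum_ffunE; apply: eq_bigr => i _; rewrite -BA widen_val.
Qed.

Lemma dt_wedgeE s i (w : ext R m s) : widen (dt_wedge i w) = wedge i (widen w).
Proof.
apply/ffunP => B; case: (boolP (#|B| == s.+1)) => sB; last first.
  by rewrite hom_widen// (hom_wedge (s := s))//; exact: hom_widen.
rewrite -[B]/(val (Sub B sB : sset m s.+1)) widen_val ffunE /= ffunE.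
case: ifP => iB; last first.
  rewrite big1// => A /andP[_ /eqP E]; move: iB.
  by rewrite E !inE eqxx.
have sD : #|B :\ i| == s by have := cardsD1 i B; rewrite iB (eqP sB) => -[->].
pose A0 : sset m s := Sub (B :\ i) sD.
rewrite (bigD1 A0) /=; last by rewrite /= finset.setD11 finset.setD1K/=.
rewrite big1 ?addr0 => [|A /andP[/andP[iA /eqP E] /eqP AA0]]; last first.
  by case: AA0; apply: val_inj; rewrite /= E finset.setU1K.
by rewrite -[B :\ i]/(val A0) widen_val.
Qed.

End Widen.

Section ExtendJets.
Context {R : realType} {n m k N : nat}.
Variable w0 : 'M[R]_(n, #|bmindex m N|).

(** The derivatives of w up to order k, completed by those of w0: a lift of w to order N,
    which is close to w0 if w is close to the truncation of w0. *)
Definition jext (w : 'M[R]_(n, #|bmindex m k|)) : 'M[R]_(n, #|bmindex m N|) :=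
  jmx N (fun al J => if (mlen J <= k)%N then jc al J w else jc al J w0).

Lemma smooth_jext U : smooth U jext.
Proof.
apply: (smooth_sub (U := setT)) => //.
rewrite /jext; apply: (smooth_jmx (F := fun al J w =>
  if (mlen J <= k)%N then jc al J w else jc al J w0)) => [|al J _]; first exact: openT.
case: (mlen J <= k)%N; [exact: smooth_jc|exact: smooth_cst].
Qed.

Lemma jtrunc_jext w : (k <= N)%N -> jtrunc k (jext w) = w.
Proof.
move=> kN; apply: jc_ext => al J Jk.
by rewrite jc_jtrunc// jc_jmx ?Jk//; exact: leq_trans kN.
Qed.

Lemma jext_self : (k <= N)%N -> jext (jtrunc k w0) = w0.
Proof.
move=> kN; apply: jc_ext => al J JN; rewrite jc_jmx//; case: ifP => // Jk.
by rewrite jc_jtrunc.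
Qed.

Lemma jext_ball e w : (k <= N)%N -> `|w - w0| < e -> `|jext (jtrunc k w) - w0| < e.
Proof.
move=> kN; have B (v : 'M[R]_(n, #|bmindex m N|)) : `|v - w0| < e <-> ball w0 e v.
  by rewrite -ball_normE /ball_ /= distrC.
move=> /B [e0 H]; apply/B; split => // al j.
have E (v : 'M[R]_(n, #|bmindex m N|)) : v al j = jc al (mindex_of (enum_val j)) v :> R by rewrite /jc bmindex_ofK enum_valK.
rewrite (E w0) (E (jext _)) jc_jmx ?mlen_mindex_of//.
case: ifP => Jk; last by apply: ballxx.
by rewrite jc_jtrunc// -!E; exact: H.
Qed.

End ExtendJets.

Section LocalForms.
Context {R : realType} {n : nat} {E : topologicalType}.
Variables (M : smooth_manifold R n E) (m N : nat) (x : chart R n E).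
Local Notation jets := 'M[R]_(n, #|bmindex m N|).
Local Notation VV := ('rV[R]_m * jets)%type.
Hypothesis Mx : atlas M x.
Variables (w0 : jets) (d e : R).
Hypothesis real_ball : forall w, `|w - w0| < e ->
  exists j : frame M m N, fdom x j /\ fcoord x j = w.
Local Notation box := (@box R n m N w0 d e).
Local Notation Dt := (@Dt R n m N w0 d e).
Local Notation ord := (@ord R n m N w0 d e).
Local Notation kform := (@kform R n m N w0 d e).
Local Notation sfun := (sfun box).
Local Notation form := {ffun {set 'I_m} -> sfun}.

Lemma vert_kform al J (c : {ffun {set 'I_m} -> R^o}) : vert al J (kform c) = 0.
Proof.
apply/ffunP => A; rewrite !ffunE; apply: vder_eq0 => [|z h Oz Oh]; first exact: smooth_cst.
by rewrite !cstfE.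
Qed.

Section OneForm.
Variables (k s : nat) (U : set (frame M m k)) (Phi : frame M m k -> ext R m s).
Hypotheses (kN : (k < N)%N) (oU : open U) (sPhi : smooth_form U Phi).
Hypothesis inU : forall j : frame M m N, fdom x j -> `|fcoord x j - w0| < e -> U (tau k j).

(** The coefficients, read in the chart x, of the pullback of Phi to the frames of order
    N; they are constant in time. *)
Definition lform : form := [ffun A => to_sfun box (fun z =>
  if insub A is Some B then frep x (fun j => Phi j B) (jtrunc k z.2) else 0)].

Let rep (A : {set 'I_m}) (z : VV) : R^o :=
  if insub A is Some B then frep x (fun j => Phi j B) (jtrunc k z.2) else 0.

Let img z : oset box z -> (fcoord x @` (U `&` fdom x)) (jtrunc k z.2).
Proof.
move=> [_ ze]; have [j [xj jz]] := real_ball ze.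
exists (tau k j); last by rewrite (fcoord_tau (ltnW kN) Mx xj) jz.
split; first by apply: inU => //; rewrite jz.
by rewrite /fdom /= base_tau// ltnW.
Qed.

Let smooth_rep A : smooth (oset box) (rep A).
Proof.
rewrite /rep; case: insubP => [B _ _|_]; last exact: smooth_cst.
apply: (smooth_comp (coordsM n #|bmindex m k|) (oset_open box) _ img (sPhi B Mx)).
exact: (smooth_map_comp (coordsM n #|bmindex m N|) (coordsM n #|bmindex m k|) openT
  (oset_open box) (smooth_snd _) (fun _ _ => Logic.I) (smooth_jtrunc k setT)).
Qed.

Lemma lformE A z : oset box z -> lform A z =
  if insub A is Some B then frep x (fun j => Phi j B) (jtrunc k z.2) else 0.
Proof. by move=> Oz; rewrite ffunE (to_sfunE (smooth_rep A)). Qed.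

Lemma lform_val A z (j : frame M m N) : oset box z -> fdom x j -> fcoord x j = z.2 ->
  lform A z = widen (Phi (tau k j)) A.
Proof.
move=> Oz xj jz; rewrite lformE// ffunE; case: insubP => // B _ _.
rewrite -jz -(fcoord_tau (ltnW kN) Mx xj) frepE//.
by rewrite /fdom /= base_tau// ltnW.
Qed.

Lemma ord_lform : ordf ord k lform.
Proof.
move=> A z z' Oz Oz' [_ zz]; rewrite !lformE//; case: insubP => // B _ _.
by congr frep; apply: jc_ext => al J Jk; rewrite !jc_jtrunc// zz.
Qed.

Lemma ind_lform : indf m lform.
Proof. by move=> A z z' Oz Oz' zz _; rewrite !lformE// zz. Qed.

Lemma hom_lform : hom s lform.
Proof.
by move=> A sA; apply: sfun_ext => z Oz; rewrite lformE// insubN.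
Qed.

(** The chain rule: the truncation of a jet sends the total vector field of order N to that
    of order k. *)
Lemma dform_lform A z (j : frame M m N) : oset box z -> fdom x j -> fcoord x j = z.2 ->
  dform Dt lform A z = widen (dT Phi (tau k.+1 j)) A.
Proof.
move=> Oz xj jz; rewrite /dform form_sum_val /dT widen_sum sum_ffunE.
apply: eq_bigr => i _; rewrite wedge_val dt_wedgeE [RHS]ffunE; case: ifP => // iA.
apply: (congr1 (fun r : R => sgn i (A :\ i) * r)).
rewrite ffunE DtE// [RHS]ffunE.
have -> : 'D_(Xf i z) (lform (A :\ i)) z = 'D_(Xf i z) (rep (A :\ i)) z.
  by apply: (eq_derive _ (oset_open box)) Oz => y Oy; exact: lformE.
rewrite /rep; case: insubP => [B _ _|_]; last by rewrite derive_cst.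
have xk : fdom x (tau k.+1 j) by rewrite /fdom /= base_tau.
have Uj : U (tau k (tau k.+1 j)).
  by rewrite tau_tau//; apply: inU => //; rewrite jz; case: Oz.
rewrite ffunE (total_derivativeE i Mx xk oU Uj (sPhi B)).
have ztau : fcoord x (tau k (tau k.+1 j)) = jtrunc k z.2.
  by rewrite tau_tau// (fcoord_tau (ltnW kN) Mx xj) jz.
have df : differentiable (frep x (fun j => Phi j B)) (jtrunc k z.2).
  by rewrite -ztau; apply: (frep_diff Mx Uj _ (sPhi B)); rewrite /fdom /= base_tau.
have ds : differentiable (fun z : VV => z.2) z.
  by apply: (smooth_diff (U := setT)) => //; exact: smooth_snd.
have dj : differentiable (fun z : VV => jtrunc k z.2) z.
  apply: (differentiable_comp ds); apply: (smooth_diff (U := setT)) => //.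
  exact: smooth_jtrunc.
rewrite (derive_comp _ dj df) ztau; congr ('D_ _ _ _).
rewrite (derive_lin _ (@jtrunc_cts R n m N k) ds).
rewrite (@derive_linE R VV jets snd); last by move=> y; exact: cvg_snd.
rewrite (fcoord_tau kN Mx xj) jz; apply: jc_ext => al J Jk /=.
rewrite jc_jtrunc// !jc_jshf//; last exact: leq_trans (ltnW kN).
by rewrite jc_jtrunc// mlen_incr.
Qed.

End OneForm.

End LocalForms.

(** * Exactness of the rows *)

Lemma open_norm_ball (R : realType) (V : normedModType R) (w0 : V) (e : R) :
  open (fun w => `|w - w0| < e).
Proof.
have -> : (fun w => `|w - w0| < e) = ball w0 e :> set _.
  by apply/funext => w; rewrite -ball_normE /ball_ /= distrC.
exact: ball_open.
Qed.

Section Rows.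
Context {R : realType} {n : nat} {E : topologicalType}.
Variables (M : smooth_manifold R n E) (m : nat).

(** A neighbourhood of b on which every jet coordinate is realized, together with a time
    interval on which the reference curve stays in it. *)
Lemma local_box N x (b : frame M m N) (P : set (frame M m N)) : atlas M x -> fdom x b ->
  nbhs b P -> exists d e : R, [/\ 0 < d, 0 < e,
    forall t : 'rV[R]_m, `|t| < d -> `|jcurve (fcoord x b) t - fcoord x b| < e,
    forall w, `|w - fcoord x b| < e -> exists j : frame M m N, fdom x j /\ fcoord x j = w &
    forall j, fdom x j -> `|fcoord x j - fcoord x b| < e -> P j].
Proof.
move=> Mx xb /(nbhs_frame _ Mx xb) nP.
have [e /= e0 He] := (nbhs_normP _ _).1 (filterI nP (realized Mx xb)).
have Be w : `|w - fcoord x b| < e -> ball_ Num.norm (fcoord x b) e w by rewrite /ball_ /= distrC.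
have nc : \forall t \near (0 : 'rV[R]_m), `|jcurve (fcoord x b) t - fcoord x b| < e.
  have cj : {for 0, continuous (jcurve (fcoord x b))}.
    by apply: (smooth_cts (U := setT)) => //; exact: smooth_jcurve.
  have nb : nbhs (jcurve (fcoord x b) 0) (fun w => `|w - fcoord x b| < e).
    rewrite jcurve0; apply: open_nbhs_nbhs; split; first exact: open_norm_ball.
    by rewrite subrr normr0.
  exact: (cj _ nb).
have [d /= d0 Hd] := (nbhs_normP _ _).1 nc.
exists d, e; split => //.
- by move=> t td; apply: Hd; rewrite /ball_ /= sub0r normrN.
- by move=> w /Be/He[].
- by move=> j xj /Be/He[H _]; exact: H.
Qed.

Lemma tau_self N (j : frame M m N) : tau N j = j.
Proof. exact: jetK. Qed.

Lemma near_tau k N s (U : set (frame M m k)) (Phi : frame M m k -> ext R m s)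
    (b : frame M m N) : (k < N)%N -> open U -> U (tau k b) ->
  locally_constant (tau k @^-1` U) (dT Phi) -> exists K, \forall j \near b,
    U (tau k j) /\ dT Phi (tau k.+1 j) = K.
Proof.
move=> kN oU Ub lc.
have [K HK] : exists c, \forall a \near tau k.+1 b, dT Phi a = c.
  by apply: lc; rewrite /preimage /= tau_tau.
exists K.
have n1 : nbhs b (tau k @^-1` U) by apply: (tau_continuous (ltnW kN)); exact: open_nbhs_nbhs.
have n2 : nbhs b (tau k.+1 @^-1` (fun a => dT Phi a = K)) by exact: (tau_continuous kN).
exact: (filterI n1 n2).
Qed.

Lemma dform_lform_cst k N s x (U : set (frame M m k)) (Phi : frame M m k -> ext R m s)
    (w0 : 'M[R]_(n, #|bmindex m N|)) (d e : R) K : atlas M x -> (k < N)%N -> open U -> smooth_form U Phi ->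
  (forall w, `|w - w0| < e -> exists j : frame M m N, fdom x j /\ fcoord x j = w) ->
  (forall j : frame M m N, fdom x j -> `|fcoord x j - w0| < e ->
     U (tau k j) /\ dT Phi (tau k.+1 j) = K) ->
  dform (@Dt R n m N w0 d e) (lform x w0 d e Phi) = kform w0 d e (widen K).
Proof.
move=> Mx kN oU sPhi rb HK.
apply/ffunP => A; apply: sfun_ext => z Oz.
have [j [xj jz]] := rb _ Oz.2.
have HK' (j : frame M m N) xj je := (HK j xj je).1.
rewrite (dform_lform Mx rb kN oU sPhi HK' A Oz xj jz) [in RHS]ffunE cstfE//.
by rewrite (HK j xj _).2// jz; exact: Oz.2.
Qed.

(** The primitive of the vertical homotopy is 0: for s = 0 because of its degree, for k = 0
    because Phi has order 0. At time 0, where the reference curve is at w0, the formula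
    says that Phi is constant. *)
Lemma first_row_exact k s (U : set (frame M m k)) (Phi : frame M m k -> ext R m s) :
  (s < m)%N -> (s = 0%N \/ k = 0%N) -> open U -> smooth_form U Phi ->
  locally_constant (tau k @^-1` U) (dT Phi) -> locally_constant U Phi.
Proof.
move=> sm sk oU sPhi lc b Ub; exists (Phi b).
pose bh := jet k.+1 (repr b).
have tb : tau k bh = b by rewrite /bh tau_jet// jetK.
have [x Mx xb] := atlas_cover M (base b).
have xbh : fdom x bh by rewrite /fdom /= -(base_tau bh (leqnSn k)) tb.
have [K HK] := near_tau (ltnSn k) oU (eq_ind_r U Ub tb) lc.
have [d [e [d0 e0 small rb H]]] := local_box Mx xbh HK.
have HU j xj je := (H j xj je).1.
set w0 := fcoord x bh in small rb H HU.
have Ecl := dform_lform_cst d Mx (ltnSn k) oU sPhi rb H.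
have cl al J : vert al J (dform (@Dt R n m k.+1 w0 d e) (lform x w0 d e Phi)) = 0.
  by rewrite Ecl; exact: vert_kform.
have [Psi [h1 _ r0 EP]] := vertical_homotopy small sm (ltnSn k)
  (ord_lform Mx rb (ltnSn k) sPhi HU) (hom_lform Mx d rb (ltnSn k) sPhi HU) cl.
have Psi0 : Psi = 0.
  case: sk => [s0|]; last exact: r0.
  by apply/ffunP => A; rewrite h1 ?ffunE// s0.
have n1 : nbhs b (fdom x : set (frame M m k)).
  by apply: open_nbhs_nbhs; split => //; exact: fdom_open.
have n2 : \forall a \near b, `|jext w0 (fcoord x a) - w0| < e.
  have c1 := fcoord_continuous Mx (xb : fdom x b).
  have c2 : {for fcoord x b, continuous (@jext R n m k k.+1 w0)}.
    by apply: (smooth_cts (U := setT)) => //; exact: smooth_jext.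
  have nb : nbhs (jext w0 (fcoord x b)) (fun w => `|w - w0| < e).
    rewrite -[b in fcoord x b]tb (fcoord_tau (leqnSn k) Mx xbh) jext_self//.
    by apply: open_nbhs_nbhs; split; [exact: open_norm_ball|rewrite subrr normr0].
  exact: (c1 _ (c2 _ nb)).
apply: (@filterS _ (nbhs b) _ _ _ _ (filterI n1 n2)) => a [xa ae].
have [j [xj jz]] := rb _ ae.
have tj : tau k j = a.
  apply: (fcoord_inj Mx) => //; first by rewrite /fdom /= base_tau.
  by rewrite (fcoord_tau (leqnSn k) Mx xj) jz jtrunc_jext.
have Oz w : `|w - w0| < e -> oset (@box R n m k.+1 w0 d e) (0, w).
  by move=> we; split => //=; rewrite normr0.
have be : `|w0 - w0| < e by rewrite subrr normr0.
apply/ffunP => A; have := EP (val A) _ (Oz _ ae).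
rewrite Psi0 dform0 [X in _ = X](_ : _ = 0); last by rewrite ffunE.
rewrite /bz /= jcurve0 => /eqP; rewrite subr_eq0 => /eqP.
rewrite (lform_val Mx rb (ltnSn k) sPhi HU _ (Oz _ ae) xj jz).
rewrite (lform_val Mx rb (ltnSn k) sPhi HU _ (Oz _ be) xbh (erefl _)).
by rewrite !widen_val tj tb.
Qed.

(** The local form of Phi has a primitive Psi which is constant in time and of order l.
    It defines a form on the frames of order l, once their coordinates are completed in
    order l + 1 by those of b. *)
Lemma higher_row_exact k s (U : set (frame M m k)) (Phi : frame M m k -> ext R m s.+1) :
  (s.+1 < m)%N -> open U -> smooth_form U Phi ->
  locally_constant (tau k @^-1` U) (dT Phi) ->
  forall b : frame M m (exact_order m k).+1, U (tau k b) ->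
  exists W : set (frame M m (exact_order m k).+1),
    [/\ open W, W b, W `<=` tau k @^-1` U &
    exists (W' : set (frame M m (exact_order m k))) (Psi : frame M m (exact_order m k) -> ext R m s)
      (c : ext R m s.+1),
      [/\ open W', tau (exact_order m k) @` W `<=` W', smooth_form W' Psi &
        forall a, W a -> Phi (tau k a) = dT Psi a + c]].
Proof.
move=> sm oU sPhi lc b Ub; set l := exact_order m k.
have kl : (k < l.+1)%N by rewrite ltnS; exact: exact_order_ge.
have [x Mx xb] := atlas_cover M (base b).
have [K HK] := near_tau kl oU Ub lc.
have [d [e [d0 e0 small rb H]]] := local_box Mx xb HK.
have HU j xj je := (H j xj je).1.
set w0 := fcoord x b in small rb H HU.
have Ecl := dform_lform_cst d Mx kl oU sPhi rb H.
have kin_m (c : {ffun {set 'I_m} -> R^o}) : kin m c.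
  by move=> A j _ mj; have := ltn_ord j; rewrite ltnNge mj.
have [_ [Psi [c [h1 o1 i1 [hc EPhi]]]]] := closed_exact d0 e0 small (leqnn m) sm (ltnSn l)
  (ord_lform Mx rb kl sPhi HU) (hom_lform Mx d rb kl sPhi HU)
  (ind_lform Mx rb kl sPhi HU) (hom_widen K) (kin_m (widen K)) Ecl.
pose B : set 'M[R]_(n, #|bmindex m l|) := [set w | `|jext w0 w - w0| < e].
have sje : smooth setT (@jext R n m l l.+1 w0) by exact: smooth_jext.
have oB : open B.
  apply: (open_comp (f := @jext R n m l l.+1 w0) _ (open_norm_ball w0 e)) => w _.
  exact: (smooth_cts sje).
pose W' : set (frame M m l) := fdom x `&` fcoord x @^-1` B.
pose W : set (frame M m l.+1) := fdom x `&` fcoord x @^-1` (fun w => `|w - w0| < e).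
(* evaluated at time 0, as Psi does not depend on the time *)
pose Psi' (j : frame M m l) : ext R m s := [ffun A => Psi (val A) (0, jext w0 (fcoord x j))].
have oW' : open W' by exact: open_chart_box.
have WW' j : fdom x j -> `|fcoord x j - w0| < e -> W' (tau l j).
  move=> xj je; split; first by rewrite /fdom /= base_tau.
  by rewrite /preimage /= (fcoord_tau (leqnSn l) Mx xj); apply: jext_ball.
have sPsi' : smooth_form W' Psi'.
  move=> A; apply: (smooth_fun_chart Mx oW'); first by move=> j [].
  have oI : open (fcoord x @` W').
    have -> : W' = W' `&` fdom x by apply/seteqP; split => j; [move=> [xj ?]|case].
    exact: fcoord_open.
  apply: (smooth_ext (f := fun w => Psi (val A) (0, jext w0 w))) => //.
    by move=> _ [j [xj _] <-]; rewrite frepE// ffunE.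
  apply: (smooth_comp (coordsP (coordsM 1 m) (coordsM n #|bmindex m l.+1|)) oI _ _ (sfun_smooth _)).
    apply: (smooth_pair (coordsM 1 m) (coordsM n #|bmindex m l.+1|) oI); first exact: smooth_cst.
    exact: smooth_jext.
  by move=> _ [j [_ jB] <-]; split => //=; rewrite normr0.
(* coefficients agree because Psi has order l and is constant in time *)
have EPsi : lform x w0 d e Psi' = Psi.
  apply/ffunP => A; apply: sfun_ext => z Oz; have [j [xj jz]] := rb _ Oz.2.
  rewrite (lform_val Mx rb (ltnSn l) sPsi' WW' A Oz xj jz) ffunE.
  case: insubP => [A' _ AA'|sA]; last by rewrite h1 ?sf0.
  rewrite ffunE AA' (fcoord_tau (leqnSn l) Mx xj) jz.
  have Oz0 : oset (@box R n m l.+1 w0 d e) (0, z.2) by split; rewrite /= ?normr0//; exact: Oz.2.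
  rewrite (i1 A z (0, z.2) Oz Oz0)//; last by move=> i mi; have := ltn_ord i; rewrite ltnNge mi.
  apply: (o1 A) => //.
    by split; rewrite /= ?normr0//; apply: jext_ball => //; exact: Oz.2.
  by split => // al J Jl /=; rewrite jc_jmx ?(leqW Jl)// Jl jc_jtrunc.
exists W; split.
- exact: open_chart_box Mx (@open_norm_ball R _ w0 e).
- by split; rewrite /preimage /= ?subrr ?normr0.
- by move=> j [xj je]; exact: HU.
exists W', Psi', [ffun A => c (val A)]; split => //.
  by move=> _ [j [xj je] <-]; exact: WW'.
move=> a [xa ae]; apply/ffunP => A.
have Oz : oset (@box R n m l.+1 w0 d e) (0, fcoord x a) by split; rewrite /= ?normr0.
rewrite -widen_val -(lform_val Mx rb kl sPhi HU _ Oz xa (erefl _)) EPhi -EPsi.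
rewrite ffunE sfD (dform_lform Mx rb (ltnSn l) oW' sPsi' WW' _ Oz xa (erefl _)).
by rewrite tau_self widen_val !ffunE cstfE.
Qed.

End Rows.

(** * The last two terms *)

Section ExactGerms.
Context {R : realType} {n : nat} {E : topologicalType}.
Variables (M : smooth_manifold R n E) (m k s : nat).
Implicit Types (b : frame M m k.+1) (W : set (frame M m k)) (Psi : frame M m k -> ext R m s)
  (Phi : frame M m k.+1 -> ext R m s.+1).

Lemma frepB x (f g : frame M m k -> R) z : frep x (fun j => f j - g j) z = frep x f z - frep x g z.
Proof. by rewrite /frep; case: pselect => // _; rewrite subr0. Qed.

Lemma frep0 x : frep x (fun _ : frame M m k => 0) = fun=> 0.
Proof. by apply/funext => z; rewrite /frep; case: pselect. Qed.

Lemma smooth_formB W Psi Psi' : open W -> smooth_form W Psi -> smooth_form W Psi' ->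
  smooth_form W (fun j => Psi j - Psi' j).
Proof.
move=> oW sP sP' A x Mx; apply: (smooth_ext (f := fun z =>
    frep x (fun j => Psi j A) z - frep x (fun j => Psi' j A) z)).
- exact: fcoord_open.
- by move=> z _; rewrite -frepB; congr (frep x _ z); apply/funext => j; rewrite !ffunE.
- by apply: smoothB; [exact: fcoord_open|exact: sP|exact: sP'].
Qed.

Lemma dt_wedgeB i (u v : ext R m s) : dt_wedge i (u - v) = dt_wedge i u - dt_wedge i v.
Proof.
apply/ffunP => B; rewrite !ffunE -sumrN -big_split /=; apply: eq_bigr => A _.
by rewrite !ffunE mulrBr.
Qed.

Lemma dTB W Psi Psi' b : open W -> W (tau k b) -> smooth_form W Psi -> smooth_form W Psi' ->
  dT (fun j => Psi j - Psi' j) b = dT Psi b - dT Psi' b.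
Proof.
move=> oW Wb sP sP'; rewrite /dT -sumrB; apply: eq_bigr => i _.
rewrite -dt_wedgeB; congr (dt_wedge i _); apply/ffunP => A; rewrite !ffunE.
have [x Mx xb] := atlas_cover M (base b).
have xt : fdom x (tau k b) by rewrite /fdom /= base_tau.
rewrite (total_derivativeE i Mx xb oW Wb (smooth_formB oW sP sP' A)).
rewrite (total_derivativeE i Mx xb oW Wb (sP A)) (total_derivativeE i Mx xb oW Wb (sP' A)).
have dP := frep_diff Mx Wb xt (sP A); have dP' := frep_diff Mx Wb xt (sP' A).
rewrite -deriveB; [|exact: diff_derivable..].
congr ('D_ _ _ _); apply/funext => z; rewrite -[RHS]frepB.
by congr (frep x _ z); apply/funext => j; rewrite !ffunE.
Qed.

Lemma dT0 b : dT (fun=> 0 : ext R m s) b = 0.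
Proof.
rewrite /dT big1// => i _.
have -> : [ffun A => total_derivative i (fun j' : frame M m k => (0 : ext R m s) A) b] = 0.
  apply/ffunP => A; rewrite !ffunE /total_derivative big1// => al _; rewrite big1// => I _.
  by rewrite frep0 derive_cst mulr0.
by rewrite -[0 in LHS](subrr 0) dt_wedgeB subrr.
Qed.

Lemma dT_exact_germ0 b : dT_exact_germ b (fun=> 0 : ext R m s.+1).
Proof.
exists setT, (fun=> 0), 0; split => //; first exact: openT.
  move=> A x Mx.
  have -> : (fun j : frame M m k => (0 : ext R m s) A) = (fun=> 0) by apply/funext => j; rewrite ffunE.
  by rewrite frep0; exact: smooth_cst.
by apply: (@filterE _ (nbhs b)) => a; rewrite dT0 addr0.
Qed.

Lemma dT_exact_germB b Phi Phi' : dT_exact_germ b Phi -> dT_exact_germ b Phi' ->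
  dT_exact_germ b (fun a => Phi a - Phi' a).
Proof.
move=> [W [Psi [c [oW Wb sP HP]]]] [W' [Psi' [c' [oW' Wb' sP' HP']]]].
have oI : open (W `&` W') by exact: openI.
have sI : smooth_form (W `&` W') Psi by move=> A; apply: smooth_fun_sub (sP A) => j [].
have sI' : smooth_form (W `&` W') Psi' by move=> A; apply: smooth_fun_sub (sP' A) => j [].
exists (W `&` W'), (fun j => Psi j - Psi' j), (c - c'); split => //; first exact: smooth_formB.
have nI : nbhs b (tau k @^-1` (W `&` W')).
  by apply: (tau_continuous (leqnSn k)); apply: open_nbhs_nbhs.
apply: (@filterS _ (nbhs b) _ _ _ _ (filterI nI (filterI HP HP'))) => a [Wa [/= -> ->]].
by rewrite (dTB oI Wa sI sI') opprD addrACA.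
Qed.

(** The exact germs form a group, and Phi is in its own coset. *)
Lemma p0_eq0 b Phi : smooth_germ b Phi -> p0 b Phi = p0 b (fun=> 0) <-> dT_exact_germ b Phi.
Proof.
have sub0 (F : frame M m k.+1 -> ext R m s.+1) : (fun a => F a - 0) = F.
  by apply/funext => a; rewrite subr0.
move=> sPhi; split=> [e|ePhi].
  have : p0 b Phi Phi.
    split => //; have -> : (fun a => Phi a - Phi a) = fun=> 0 by apply/funext => a; rewrite subrr.
    exact: dT_exact_germ0.
  by rewrite e => -[_]; rewrite sub0.
apply/seteqP; split=> F [sF eF]; split => //; rewrite ?sub0 in eF *; last exact: dT_exact_germB.
have := dT_exact_germB eF (dT_exact_germB (dT_exact_germ0 b) ePhi).
have -> // : (fun a => F a - Phi a - (0 - Phi a)) = F.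
by apply/funext => a; rewrite sub0r opprK subrK.
Qed.

End ExactGerms.

Lemma first_row_lt (m : nat) (k : int) : (0 < m)%N -> - m%:Z < k -> (first_row k < m)%N.
Proof. by rewrite /first_row => ? ?; lia. Qed.

Lemma first_row_eq0 (k : int) : first_row k = 0%N \/ row_order k (first_row k) = 0%N.
Proof. by rewrite /row_order /first_row; lia. Qed.

Theorem mainTheorem7 (R : realType) (n m : nat) (m_gt0 : (0 < m)%N)
    (E : topologicalType) (M : smooth_manifold R n E)
    (k : int) (k_gt : - m%:Z < k) :
  [/\ (* exactness at the last two terms *)
      forall (s : nat), s.+1 = m ->
      forall b : frame M m (row_order k s).+1,
        (forall Phi : frame M m (row_order k s).+1 -> ext R m s.+1,
          smooth_germ b Phi ->
          (p0 b Phi = p0 b (fun=> 0) <-> dT_exact_germ b Phi)) /\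
        (forall X, Xi (s := s) b X ->
          exists2 Phi, smooth_germ b Phi & p0 b Phi = X),
      (* exactness in row s_0, where s_0 <= m - 1 *)
      forall (U : set (frame M m (row_order k (first_row k))))
        (Phi : frame M m (row_order k (first_row k)) -> ext R m (first_row k)),
        open U -> smooth_form U Phi ->
        locally_constant (tau (row_order k (first_row k)) @^-1` U) (dT Phi) ->
        locally_constant U Phi &
      (* exactness in the rows s = s'+1 with s_0 < s <= m - 1, with l = l'+1 *)
      forall s' : nat, (first_row k < s'.+1)%N -> (s'.+1 <= m.-1)%N ->
      forall (U : set (frame M m (row_order k s'.+1)))
        (Phi : frame M m (row_order k s'.+1) -> ext R m s'.+1),
        open U -> smooth_form U Phi ->
        locally_constant (tau (row_order k s'.+1) @^-1` U) (dT Phi) ->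
        exists2 l' : nat, (row_order k s'.+1 < l'.+1)%N &
          forall b : frame M m l'.+1, U (tau (row_order k s'.+1) b) ->
          exists W : set (frame M m l'.+1),
            [/\ open W, W b, W `<=` tau (row_order k s'.+1) @^-1` U &
              exists (W' : set (frame M m l')) (Psi : frame M m l' -> ext R m s')
                (c : ext R m s'.+1),
                [/\ open W', tau l' @` W `<=` W', smooth_form W' Psi &
                  forall a, W a ->
                    Phi (tau (row_order k s'.+1) a) = dT Psi a + c]]].
Proof.
split=> [s _ b|U Phi oU sPhi lc|s' _ sm U Phi oU sPhi lc].
- by split=> [Phi sPhi|X [Phi sPhi <-]]; [exact: p0_eq0|exists Phi].
- apply: (first_row_exact (first_row_lt m_gt0 k_gt) _ oU sPhi lc).
  exact: first_row_eq0.
- have s'm : (s'.+1 < m)%N by rewrite -(prednK m_gt0) ltnS.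
  exists (exact_order m (row_order k s'.+1)); first by rewrite ltnS exact_order_ge.
  exact: higher_row_exact.
Qed.
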